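(* Let $(M,\mathcal{Z},\omega)$ be a log symplectic manifold such that $\mathcal{Z}$ admits global defining functions. Then $M$ admits a stable almost complex structure. After choosing orientations on the line bundles $\mathcal{I}_Z$ for $Z\in\mathcal{Z}$, the construction of this stable almost complex structure is canonical up to homotopy.
   Context: $M^n$ is a connected manifold without boundary. A (simple) normal crossing divisor $\mathcal{Z}$ in $M$ is a finite collection of embedded connected hypersurfaces of real codimension $1$ in $M$ such that if $Z_1,\dots,Z_k\in\mathcal{Z}$ are distinct and $p\in Z_1\cap\cdots\cap Z_k$, there is a local coordinate chart $\varphi:U\to\mathbb{R}^n$ centred at $p$ that maps $Z_j\cap U$ into a subset of the coordinate hyperplane $x_j=0$ for $j=1,\dots,k$. The log tangent bundle $T_{\mathcal{Z}}M$ is the smooth rank $n$ vector bundle (a Lie algebroid) whose sheaf of smooth sections is the sheaf of local vector fields tangent to all $Z\in\mathcal{Z}$. Sections of $\wedge^\bullet T^*_{\mathcal{Z}}M$ are called log differential forms, and carry the Lie algebroid de Rham differential. A log symplectic form is a closed log $2$-form $\omega$ such that the map $T_{\mathcal{Z}}M\to T^*_{\mathcal{Z}}M$ induced by contraction with $\omega$ is an isomorphism; a log symplectic manifold $(M,\mathcal{Z},\omega)$ is a manifold with a normal crossing divisor $\mathcal{Z}$ and a log symplectic form $\omega$. For an embedded hypersurface $Z\subset M$, $\mathcal{I}_Z$ is the real line bundle whose sheaf of smooth sections is the sheaf of smooth real-valued functions vanishing on $Z$. A global defining function for $Z$ is a smooth real-valued function $f$ on $M$ with $f^{-1}(0)=Z$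 and $df|_Z$ non-vanishing. The divisor $\mathcal{Z}$ admits global defining functions if each $Z\in\mathcal{Z}$ admits a global defining function. A stable almost complex structure on $M$ is a complex structure on the vector bundle $\underline{\mathbb{R}}^p\oplus TM$ for some $p\ge0$, where $\underline{\mathbb{R}}^p$ is the trivial bundle. ''Canonical up to homotopy'' means that the structure constructed is determined up to homotopy once the orientations on the line bundles $\mathcal{I}_Z$ are chosen. *)

(* Defs.v *)
From mathcomp Require Import all_boot all_order all_algebra.
From mathcomp Require Import all_classical all_reals all_analysis.

Set Implicit Arguments.
Unset Strict Implicit.
Unset Printing Implicit Defensive.

Import Order.TTheory GRing.Theory Num.Theory.
Import numFieldNormedType.Exports.

Local Open Scope classical_set_scope.
Local Open Scope ring_scope.

Definition eqon {M T : Type} (U : set M) (f g : M -> T) : Prop :=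
  forall x, U x -> f x = g x.

Fixpoint Ck (R : realType) (n k : nat) (U : set 'rV[R]_n) (f : 'rV[R]_n -> R)
    : Prop :=
  (forall y, U y -> {for y, continuous f}) /\
  match k with
  | 0%N => True
  | k'.+1 => forall v : 'rV[R]_n,
      (forall y, U y -> derivable f y v) /\ Ck k' U ('D_v f)
  end.

Definition smooth_in (R : realType) (n : nat) (U : set 'rV[R]_n)
    (f : 'rV[R]_n -> R) : Prop := forall k, Ck k U f.

(* [param] is the inverse of [coord]; it is only meaningful on the open set
   [coord @` dom]. *)
Record chart (R : realType) (n : nat) (M : topologicalType) := Chart {
  dom : set M;
  coord : M -> 'rV[R]_n;
  param : 'rV[R]_n -> M;
  dom_open : open dom;
  range_open : open (coord @` dom);
  coordK : forall x, dom x -> param (coord x) = x;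
  coord_continuous : forall x, dom x -> {for x, continuous coord};
  param_continuous : forall y, (coord @` dom) y -> {for y, continuous param}
}.

Definition smooth_transition (R : realType) (n : nat) (M : topologicalType)
    (c d : chart R n M) : Prop :=
  forall j : 'I_n, smooth_in (coord c @` (dom c `&` dom d))
    (fun y => coord d (param c y) 0 j).

Definition compatible_charts (R : realType) (n : nat) (M : topologicalType)
    (c d : chart R n M) : Prop :=
  smooth_transition c d /\ smooth_transition d c.

(* Besides the atlas, a preferred chart around each point is fixed. The tangent
   space at x is 'rV_n, a vector being given by its coordinates in the
   preferred chart at x; [jac] below passes to the other charts. *)
Record smooth_structure (R : realType) (n : nat) (M : topologicalType) :=
  SmoothStructure {
    atlas : set (chart R n M);
    chart_at : M -> chart R n M;
    chart_at_atlas : forall x, atlas (chart_at x);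
    chart_at_dom : forall x, dom (chart_at x) x;
    atlas_compatible : forall c d, atlas c -> atlas d -> compatible_charts c d
  }.

Section Manifold.
Context {R : realType} {n : nat} {M : topologicalType}.
Variable S : smooth_structure R n M.

Definition smooth_chart (c : chart R n M) : Prop :=
  forall d, atlas S d -> compatible_charts c d.

Definition smooth_fun (U : set M) (f : M -> R) : Prop :=
  forall c, atlas S c ->
    smooth_in (coord c @` (U `&` dom c)) (fun y => f (param c y)).

Definition smooth_vec (m : nat) (U : set M) (a : M -> 'rV[R]_m) : Prop :=
  forall i, smooth_fun U (fun x => a x 0 i).

(* Change of basis of T_xM (acting on row vectors, on the right) from the
   preferred chart at x to the chart c. *)
Definition jac (c : chart R n M) (x : M) : 'M[R]_n :=
  let c0 := chart_at S x in
  jacobian (fun y : 'rV[R]_n => coord c (param c0 y)) (coord c0 x).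

Definition vfield : Type := M -> 'rV[R]_n.

Definition field_in_chart (c : chart R n M) (X : vfield) (y : 'rV[R]_n)
    : 'rV[R]_n := X (param c y) *m jac c (param c y).

Definition smooth_field (U : set M) (X : vfield) : Prop :=
  forall c, atlas S c -> forall j : 'I_n,
    smooth_in (coord c @` (U `&` dom c)) (fun y => field_in_chart c X y 0 j).

Definition smooth_covector (al : M -> 'cV[R]_n) : Prop :=
  forall (U : set M) (X : vfield), open U -> smooth_field U X ->
    smooth_fun U (fun x => (X x *m al x) 0 0).

Definition dfun (f : M -> R) (x : M) (v : 'rV[R]_n) : R :=
  let c := chart_at S x in 'D_v (fun y => f (param c y)) (coord c x).

Definition lie_der (X : vfield) (f : M -> R) (x : M) : R := dfun f x (X x).

Definition bracket (X Y : vfield) (x : M) : 'rV[R]_n :=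
  let c := chart_at S x in
  'D_(X x) (field_in_chart c Y) (coord c x)
  - 'D_(Y x) (field_in_chart c X) (coord c x).

Definition centred_chart (c : chart R n M) (p : M) : Prop :=
  [/\ smooth_chart c, dom c p & coord c p = 0].

Definition embedded_hypersurface (Z : set M) : Prop :=
  forall p, Z p -> exists c : chart R n M, exists j : 'I_n,
    centred_chart c p /\ forall x, dom c x -> (Z x <-> coord c x 0 j = 0).

(* The divisor is the finite set of the values of the injective family Z. *)
Definition normal_crossing (k : nat) (Z : 'I_k -> set M) : Prop :=
  [/\ injective Z,
      forall i, [/\ Z i !=set0, connected (Z i) & embedded_hypersurface (Z i)] &
      forall (m : nat) (s : 'I_m -> 'I_k) (p : M), injective s ->
        (forall j, Z (s j) p) ->
        exists (c : chart R n M) (le_mn : (m <= n)%N),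
          centred_chart c p /\
          forall (j : 'I_m) x, dom c x -> Z (s j) x ->
            coord c x 0 (widen_ord le_mn j) = 0].

Definition global_defining (Z : set M) (f : M -> R) : Prop :=
  [/\ smooth_fun [set: M] f,
      forall x, f x = 0 <-> Z x &
      forall x, Z x -> exists v, dfun f x v != 0].

(* Sections over U of the line bundle I_Z. *)
Definition vanishing (Z U : set M) (g : M -> R) : Prop :=
  smooth_fun U g /\ forall x, U x -> Z x -> g x = 0.

(* A frame of I_Z over U: a free generator of the sheaf of its sections. *)
Definition ideal_frame (Z U : set M) (f : M -> R) : Prop :=
  vanishing Z U f /\
  forall V g, open V -> V `<=` U -> vanishing Z V g ->
    exists h, [/\ smooth_fun V h, eqon V g (fun x => h x * f x) &
      forall h', smooth_fun V h' -> eqon V g (fun x => h' x * f x) ->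
        eqon V h' h].

(* An orientation O of I_Z selects, at each point x, the germs of sections g of
   I_Z whose value in the fibre at x is positive; it is required to be, locally,
   the orientation given by some frame f. Being a frame, f identifies the fibre
   at x with R by sending g = h f to h(x). *)
Definition orientation (Z : set M) (O : M -> (M -> R) -> Prop) : Prop :=
  forall x0, exists U f, [/\ open U, U x0, ideal_frame Z U f &
    forall V x g, open V -> V `<=` U -> V x -> vanishing Z V g ->
      (O x g <-> exists h,
         [/\ smooth_fun V h, eqon V g (fun y => h y * f y) & 0 < h x])].

Definition positive_frame (Z : set M) (O : M -> (M -> R) -> Prop) (f : M -> R)
    : Prop :=
  ideal_frame Z [set: M] f /\ forall x, O x f.

(* For an embedded hypersurface Z and p in Z, this is membership in T_pZ. *)
Definition tangent_to (Z : set M) (p : M) (v : 'rV[R]_n) : Prop :=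
  forall U g, open U -> U p -> vanishing Z U g -> dfun g p v = 0.

Section Log.
Context {k : nat}.
Variable Z : 'I_k -> set M.

Definition log_field (U : set M) (X : vfield) : Prop :=
  smooth_field U X /\ forall i x, U x -> Z i x -> tangent_to (Z i) x (X x).

(* Sheaf maps are encoded by one function on all fields: its values on U are
   only meaningful for fields that are log fields on U, and there they depend
   only on the restrictions to U. *)

Definition log_form1 (U : set M) (al : vfield -> M -> R) : Prop :=
  forall V, open V -> V `<=` U ->
  [/\ forall X, log_field V X -> smooth_fun V (al X),
      forall X Y, log_field V X -> log_field V Y -> eqon V X Y ->
        eqon V (al X) (al Y) &
      forall g X Y, smooth_fun V g -> log_field V X -> log_field V Y ->
        eqon V (al (fun x => g x *: X x + Y x))
               (fun x => g x * al X x + al Y x)].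

Definition log_form2 (w : vfield -> vfield -> M -> R) : Prop :=
  forall U, open U -> forall X, log_field U X ->
  [/\ log_form1 U (w X), log_form1 U (fun Y => w Y X) &
      eqon U (w X X) (fun=> 0)].

Definition log_closed2 (w : vfield -> vfield -> M -> R) : Prop :=
  forall U, open U -> forall X Y W : vfield,
  log_field U X -> log_field U Y -> log_field U W ->
  eqon U (fun x =>
       lie_der X (w Y W) x - lie_der Y (w X W) x + lie_der W (w X Y) x
       - w (bracket X Y) W x + w (bracket X W) Y x - w (bracket Y W) X x)
    (fun=> 0).

(* Contraction with w is an isomorphism from the sheaf of log fields onto the
   sheaf of log 1-forms. *)
Definition log_nondegenerate (w : vfield -> vfield -> M -> R) : Prop :=
  forall U, open U ->
  (forall al, log_form1 U al -> exists X, log_field U X /\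
     forall V Y, open V -> V `<=` U -> log_field V Y ->
       eqon V (w X Y) (al Y)) /\
  (forall X X', log_field U X -> log_field U X' ->
     (forall V Y, open V -> V `<=` U -> log_field V Y ->
        eqon V (w X Y) (w X' Y)) ->
     eqon U X X').

Definition log_symplectic (w : vfield -> vfield -> M -> R) : Prop :=
  [/\ normal_crossing Z, log_form2 w, log_closed2 w & log_nondegenerate w].

Definition log_complex (I : vfield -> vfield) : Prop :=
  forall U, open U ->
  [/\ forall X, log_field U X -> log_field U (I X),
      forall X Y, log_field U X -> log_field U Y -> eqon U X Y ->
        eqon U (I X) (I Y),
      forall g X Y, smooth_fun U g -> log_field U X -> log_field U Y ->
        eqon U (I (fun x => g x *: X x + Y x))
               (fun x => g x *: I X x + I Y x) &
      forall X, log_field U X -> eqon U (I (I X)) (fun x => - X x)].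

(* X is zero in the fibre of the log tangent bundle at x. On the divisor this is
   stronger than X x = 0. *)
Definition log_zero_at (x : M) (X : vfield) : Prop :=
  exists (U : set M) (m : nat) (g : 'I_m -> M -> R) (Y : 'I_m -> vfield),
  [/\ open U, U x,
      forall i, [/\ smooth_fun U (g i), log_field U (Y i) & g i x = 0] &
      eqon U X (fun y => \sum_i g i y *: Y i y)].

Definition log_compatible (w : vfield -> vfield -> M -> R) (I : vfield -> vfield)
    : Prop :=
  [/\ log_complex I,
      forall U, open U -> forall X Y, log_field U X -> log_field U Y ->
        eqon U (w (I X) (I Y)) (w X Y) &
      forall U, open U -> forall X x, log_field U X -> U x ->
        ~ log_zero_at x X -> 0 < w X (I X) x].

End Log.

(* An endomorphism of the bundle R^p + TM, as a matrix acting on row vectors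
   row_mx a v on the right, with v in the preferred chart at x. *)
Definition end_in_chart (p : nat) (c : chart R n M) (J : M -> 'M[R]_(p + n))
    (x : M) : 'M[R]_(p + n) :=
  let T := block_mx 1%:M 0 0 (jac c x) in invmx T *m J x *m T.

Definition stable_acs (p : nat) (J : M -> 'M[R]_(p + n)) : Prop :=
  (forall x, J x *m J x = - 1%:M) /\
  forall c, atlas S c -> forall i j,
    smooth_in (coord c @` dom c) (fun y => end_in_chart c J (param c y) i j).

Definition homotopic_acs (p : nat) (J J' : M -> 'M[R]_(p + n)) : Prop :=
  exists H : R -> M -> 'M[R]_(p + n),
  [/\ H 0 = J, H 1 = J',
      forall t, 0 <= t <= 1 -> stable_acs (H t) &
      forall c, atlas S c ->
        {within [set q : R * M | 0 <= q.1 <= 1 /\ dom c q.2],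
          continuous (fun q : R * M => end_in_chart c (H q.1) q.2)}].

(* Let E be the bundle with sections the (u, g) in TM + R^k such that
   df_i(u) = g_i on Z_i for all i, where f_i is a positive frame of I_(Z_i)
   (so g_i stands for the section g_i / f_i of the dual of I_(Z_i)).
   It sits in two exact sequences
     0 -> T_Z M -> E -> R^k -> 0     (u, g) |-> g,
     0 -> R^k -> E -> TM -> 0        b |-> (0, (f_i b_i)_i),  (u, g) |-> u.
   The splittings of the first one are given by fields nu_j with
   df_i(nu_j) = delta_ij on Z_i, those of the second one by 1-forms al_i,
   via u |-> (u, (df_i(u) + f_i al_i(u))_i). *)
Definition splitting_data (k : nat) (Z : 'I_k -> set M) (f : 'I_k -> M -> R)
    (nu : 'I_k -> vfield) (al : 'I_k -> M -> 'cV[R]_n) : Prop :=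
  [/\ forall j, smooth_field [set: M] (nu j),
      forall i j x, Z i x -> dfun (f i) x (nu j x) = (i == j)%:R &
      forall i, smooth_covector (al i)].

(* Over U, the resulting isomorphism T_Z M + R^k ~ E ~ TM + R^k sends the
   section (X, a) to the section (v, b). *)
Definition splitting_iso (k : nat) (f : 'I_k -> M -> R) (nu : 'I_k -> vfield)
    (al : 'I_k -> M -> 'cV[R]_n) (U : set M)
    (X : vfield) (a : M -> 'rV[R]_k) (v : vfield) (b : M -> 'rV[R]_k) : Prop :=
  [/\ eqon U v (fun x => X x + \sum_j a x 0 j *: nu j x),
      smooth_vec U b &
      forall i x, U x ->
        a x 0 i = dfun (f i) x (v x)
                  + f i x * (b x 0 i + (v x *m al i x) 0 0)].

(* J is obtained from w and the orientations O_i of the I_(Z_i): it is the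
   transport to R^k + R^k + TM, along the isomorphism above on the last two
   summands, of the structure on R^k + R^k + T_Z M that is (a', a) |-> (-a, a')
   on R^k + R^k (that is, multiplication by i on a' + i a) and a w-compatible
   complex structure I on T_Z M. *)
Definition constructed (k : nat) (Z : 'I_k -> set M)
    (w : vfield -> vfield -> M -> R) (O : 'I_k -> M -> (M -> R) -> Prop)
    (J : M -> 'M[R]_((k + k) + n)) : Prop :=
  exists (f : 'I_k -> M -> R) (nu : 'I_k -> vfield)
    (al : 'I_k -> M -> 'cV[R]_n) (I : vfield -> vfield),
  [/\ forall i, positive_frame (Z i) (O i) (f i),
      splitting_data Z f nu al,
      log_compatible Z w I &
      forall U X (a a' : M -> 'rV[R]_k) v b v' b',
        open U -> log_field Z U X -> smooth_vec U a -> smooth_vec U a' ->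
        splitting_iso f nu al U X a v b ->
        splitting_iso f nu al U (I X) a' v' b' ->
        eqon U (fun x => row_mx (row_mx (a' x) (b x)) (v x) *m J x)
               (fun x => row_mx (row_mx (- a x) (b' x)) (v' x))].

End Manifold.

(* Main.v *)
(** A complex structure compatible with [w] exists near every point, by splitting
   off [w]-symplectic planes of log fields one at a time (Schur complements). Two
   of them, [A0] and [A1], are joined by the path of compatible structures
   [K^-1 A0 K] with [K = (2 - s) A0 + s A1], and this interpolation replaces
   convexity in a partition of unity argument: it yields a global [I]. The normal
   fields [nu] are glued in the same way.

   In a log frame the isomorphism of [T_Z M + R^k] with [TM + R^k] given by the
   splittings is a matrix of smooth functions. It is invertible, since any local
   section [(v, b)] comes from [a_i = df_i(v) + f_i (b_i + al_i(v))] and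
   [X = v - sum_j a_j nu_j]. This transports the structure to a smooth [J], which
   is determined by [f], [nu], [al] and [I].

   Let [J] and [J'] come from two choices. The positive frames differ by positive
   functions [h_i], and after conjugating [J'] by some [g], which a segment joins
   to the identity, both structures send the component [a] to [- a] in the first
   copy of [R^k] and take it back from there. So a vector in the kernel of
   [(2 - t) J + t J'] comes from [T_Z M], where positivity of [I] and [I'] makes
   it vanish; conjugating [J] by these invertible endomorphisms gives the
   homotopy. *)

(* The difficulty sits on the divisor. There a log field such as [x d/dx] vanishes as a vector
   without being zero in the fibre of [T_Z M], so [T_Z M] is only handled through coefficients in
   local log frames. Likewise [b] enters [splitting_iso] multiplied by [f], hence is not determined
   pointwise on the divisor. It is recovered as a smooth quotient: Hadamard's lemma divides by a
   coordinate, and the frame property of [f] cancels factors that vanish on the divisor.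

   In the other direction [a] is an explicit smooth function of [(v, b)]. So [a'] and [a] are
   functionals on [R^k + R^k + TM] that do not involve [I], and [J] exchanges them up to sign. This
   rigidity is what makes the homotopy work, since positivity is known only on [T_Z M].

   A normal crossing chart only puts each hypersurface inside a coordinate hyperplane. The defining
   functions turn this into an equality near the point, and make the hypersurfaces closed. The
   orientations enter through the sign of [h_i = f'_i / f_i]: for positive [h_i] the segment from 1
   to [1 / h_i] avoids 0. *)
Require Import Defs.
From HB Require Import structures.
From mathcomp Require Import all_boot all_order all_algebra.
From mathcomp Require Import all_classical all_reals all_analysis.
From mathcomp Require Import perm ring lra.
(* Imported again because MathComp's [vector] has its own [coord]. *)
Require Import Defs.

Set Implicit Arguments.
Unset Strict Implicit.
Unset Printing Implicit Defensive.

Import Order.TTheory GRing.Theory Num.Theory.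
Import numFieldNormedType.Exports.

Local Open Scope classical_set_scope.
Local Open Scope ring_scope.

(** * Smooth functions on R^n *)

Lemma near_all (T : nbhsType) (I : finType) (P : I -> T -> Prop) (F : set_system T) :
  Filter F -> (forall i, F (P i)) -> F (fun z => forall i, P i z).
Proof. by move=> FF; apply: filter_forall. Qed.

Section Directional.
Context {R : realType} {V : normedModType R}.
Implicit Types (f : V -> R) (x v : V).

Lemma is_derive_line f x v s : derivable f (x + s *: v) v ->
  is_derive s (1 : R) (fun t : R => f (x + t *: v)) ('D_v f (x + s *: v)).
Proof.
move=> df.
have E : (fun h : R => h^-1 *: (((fun t : R => f (x + t *: v)) \o shift s) (h *: (1:R)) - f (x + s *: v)))
  = (fun h : R => h^-1 *: ((f \o shift (x + s *: v)) (h *: v) - f (x + s *: v))).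
  apply/funext => h /=; congr (_ *: (f _ - _)).
  by rewrite [h%:A]mulr1 scalerDl addrCA.
by apply: DeriveDef; rewrite /derivable /derive E.
Qed.

(** [f] is derivable only along [v], so no differential is available; on a line the claim is the
    one-variable chain rule for [h |-> c h]. It serves before differentiability is known, in
    [C1_differentiable]. *)
Lemma is_derive_scale f x v (c : R) : derivable f x v ->
  is_derive x (c *: v) f (c * 'D_v f x).
Proof.
move=> df.
have := @is_derive_line f x v 0; rewrite scale0r addr0 => /(_ df) [dl el].
have /derivable1_diffP dl' := dl.
have dc : is_derive (0 : R) (1 : R) (fun h : R => c * h) c.
  by apply: is_derive_eq; rewrite [LHS]mulr1.
have dg : differentiable (fun t : R => f (x + t *: v)) (c * (0 : R)) by rewrite mulr0.
have E : (fun h : R => f (h *: (c *: v) + x)) = (fun t : R => f (x + t *: v)) \o (fun h : R => c * h).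
  by apply/funext => h /=; rewrite addrC scalerA mulrC.
have dE : derivable (fun h : R => f (h *: (c *: v) + x)) 0 1.
  rewrite E; apply/derivable1_diffP; apply: differentiable_comp => //.
have dx : derivable f x (c *: v) by apply/derivable1P.
apply: DeriveDef => //.
have := @is_derive_line f x (c *: v) 0; rewrite scale0r addr0 => /(_ dx) [_ <-].
have -> : (fun t : R => f (x + t *: (c *: v))) = (fun t : R => f (x + t *: v)) \o (fun h : R => c * h).
  by apply/funext => h /=; rewrite scalerA mulrC.
rewrite -derive1E derive1_comp; last 2 first.
- by case: dc.
- by rewrite mulr0.
by rewrite mulr0 !derive1E el mulrC; case: dc => _ ->.
Qed.

End Directional.

Section C1.
Context {R : realType} {n : nat}.
Implicit Types (f : 'rV[R]_n -> R) (x y v h : 'rV[R]_n).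
Local Notation e_ j := (delta_mx 0 j : 'rV[R]_n).

Lemma mx_norm_entry v j : `|v 0 j| <= `|v|.
Proof. by rewrite [leRHS]/Num.Def.normr /= mx_normrE; apply: (le_bigmax _ (fun ij => `|v ij.1 ij.2|) (0, j)). Qed.

Lemma mx_norm_le v (e : R) : 0 <= e -> (forall j, `|v 0 j| <= e) -> `|v| <= e.
Proof.
move=> e0 H; rewrite [leLHS]/Num.Def.normr /= mx_normrE; apply: bigmax_le => // -[i j] _.
by rewrite ord1.
Qed.

(** The points [y + row_trunc m h] lead from [y] to [y + h] along one coordinate axis at a time. *)
Definition row_trunc (m : nat) h : 'rV[R]_n := \row_j (if (j < m)%N then h 0 j else 0).

Lemma row_truncS (j : 'I_n) h : row_trunc j.+1 h = row_trunc j h + h 0 j *: e_ j.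
Proof.
apply/rowP => l; rewrite !mxE eqxx /= ltnS leq_eqVlt -val_eqE /=.
by case: ltngtP => //= lj; rewrite ?mulr0 ?addr0 ?add0r //; rewrite (val_inj lj) mulr1.
Qed.

(** Along the path of truncations each increment of [f] is, by the mean value theorem, an entry of
    [h] times a partial derivative at a nearby point; continuity of the partial derivatives at [y]
    does the rest. *)
Lemma C1_differentiable f y (U : set 'rV[R]_n) : open U -> U y ->
  (forall z v, U z -> derivable f z v) ->
  (forall v, {for y, continuous ('D_v f)}) ->
  differentiable f y.
Proof.
move=> oU Uy df cf.
pose L h := \sum_j h 0 j * 'D_(e_ j) f y.
have linL : linear L.
  move=> a u v; rewrite /L scaler_sumr -big_split /=; apply: eq_bigr => j _.
  by rewrite !mxE [a *: _]mulrA -mulrDl.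
pose L' : {linear 'rV[R]_n -> R} := HB.pack L (GRing.isLinear.Build _ _ _ _ _ linL).
have cL : continuous L.
  move=> z; rewrite /L; apply: (@cvg_big _ _ +%R) => [||j _]; first exact: add_continuous.
    exact: (nbhs_filter z).
  have := @cvgMr_tmp R _ _ (nbhs_filter z) (fun x : 'rV[R]_n => x 0 j) (z 0 j) ('D_(e_ j) f y).
  by apply; exact: (@matrix_normedtype.coord_continuous R 1 n 0 j z).
have oL : (f : 'rV[R]_n -> R^o) \o shift y = cst (f y) + (L : 'rV[R]_n -> R^o) +o_ (0 : 'rV[R]_n) id.
  apply/eqaddoP => _/posnumP[e].
  (* One share of the error for each axis; [n.+1] keeps the divisor nonzero for [n = 0]. *)
  have [d d0 Hd] : exists2 d : R, 0 < d & forall z, `|z - y| < d -> U z /\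
     forall j, `|'D_(e_ j) f z - 'D_(e_ j) f y| <= e%:num / n.+1%:R.
    have nU : nbhs y U by apply: open_nbhs_nbhs.
    have : \forall z \near y, U z /\ forall j, `|'D_(e_ j) f z - 'D_(e_ j) f y| <= e%:num / n.+1%:R.
      have nD : \forall z \near y, forall j, `|'D_(e_ j) f z - 'D_(e_ j) f y| <= e%:num / n.+1%:R.
        apply: near_all => j.
        have /cvgrPdist_le := cf (e_ j) => /(_ (e%:num / n.+1%:R)).
        rewrite divr_gt0 // => /(_ isT); apply: filterS => z.
        by rewrite distrC.
      by apply: (@filterS2 _ _ (nbhs_filter y) _ _ _ _ nU nD).
    move=> /nbhs_ballP [d d0 H]; exists d => // z zd; apply: H.
    by rewrite -ball_normE /= distrC.
  have := @nbhs0_lt R 'rV[R]_n d d0; apply: filterS => h hd.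
  have T m : `|row_trunc m h| <= `|h|.
    apply: mx_norm_le => // j; rewrite mxE; case: ifP => _; first exact: mx_norm_entry.
    by rewrite normr0.
  have K m : (m <= n)%N -> `|f (y + row_trunc m h) - f y - \sum_(j < n | (j < m)%N) h 0 j * 'D_(e_ j) f y|
      <= m%:R * (e%:num / n.+1%:R) * `|h|.
    elim: m => [_|m IH mn].
      rewrite big_pred0 // !mul0r subr0.
      have -> : row_trunc 0 h = 0 by apply/rowP => j; rewrite !mxE.
      by rewrite addr0 subrr normr0.
    pose jm := Ordinal mn.
    rewrite (bigD1 jm) //=.
    rewrite (eq_bigl (fun j : 'I_n => (j < m)%N)); last first.
      by move=> j; rewrite -val_eqE /= ltnS; case: ltngtP.
    have := row_truncS jm h => /= ->.
    (* For the sup norm every intermediate point stays within [|h|] of [y]. *)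
    have Us (s : R) : s \in `[0, 1] -> U (y + row_trunc m h + s *: (h 0 jm *: e_ jm)) /\
       forall j, `|'D_(e_ j) f (y + row_trunc m h + s *: (h 0 jm *: e_ jm)) - 'D_(e_ j) f y| <= e%:num / n.+1%:R.
      rewrite in_itv /= => /andP[s0 s1]; apply: Hd.
      rewrite [X in `|X|]addrC !addrA addNr add0r.
      apply: le_lt_trans hd; apply: mx_norm_le => // j; rewrite !mxE eqxx /=.
      have [/eqP jE|jE] := boolP (j == jm).
        rewrite jE ltnn add0r mulr1 normrM ger0_norm //.
        by apply: le_trans (mx_norm_entry h jm); rewrite ler_piMl.
      rewrite !mulr0 addr0; case: ifP => _; first exact: mx_norm_entry.
      by rewrite normr0.
    have := @MVT_segment R (fun s : R => f (y + row_trunc m h + s *: (h 0 jm *: e_ jm)))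
      (fun s => 'D_(h 0 jm *: e_ jm) f (y + row_trunc m h + s *: (h 0 jm *: e_ jm))) 0 1 ler01.
    case.
    - move=> s s01; apply: is_derive_line; apply: df.
      by apply: (Us _ _).1; apply: subset_itv_oo_cc.
    - apply: derivable_within_continuous => s s01.
      have [] := @is_derive_line _ _ f (y + row_trunc m h) (h 0 jm *: e_ jm) s => //.
      by apply: df; apply: (Us _ _).1.
    move=> s s01; rewrite scale1r scale0r addr0 subr0 mulr1 addrA => E.
    rewrite -(subrK (f (y + row_trunc m h)) (f (y + row_trunc m h + _))) E.
    have [Usz Usj] := Us s s01.
    have [_ ->] := is_derive_scale (h 0 jm) (df _ (e_ jm) Usz).
    set A := 'D_ _ f (_ + _); set B := 'D_(e_ jm) f y; set S := \sum_(_ < _ | _) _.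
    have -> : h 0 jm * A + f (y + row_trunc m h) - f y - (h 0 jm * B + S) =
      h 0 jm * (A - B) + (f (y + row_trunc m h) - f y - S) by ring.
    rewrite (le_trans (ler_normD _ _)) // -natr1 !mulrDl mul1r addrC lerD //.
      by apply: IH; apply: ltnW.
    rewrite normrM mulrC ler_pM //; first exact: Usj.
    exact: mx_norm_entry.
  have := K n (leqnn n).
  have -> : row_trunc n h = h by apply/rowP => j; rewrite !mxE ltn_ord.
  rewrite (eq_bigl xpredT); last by move=> j; rewrite ltn_ord.
  have -> : (f \o shift y - (cst (f y) + L)) h = f (y + h) - f y - L h.
    transitivity (f (h + y) - (f y + L h)); first by [].
    by rewrite [h + y]addrC opprD addrA.
  move=> /le_trans; apply.
  rewrite ler_wpM2r // mulrCA ler_piMr // ler_pdivrMr // mul1r ler_nat //.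
have E := @diff_unique R _ _ f L' y cL oL.
by apply/diff_locallyP; split; rewrite E.
Unshelve. all: by end_near. Qed.

End C1.

Section ChainRule.
Context {R : realType}.

Lemma is_derive_line0 (V W : normedModType R) (f : V -> W) x v df :
  is_derive (0 : R) (1 : R) (fun h : R => f (h *: v + x)) df <-> is_derive x v f df.
Proof.
have E : (fun h : R => h^-1 *: (((fun h : R => f (h *: v + x)) \o shift 0) (h *: (1:R)) - f (0 *: v + x)))
  = (fun h : R => h^-1 *: ((f \o shift x) (h *: v) - f x)).
  by apply/funext => h /=; rewrite addr0 [h%:A]mulr1 scale0r add0r.
by split => -[d e]; apply: DeriveDef; move: d e; rewrite /derivable /derive E.
Qed.

(** [f] is derivable only in the direction [v]. On a line this is differentiability, so the chain
    rule for differentials applies to the restriction. *)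
Lemma is_derive_comp (V W W' : normedModType R) (g : W -> W') (f : V -> W) y v df :
  is_derive y v f df -> differentiable g (f y) ->
  is_derive y v (g \o f) ('d g (f y) df).
Proof.
move=> /is_derive_line0 [d e] dg; apply/is_derive_line0.
have dl := (derivable1_diffP _ _).1 d.
have dg' : differentiable g (f (0 *: v + y)) by rewrite scale0r add0r.
have dc := @differentiable_comp R R W W' (fun h : R => f (h *: v + y)) g 0 dl dg'.
apply: DeriveDef; first by apply/derivable1_diffP.
rewrite -derive1E derive1E' //.
have -> : 'd (fun h : R => (g \o f) (h *: v + y)) 0 = 'd (g \o (fun h : R => f (h *: v + y))) 0 by [].
rewrite diff_comp //= scale0r add0r; congr ('d g _ _).
by rewrite -e -derive1E derive1E'.
Qed.

Lemma is_derive_comp1 (V : normedModType R) (g : R -> R) (f : V -> R) y v df dg :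
  is_derive y v f df -> is_derive (f y) 1 g dg -> is_derive y v (g \o f) (dg * df).
Proof.
move=> Hf [d e].
have := is_derive_comp Hf ((derivable1_diffP _ _).1 d).
rewrite diff1E; last exact: (derivable1_diffP _ _).1 d.
by rewrite derive1E e mulrC.
Qed.

Lemma diff_delta m (g : 'rV[R]_m -> R) p u : differentiable g p ->
  'd g p u = \sum_j u 0 j * 'D_(delta_mx 0 j) g p.
Proof.
move=> dg; rewrite {1}(row_sum_delta u) linear_sum; apply: eq_bigr => j _.
by rewrite linearZ -deriveE.
Qed.

Lemma derive_delta m (g : 'rV[R]_m -> R) p u : differentiable g p ->
  'D_u g p = \sum_j u 0 j * 'D_(delta_mx 0 j) g p.
Proof. by move=> dg; rewrite deriveE // diff_delta. Qed.

Lemma is_derive_row (V : normedModType R) m (f : V -> 'rV[R]_m) y v :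
  (forall j, derivable (fun z => f z 0 j) y v) ->
  is_derive y v f (\row_j 'D_v (fun z => f z 0 j) y).
Proof.
move=> d; have df : derivable f y v by apply/derivable_mxP => i j; rewrite ord1.
apply: DeriveDef => //; rewrite derive_mx //; apply/rowP => j; by rewrite !mxE.
Qed.

Lemma is_derive_compn (V : normedModType R) m (g : 'rV[R]_m -> R) (f : V -> 'rV[R]_m) y v :
  (forall j, derivable (fun z => f z 0 j) y v) -> differentiable g (f y) ->
  is_derive y v (g \o f)
    (\sum_j 'D_v (fun z => f z 0 j) y * 'D_(delta_mx 0 j) g (f y)).
Proof.
move=> d dg; have := is_derive_comp (is_derive_row d) dg.
by rewrite diff_delta //; under eq_bigr do rewrite mxE.
Qed.

End ChainRule.

Section CkTheory.
Context {R : realType} {n : nat}.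
Implicit Types (f g : 'rV[R]_n -> R) (U V : set 'rV[R]_n).

Lemma near_eqon (T : topologicalType) (S : Type) (U : set T) (f g : T -> S) y :
  open U -> U y -> eqon U f g -> \forall z \near y, f z = g z.
Proof.
move=> oU Uy fg; have : nbhs y U by apply: open_nbhs_nbhs.
by apply: filterS => z /fg.
Qed.

Lemma cvg_eqon (T S : topologicalType) (U : set T) (f g : T -> S) (y : T) (l : S) :
  open U -> U y -> eqon U f g -> f x @[x --> y] --> l -> g x @[x --> y] --> l.
Proof.
move=> oU Uy fg H; apply: cvg_trans H; apply: near_eq_cvg.
exact: near_eqon oU Uy fg.
Qed.

Lemma Ck_cont k U f y : Ck k U f -> U y -> {for y, continuous f}.
Proof. by case: k => [|k] [c _]; apply: c. Qed.

Lemma CkS k U f : Ck k.+1 U f -> (forall v y, U y -> derivable f y v) /\ (forall v, Ck k U ('D_v f)).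
Proof. by move=> [_ H]; split=> v; have [] := H v. Qed.

(** [V] need not be open: [Ck] only collects conditions at the points of its set, all about the same
    globally defined derivatives. *)
Lemma Ck_loc k U f : (forall y, U y -> exists V, V y /\ Ck k V f) -> Ck k U f.
Proof.
elim: k f => [|k IH] f H; split=> //.
- by move=> y /H [V [Vy [c _]]]; apply: c.
- by move=> y /H [V [Vy [c _]]]; apply: c.
- move=> v; split; first by move=> y /H [V [Vy /CkS[d _]]]; apply: d.
  by apply: IH => y /H [V [Vy /CkS[_ d]]]; exists V.
Qed.

Lemma Ck_sub k U V f : V `<=` U -> Ck k U f -> Ck k V f.
Proof.
elim: k f => [|k IH] f VU [c d]; split=> //; [by move=> y /VU; apply: c..|].
move=> v; have [d1 d2] := d v; split; last exact: IH.
by move=> y /VU; apply: d1.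
Qed.

Lemma Ck_eq k U f g : open U -> eqon U f g -> Ck k U f -> Ck k U g.
Proof.
move=> oU.
have C (h1 h2 : 'rV[R]_n -> R) : eqon U h1 h2 -> (forall y, U y -> {for y, continuous h1}) ->
    (forall y, U y -> {for y, continuous h2}).
  move=> fg c y Uy; have := c y Uy; rewrite /prop_for /continuous_at -(fg y Uy).
  exact: cvg_eqon oU Uy fg.
elim: k f g => [|k IH] f g fg [c d]; split=> //; [exact: C c|exact: C c|].
move=> v; have [d1 d2] := d v; split.
  by move=> y Uy; apply: near_eq_derivable (d1 _ Uy); apply: near_eqon fg.
by apply: IH d2 => y Uy; apply: near_eq_derive; apply: near_eqon fg.
Qed.

Lemma Ck_dec k U f : Ck k.+1 U f -> Ck k U f.
Proof.
elim: k f => [|k IH] f [c d]; split=> // v.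
by have [d1 d2] := d v; split=> //; apply: IH.
Qed.

Lemma Ck_cst k U (a : R) : Ck k U (fun=> a).
Proof.
elim: k a => [|k IH] a; (split; first by move=> y _; apply: cst_continuous); first by [].
move=> v; split; first by move=> y _; apply: derivable_cst.
have -> : 'D_v (fun=> a) = (fun=> 0) :> ('rV[R]_n -> R) by apply/funext => y; apply: derive_cst.
exact: IH.
Qed.

Lemma Ck_coord k U j : Ck k U (fun y => y 0 j).
Proof.
have D v y : is_derive y v (fun y : 'rV[R]_n => y 0 j : R) (v 0 j).
  have E := @derive_mx R 'rV[R]_n 1 n id y v (@derivable_id _ _ _ _).
  apply: DeriveDef.
    have := (@derivable_mxP R 'rV[R]_n 1 n id y v).1 (@derivable_id _ _ _ _) 0 j. by [].
  by move: E; rewrite derive_id => /rowP /(_ j); rewrite mxE => <-.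
case: k => [|k]; (split; first by move=> y _; apply: matrix_normedtype.coord_continuous); first by [].
move=> v; split; first by move=> y _; case: (D v y).
have -> : 'D_v (fun y : 'rV[R]_n => y 0 j) = (fun=> v 0 j).
  by apply/funext => y; case: (D v y).
exact: Ck_cst.
Qed.

Lemma CkD k U f g : open U -> Ck k U f -> Ck k U g -> Ck k U (fun y => f y + g y).
Proof.
move=> oU; elim: k f g => [|k IH] f g Hf Hg;
  (split; first by move=> y Uy; apply: (@continuousD _ R^o) ; apply: Ck_cont Uy; eassumption); first by [].
move=> v; have [df Df] := CkS Hf; have [dg Dg] := CkS Hg; split.
  by move=> y Uy; apply: derivableD; [apply: df|apply: dg].
apply: Ck_eq (IH _ _ (Df v) (Dg v)) => // y Uy.
by have /= <- := deriveD (df v y Uy) (dg v y Uy).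
Qed.

Lemma CkM k U f g : open U -> Ck k U f -> Ck k U g -> Ck k U (fun y => f y * g y).
Proof.
move=> oU; elim: k f g => [|k IH] f g Hf Hg;
  (split; first by move=> y Uy; apply: (@continuousM R) ; apply: Ck_cont Uy; eassumption); first by [].
move=> v; have [df Df] := CkS Hf; have [dg Dg] := CkS Hg; split.
  by move=> y Uy; apply: derivableM; [apply: df|apply: dg].
apply: Ck_eq (CkD oU (IH _ _ (Ck_dec Hf) (Dg v)) (IH _ _ (Ck_dec Hg) (Df v))) => // y Uy.
by have /= -> := deriveM (df v y Uy) (dg v y Uy).
Qed.

Lemma CkN k U f : open U -> Ck k U f -> Ck k U (fun y => - f y).
Proof.
move=> oU Hf; apply: Ck_eq (CkM oU (Ck_cst k U (-1)) Hf) => // y _.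
by rewrite mulN1r.
Qed.

Lemma Ck_sum k U (I : Type) (r : seq I) (P : pred I) (F : I -> 'rV[R]_n -> R) : open U ->
  (forall i, P i -> Ck k U (F i)) -> Ck k U (fun y => \sum_(i <- r | P i) F i y).
Proof.
move=> oU H; elim: r => [|i r IH].
  by apply: Ck_eq (Ck_cst k U 0) => // y _; rewrite big_nil.
have [Pi|Pi] := boolP (P i).
  by apply: Ck_eq (CkD oU (H i Pi) IH) => // y _; rewrite big_cons Pi.
by apply: Ck_eq IH => // y _; rewrite big_cons (negbTE Pi).
Qed.

Lemma Ck_prod k U (I : Type) (r : seq I) (P : pred I) (F : I -> 'rV[R]_n -> R) : open U ->
  (forall i, P i -> Ck k U (F i)) -> Ck k U (fun y => \prod_(i <- r | P i) F i y).
Proof.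
move=> oU H; elim: r => [|i r IH].
  by apply: Ck_eq (Ck_cst k U 1) => // y _; rewrite big_nil.
have [Pi|Pi] := boolP (P i).
  by apply: Ck_eq (CkM oU (H i Pi) IH) => // y _; rewrite big_cons Pi.
by apply: Ck_eq IH => // y _; rewrite big_cons (negbTE Pi).
Qed.

Lemma CkV k U f : open U -> (forall y, U y -> f y != 0) -> Ck k U f -> Ck k U (fun y => (f y)^-1).
Proof.
move=> oU f0; elim: k => [|k IH] Hf;
  (split; first by move=> y Uy; apply: (@continuousV R) ; [apply: f0|apply: Ck_cont Uy; eassumption]); first by [].
have IH' := IH (Ck_dec Hf).
move=> v; have [df Df] := CkS Hf; split.
  by move=> y Uy; apply: derivableV; [apply: f0|apply: df].
apply: Ck_eq (CkN oU (CkM oU (CkM oU IH' IH') (Df v))) => // y Uy.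
have /= -> := deriveV (f0 y Uy) (df v y Uy).
by rewrite /GRing.scale /= -mulNr expr2 invfM.
Qed.

(** The outer function comes with all its derivatives, [phi m.+1] being that of [phi m], so that the
    induction on [k] covers the factor [phi m.+1 (f y)] of the derivative. *)
Lemma Ck_comp1 k U f (phi : nat -> R -> R) (W : set R) : open U ->
  (forall m x, W x -> is_derive x 1 (phi m) (phi m.+1 x)) -> (forall y, U y -> W (f y)) ->
  Ck k U f -> forall m, Ck k U (fun y => phi m (f y)).
Proof.
move=> oU dphi fW; elim: k => [|k IH] Hf m;
  (split; first by move=> y Uy; apply: (@continuous_comp _ _ _ f (phi m)); [apply: Ck_cont Uy; eassumption |
     apply: differentiable_continuous; apply/derivable1_diffP; have [] := dphi m (f y) (fW _ Uy) ]); first by [].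
have IH' := IH (Ck_dec Hf).
move=> v; have [df Df] := CkS Hf.
have D y : U y -> is_derive y v (phi m \o f) (phi m.+1 (f y) * 'D_v f y).
  move=> Uy; apply: is_derive_comp1; last by apply: dphi; apply: fW.
  by apply: derivableP; apply: df.
split; first by move=> y Uy; have [] := D y Uy.
by apply: Ck_eq (CkM oU (IH' m.+1) (Df v)) => // y Uy; have [_ <-] := D y Uy.
Qed.

End CkTheory.

Lemma continuous_row (R : realType) (T : topologicalType) m (f : T -> 'rV[R]_m) y :
  (forall j, {for y, continuous (fun z => f z 0 j)}) -> {for y, continuous f}.
Proof.
move=> H; apply/cvg_ballP => e e0.
have : \forall z \near y, forall j, ball (f y 0 j) e (f z 0 j).
  by apply: near_all => j; have /cvg_ballP := H j; apply.
by apply: filterS => z Hz; split=> // i j; rewrite ord1.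
Qed.

Section Smooth.
Context {R : realType}.

Lemma smooth_in_differentiable n (U : set 'rV[R]_n) f y : open U -> U y -> smooth_in U f -> differentiable f y.
Proof.
move=> oU Uy H; have [d c] := CkS (H 1%N); apply: (@C1_differentiable R n f y U) => //.
- by move=> z v Uz; apply: d.
- by move=> v; apply: Ck_cont Uy.
Qed.

(** [g] is smooth to all orders while [f] is only [Ck]: the induction on [k] is then available for
    the partial derivatives of [g]. *)
Lemma Ck_comp n m (U : set 'rV[R]_n) (W : set 'rV[R]_m) k g (f : 'rV[R]_n -> 'rV[R]_m) :
  open U -> open W -> (forall y, U y -> W (f y)) ->
  (forall j, Ck k U (fun y => f y 0 j)) -> smooth_in W g -> Ck k U (g \o f).
Proof.
move=> oU oW fW; elim: k g => [|k IH] g Hf Hg.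
  split=> // y Uy; apply: (@continuous_comp _ _ _ f g).
    by apply: continuous_row => j; apply: Ck_cont (Hf j) Uy.
  by apply: Ck_cont (Hg 0%N) _; apply: fW.
have Hfk j := Ck_dec (Hf j).
have IH' g' := IH g' Hfk.
have D v y : U y -> is_derive y v (g \o f) _ := fun Uy => @is_derive_compn R _ m g f y v
   (fun j => (CkS (Hf j)).1 v y Uy) (smooth_in_differentiable oW (fW y Uy) Hg).
split; first by move=> y; apply: Ck_cont (IH' g Hg).
move=> v; split; first by move=> y Uy; have [] := D v y Uy.
have H : Ck k U (fun y => \sum_j 'D_v (fun z => f z 0 j) y * 'D_(delta_mx 0 j) g (f y)).
  apply: Ck_sum => // j _; apply: CkM => //.
    by have [_] := CkS (Hf j); apply.
  by apply: (IH' ('D_(delta_mx 0 j) g)) => k'; have [_] := CkS (Hg k'.+1); apply.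
by apply: Ck_eq H => // y Uy; have [_ ->] := D v y Uy.
Qed.

End Smooth.

(** * Bump functions *)

Section SmoothOps.
Context {R : realType} {n : nat}.
Implicit Types (f g : 'rV[R]_n -> R) (U V : set 'rV[R]_n).

Lemma smooth_in_sub U V f : V `<=` U -> smooth_in U f -> smooth_in V f.
Proof. by move=> VU H k; apply: Ck_sub (H k). Qed.
Lemma smooth_in_loc U f : (forall y, U y -> exists V, V y /\ smooth_in V f) -> smooth_in U f.
Proof. by move=> H k; apply: Ck_loc => y /H [V [Vy Hy]]; exists V. Qed.
Lemma smooth_in_eq U f g : open U -> eqon U f g -> smooth_in U f -> smooth_in U g.
Proof. by move=> oU fg H k; apply: Ck_eq (H k). Qed.
Lemma smooth_in_cst U (a : R) : smooth_in U (fun=> a).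
Proof. by move=> k; apply: Ck_cst. Qed.
Lemma smooth_in_coord U j : smooth_in U (fun y => y 0 j).
Proof. by move=> k; apply: Ck_coord. Qed.
Lemma smooth_inD U f g : open U -> smooth_in U f -> smooth_in U g -> smooth_in U (fun y => f y + g y).
Proof. by move=> oU Hf Hg k; apply: CkD. Qed.
Lemma smooth_inM U f g : open U -> smooth_in U f -> smooth_in U g -> smooth_in U (fun y => f y * g y).
Proof. by move=> oU Hf Hg k; apply: CkM. Qed.
Lemma smooth_inN U f : open U -> smooth_in U f -> smooth_in U (fun y => - f y).
Proof. by move=> oU Hf k; apply: CkN. Qed.
Lemma smooth_inV U f : open U -> (forall y, U y -> f y != 0) -> smooth_in U f ->
  smooth_in U (fun y => (f y)^-1).
Proof. by move=> oU f0 Hf k; apply: CkV. Qed.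
Lemma smooth_in_sum U (I : Type) (r : seq I) (P : pred I) (F : I -> 'rV[R]_n -> R) : open U ->
  (forall i, P i -> smooth_in U (F i)) -> smooth_in U (fun y => \sum_(i <- r | P i) F i y).
Proof. by move=> oU H k; apply: Ck_sum => // i Pi; apply: H. Qed.
Lemma smooth_in_prod U (I : Type) (r : seq I) (P : pred I) (F : I -> 'rV[R]_n -> R) : open U ->
  (forall i, P i -> smooth_in U (F i)) -> smooth_in U (fun y => \prod_(i <- r | P i) F i y).
Proof. by move=> oU H k; apply: Ck_prod => // i Pi; apply: H. Qed.
Lemma smooth_in_derive U f v : smooth_in U f -> smooth_in U ('D_v f).
Proof. by move=> H k; have [_] := CkS (H k.+1); apply. Qed.
Lemma smooth_in_derivable U f y v : U y -> smooth_in U f -> derivable f y v.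
Proof. by move=> Uy H; have [d _] := CkS (H 1%N); apply: d. Qed.
Lemma smooth_in_continuous U f y : U y -> smooth_in U f -> {for y, continuous f}.
Proof. by move=> Uy H; apply: (Ck_cont (H 0%N)). Qed.
Lemma smooth_in_comp1 U f (phi : nat -> R -> R) (W : set R) m : open U ->
  (forall m x, W x -> is_derive x 1 (phi m) (phi m.+1 x)) -> (forall y, U y -> W (f y)) ->
  smooth_in U f -> smooth_in U (fun y => phi m (f y)).
Proof. by move=> oU d fW Hf k; apply: Ck_comp1 d fW (Hf k) m. Qed.
Lemma smooth_in_comp m (U : set 'rV[R]_n) (W : set 'rV[R]_m) (g : 'rV[R]_m -> R) (f : 'rV[R]_n -> 'rV[R]_m) :
  open U -> open W -> (forall y, U y -> W (f y)) ->
  (forall j, smooth_in U (fun y => f y 0 j)) -> smooth_in W g -> smooth_in U (g \o f).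
Proof. by move=> oU oW fW Hf Hg k; apply: Ck_comp fW _ Hg => // j; apply: Hf. Qed.

End SmoothOps.

Section FlatFunction.
Context {R : realType}.
Implicit Types (p : {poly R}) (x : R).

(* This class is closed under differentiation, see [flat_next]. *)
Definition flat_fun p x : R := if 0 < x then p.[x^-1] * expR (- x^-1) else 0.
Definition flat_next p : {poly R} := 'X ^+ 2 * (p - p^`()).

Lemma exprn_expRN_le m (y : R) : 0 <= y -> y ^+ m * expR (- y) <= m`!%:R.
Proof.
move=> y0; rewrite expRN -ler_pdivlMr ?invr_gt0 ?expR_gt0 // invrK.
case: m => [|m].
  rewrite expr0 fact0 mul1r; apply: le_trans (expR_ge1Dx y); by rewrite lerDl.
have := expR_ge1Dxn m y0; set E := expR y => H.
have f0 : 0 < (m.+1)`!%:R :> R by rewrite ltr0n fact_gt0.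
rewrite mulrC -ler_pdivrMr //; apply: le_trans H; by rewrite lerDr.
Qed.

Lemma horner_expRN_bounded p : exists C : R, forall y, 0 <= y -> `|p.[y] * expR (- y)| <= C.
Proof.
exists (\sum_(i < size p) `|p`_i| * i`!%:R) => y y0.
rewrite horner_coef mulr_suml; apply: le_trans (ler_norm_sum _ _ _) _.
apply: ler_sum => i _; rewrite -mulrA normrM ler_wpM2l //.
rewrite ger0_norm ?exprn_expRN_le // mulr_ge0 // ?expR_ge0 //; exact: exprn_ge0.
Qed.

(** Away from 0 this is the chain rule. At 0, the bound of [horner_expRN_bounded] for [X^2 p] makes
    [flat_fun p h] at most a multiple of [h^2], so the derivative is 0. *)
Lemma is_derive_flat p x : is_derive x 1 (flat_fun p) (flat_fun (flat_next p) x).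
Proof.
have [x0|x0|x0] := ltgtP x 0.
- have -> : flat_fun (flat_next p) x = 0 by rewrite /flat_fun ltNge ltW.
  apply: (@near_eq_is_derive _ _ _ (fun _ : R => 0 : R)).
  have : \forall y \near x, y < 0 by apply: lt_nbhsl.
  by apply: filterS => y y0; rewrite /flat_fun ltNge ltW.
- pose g y := p.[y^-1] * expR (- y^-1).
  have xn0 : x != 0 by rewrite gt_eqF.
  have dI : is_derive x 1 (fun y : R => y^-1) (- x ^- 2).
    apply: DeriveDef; first exact: derivableV.
    by rewrite deriveV // derive_id [LHS]mulr1.
  have dN : is_derive x 1 (fun y : R => - y^-1) (x ^- 2).
    by rewrite -[X in is_derive _ _ _ X]opprK; apply: is_deriveN.
  have dE := is_derive_comp1 dN (is_derive_expR (- x^-1)).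
  have dP := is_derive_comp1 dI (is_derive_poly p x^-1).
  have dG := is_deriveM dP dE.
  apply: (@near_eq_is_derive _ _ _ g).
    have : \forall y \near x, 0 < y by apply: lt_nbhsr.
    by apply: filterS => y y0; rewrite /flat_fun y0.
  apply: is_derive_eq dG _; rewrite /flat_fun x0 /flat_next.
  rewrite !hornerE /= /GRing.scale /= exprVn.
  by ring.
- rewrite x0; have -> : flat_fun (flat_next p) 0 = 0 by rewrite /flat_fun ltxx.
  have [C HC] := horner_expRN_bounded ('X ^+ 2 * p).
  have B h : `|flat_fun p h| <= `|C| * h ^+ 2.
    rewrite /flat_fun; case: ifP => h0; last by rewrite normr0 mulr_ge0 // sqr_ge0.
    have hi : 0 <= h^-1 by rewrite invr_ge0 ltW.
    have := HC _ hi; rewrite hornerM hornerXn -mulrA normrM.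
    rewrite [X in X * _]ger0_norm ?exprn_ge0 // exprVn mulrC ler_pdivrMr ?exprn_gt0 //.
    by move=> /le_trans; apply; rewrite ler_wpM2r ?sqr_ge0 // ler_norm.
  have L : h^-1 *: ((flat_fun p \o shift 0) (h *: (1:R)) - flat_fun p 0) @[h --> 0^'] --> (0 : R).
    apply/cvgrPdist_le => e e0; near=> h.
    rewrite sub0r normrN /= addr0 [h%:A]mulr1 {2}/flat_fun ltxx subr0.
    have hn0 : h != 0 by near: h; exact: nbhs_dnbhs_neq.
    rewrite /GRing.scale /= normrM normfV mulrC ler_pdivrMr ?normr_gt0 //.
    apply: le_trans (B h) _; rewrite -real_normK ?num_real // expr2 mulrA ler_wpM2r //.
    have C1 : 0 < `|C| + 1 by apply: ltr_wpDl.
    have : `|h| <= e / (`|C| + 1).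
      by near: h; apply: dnbhs0_le; rewrite divr_gt0.
    rewrite ler_pdivlMr // => H; apply: le_trans H; rewrite mulrC ler_wpM2l //.
    by rewrite lerDl.
  by apply: DeriveDef; [apply/cvg_ex; exists 0|apply: cvg_lim].
Unshelve. all: by end_near. Qed.

(** [flat_seq 0] is [exp (- 1 / x)] extended by 0 to [x <= 0], and [flat_seq m] is its m-th
    derivative, in the form that [smooth_in_comp1] expects. *)
Definition flat_seq (m : nat) : R -> R := flat_fun (iter m flat_next 1).

Definition smooth_step x : R := flat_seq 0 x / (flat_seq 0 x + flat_seq 0 (1 - x)).

Lemma flat_ge0 x : 0 <= flat_seq 0 x.
Proof. by rewrite /flat_seq /flat_fun /= hornerC mul1r; case: ifP => // _; apply: expR_ge0. Qed.

Lemma flat_gt0 x : 0 < x -> 0 < flat_seq 0 x.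
Proof. by move=> x0; rewrite /flat_seq /flat_fun /= hornerC mul1r x0 expR_gt0. Qed.

Lemma flat_eq0 x : x <= 0 -> flat_seq 0 x = 0.
Proof. by move=> x0; rewrite /flat_seq /flat_fun /= ltNge x0. Qed.

Lemma step_den_gt0 x : 0 < flat_seq 0 x + flat_seq 0 (1 - x).
Proof.
have [x0|x0] := ltP 0 x; first by rewrite ltr_pwDl ?flat_gt0 ?flat_ge0.
by rewrite ltr_wpDl ?flat_ge0 // flat_gt0 // subr_gt0 (le_lt_trans x0).
Qed.

Lemma smooth_step_bound x : 0 <= smooth_step x <= 1.
Proof.
rewrite /smooth_step divr_ge0 ?flat_ge0 ?(ltW (step_den_gt0 _)) //=.
by rewrite ler_pdivrMr ?step_den_gt0 // mul1r lerDl flat_ge0.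
Qed.

Lemma smooth_step0 x : x <= 0 -> smooth_step x = 0.
Proof. by move=> x0; rewrite /smooth_step flat_eq0 // mul0r. Qed.

Lemma smooth_step1 x : 1 <= x -> smooth_step x = 1.
Proof.
move=> x1; rewrite /smooth_step [flat_seq 0 (1 - x)]flat_eq0 ?subr_le0 // addr0 divff //.
by rewrite gt_eqF // flat_gt0 // (lt_le_trans ltr01).
Qed.

Lemma smooth_in_flat n (U : set 'rV[R]_n) (f : 'rV[R]_n -> R) : open U -> smooth_in U f ->
  smooth_in U (fun y => flat_seq 0 (f y)).
Proof.
move=> oU Hf; apply: (@smooth_in_comp1 _ _ _ _ flat_seq setT) => // m x _.
exact: is_derive_flat.
Qed.

Lemma smooth_in_step n (U : set 'rV[R]_n) (f : 'rV[R]_n -> R) : open U -> smooth_in U f ->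
  smooth_in U (fun y => smooth_step (f y)).
Proof.
move=> oU Hf; apply: smooth_inM => //; first exact: smooth_in_flat.
apply: smooth_inV => // [y _|]; first by rewrite gt_eqF ?step_den_gt0.
apply: smooth_inD => //; first exact: smooth_in_flat.
apply: smooth_in_flat => //; apply: smooth_inD => //; first exact: smooth_in_cst.
exact: smooth_inN.
Qed.

End FlatFunction.

Section BumpRn.
Context {R : realType} {n : nat}.

(** Balls of the sup norm are boxes, so a product of one-variable steps is a bump for them; squares
    replace absolute values, which are not smooth. *)
Definition box_bump (y0 : 'rV[R]_n) (a b : R) (y : 'rV[R]_n) : R :=
  \prod_j smooth_step ((b ^+ 2 - (y 0 j - y0 0 j) ^+ 2) / (b ^+ 2 - a ^+ 2)).

Lemma box_bump_smooth y0 a b U : open U -> smooth_in U (box_bump y0 a b).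
Proof.
move=> oU; apply: smooth_in_prod => // j _; apply: smooth_in_step => //.
apply: smooth_inM => //; last exact: smooth_in_cst.
apply: smooth_inD => //; first exact: smooth_in_cst.
have H : smooth_in U (fun y => y 0 j - y0 0 j).
  by apply: smooth_inD => //; [exact: smooth_in_coord|exact: smooth_in_cst].
by apply: smooth_inN => //; apply: smooth_inM.
Qed.

Lemma box_bump_bound y0 a b y : 0 <= box_bump y0 a b y <= 1.
Proof.
apply/andP; split.
  by apply: prodr_ge0 => j _; case/andP: (smooth_step_bound ((b ^+ 2 - (y 0 j - y0 0 j) ^+ 2) / (b ^+ 2 - a ^+ 2))).
by apply: prodr_ile1 => j _; apply: smooth_step_bound.
Qed.

Lemma box_bump1 y0 a b y : 0 < a < b -> `|y - y0| <= a -> box_bump y0 a b y = 1.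
Proof.
move=> /andP[a0 ab] H; apply: big1 => j _; apply: smooth_step1.
have d : a ^+ 2 < b ^+ 2 by rewrite ltr_pXn2r // ?nnegrE ltW // (lt_trans a0).
rewrite ler_pdivlMr ?subr_gt0 // mul1r lerD2l lerN2.
rewrite -[leLHS]real_normK ?num_real // ler_pXn2r ?nnegrE ?(ltW a0) //.
by apply: le_trans H; have := mx_norm_entry (y - y0) j; rewrite !mxE.
Qed.

Lemma box_bump0 y0 a b y : 0 < a < b -> b <= `|y - y0| -> box_bump y0 a b y = 0.
Proof.
move=> /andP[a0 ab] H; have b0 := lt_trans a0 ab.
have d : a ^+ 2 < b ^+ 2 by rewrite ltr_pXn2r // ?nnegrE ltW.
have [j Hj] : exists j, b <= `|(y - y0) 0 j|.
  have : mx_norm (y - y0) != 0 by rewrite gt_eqF // (lt_le_trans b0 H).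
  move=> /mx_norm_neq0 [[i j]]; rewrite ord1 /= => E; exists j.
  by apply: le_trans H _; rewrite [leLHS]/Num.Def.normr /= E.
rewrite /box_bump (bigD1 j) //= smooth_step0 ?mul0r //.
rewrite pmulr_lle0 ?invr_gt0 ?subr_gt0 // subr_le0.
rewrite -[leRHS]real_normK ?num_real // ler_pXn2r ?nnegrE ?(ltW b0) //.
by move: Hj; rewrite !mxE.
Qed.

End BumpRn.

(** * Division by a coordinate *)

Lemma continuous_dist (R : realType) (T : topologicalType) (f : T -> R) y :
  (forall e, 0 < e -> \forall z \near y, `|f y - f z| <= e) -> {for y, continuous f}.
Proof. by move=> H; apply/cvgrPdist_le => e /H. Qed.

Section UnitIntegral.
Context {R : realType}.
Local Notation mu := (@lebesgue_measure R).

(** Continuity in R at the points of the segment, end points included, and not in the subspace: in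
    this form it follows from joint continuity by composition. *)
Definition cont01 (g : R -> R) := forall t, 0 <= t <= 1 -> {for t, continuous g}.
Definition int01 (g : R -> R) : R := \int[mu]_(t in `[0, 1]) g t.

Lemma cont01_within (g : R -> R) : cont01 g -> {within `[0, 1], continuous g}.
Proof.
move=> H; apply: continuous_in_subspaceT => t; rewrite inE /= in_itv /= => t01.
exact: H.
Qed.

Lemma cont01_integrable (g : R -> R) : cont01 g -> mu.-integrable `[0, 1] (EFin \o g).
Proof.
move=> /cont01_within H; apply: continuous_compact_integrable => //.
exact: segment_compact.
Qed.

Lemma measure01 : fine (mu `[0, 1]%classic) = 1.
Proof.
have := @lebesgue_measure_itv R `[0, 1]; rewrite /= lte_fin ltr01 => E.
by transitivity (fine (1%:E - 0%:E : \bar R)%E); [congr fine; exact: E|rewrite -EFinB /= subr0].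
Qed.

Lemma int01_cst (c : R) : int01 (fun=> c) = c.
Proof. by rewrite /int01 Rintegral_cst // -[RHS]mulr1; congr (_ * _); exact: measure01. Qed.

Lemma int01_bound (g : R -> R) (e : R) : cont01 g -> (forall t, 0 <= t <= 1 -> `|g t| <= e) ->
  `|int01 g| <= e.
Proof.
move=> cg He; apply: (le_trans (le_normr_Rintegral _ (cont01_integrable cg))) => //.
rewrite -[leRHS]int01_cst; apply: le_Rintegral => //.
- apply: (@cont01_integrable (fun t => `|g t|)) => t t01.
  by apply: (@continuous_comp _ _ _ g (fun x => `|x|)); [exact: cg|exact: (@norm_continuous _ R^o)].
- by apply: (@cont01_integrable (fun=> e)) => t _; apply: cst_continuous.
Qed.

Lemma int01D (f g : R -> R) : cont01 f -> cont01 g -> int01 (fun t => f t + g t) = int01 f + int01 g.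
Proof. by move=> cf cg; apply: RintegralD => //; apply: cont01_integrable. Qed.

Lemma int01Z (f : R -> R) (c : R) : cont01 f -> int01 (fun t => c * f t) = c * int01 f.
Proof. by move=> cf; apply: RintegralZl => //; apply: cont01_integrable. Qed.

Lemma cont01D (f g : R -> R) : cont01 f -> cont01 g -> cont01 (fun t => f t + g t).
Proof. by move=> cf cg t H; apply: (@continuousD _ R^o); [apply: cf|apply: cg]. Qed.

Lemma cont01Z (f : R -> R) c : cont01 f -> cont01 (fun t => c * f t).
Proof. by move=> cf t H; apply: (@continuousM R); [apply: cst_continuous|apply: cf]. Qed.

Lemma eq_int01 (f g : R -> R) : (forall t, 0 <= t <= 1 -> f t = g t) -> int01 f = int01 g.
Proof. by move=> H; apply: eq_Rintegral => t; rewrite inE /= in_itv /= => /H. Qed.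

Lemma int01_FTC (F f : R -> R) : cont01 f -> (forall t : R, 0 <= t <= 1 -> is_derive t 1 F (f t)) ->
  int01 f = F 1 - F 0.
Proof.
move=> cf dF.
have cF (t : R) : 0 <= t <= 1 -> {for t, continuous F}.
  by move=> t01; apply: differentiable_continuous; apply/derivable1_diffP; have [] := dF t t01.
rewrite /int01 /Rintegral (@continuous_FTC2 _ f F 0 1) //.
- exact: cont01_within.
- split.
  + move=> t; rewrite in_itv /= => /andP[t0 t1]; have [] := dF t; rewrite ?ltW //.
  + by apply: cvg_at_right_filter; apply: cF; rewrite lexx ler01.
  + by apply: cvg_at_left_filter; apply: cF; rewrite lexx ler01.
- move=> t; rewrite in_itv /= => /andP[t0 t1]; rewrite derive1E.
  by have [|_ ->] := dF t; rewrite ?ltW.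
Qed.

End UnitIntegral.

Section ParamIntegral.
Context {R : realType} {n : nat}.
Implicit Types (Phi Psi : R -> 'rV[R]_n -> R) (U : set 'rV[R]_n) (y v : 'rV[R]_n).

Definition jcont01 U Phi := forall t y, 0 <= t <= 1 -> U y ->
  {for (t, y), continuous (fun p : R * 'rV[R]_n => Phi p.1 p.2)}.

Lemma jcont01_slice U Phi y : jcont01 U Phi -> U y -> cont01 (Phi^~ y).
Proof.
move=> H Uy t t01; have := H t y t01 Uy.
apply: (@continuous_comp _ _ _ (fun t => (t, y)) (fun p : R * 'rV[R]_n => Phi p.1 p.2)).
exact: (cvg_pair cvg_id (cvg_cst y)).
Qed.

(** Compactness of [[0, 1]], as near-covering, makes the continuity in [z] uniform in [t]. *)
Lemma jcont01_unif U Phi y e : open U -> jcont01 U Phi -> U y -> 0 < e ->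
  \forall z \near y, U z /\ forall t, 0 <= t <= 1 -> `|Phi t z - Phi t y| <= e.
Proof.
move=> oU H Uy e0.
have nU : nbhs y U by apply: open_nbhs_nbhs.
have := @segment_compact R 0 1 => /compact_near_coveringP.
move=> /(_ _ (nbhs y) (fun z t => `|Phi t z - Phi t y| <= e) (nbhs_filter y)) K.
have : \forall z \near y, `[(0:R), 1]%classic `<=` (fun t => `|Phi t z - Phi t y| <= e).
  apply: K => t; rewrite /= in_itv /= => t01.
  have e2 : 0 < e / 2 by rewrite divr_gt0.
  have /cvgrPdist_le /(_ _ e2) := H t y t01 Uy => -[[A B] /= [nA nB] AB].
  have /cvgrPdist_le /(_ _ e2) := jcont01_slice H Uy t01 => nC.
  exists (A `&` (fun t' => `|Phi t y - Phi t' y| <= e / 2), B) => /=.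
    by split=> //; apply: filterI.
  move=> [t' z] /= [[At' Ct'] Bz].
  have := AB (t', z) (conj At' Bz) => /=.
  move=> h1; rewrite [e]splitr.
  have -> : Phi t' z - Phi t' y = (Phi t y - Phi t' y) - (Phi t y - Phi t' z) by ring.
  by apply: le_trans (ler_normB _ _) _; apply: lerD.
apply: filterS2 nU => z Uz Hz; split=> // t t01; apply: Hz; by rewrite /= in_itv.
Qed.

Lemma int_param_cont U Phi y : open U -> jcont01 U Phi -> U y ->
  {for y, continuous (fun z => int01 (Phi^~ z))}.
Proof.
move=> oU H Uy; apply: continuous_dist => e e0.
apply: filterS (jcont01_unif oU H Uy e0) => z [Uz Hz].
have cy := jcont01_slice H Uy; have cz := jcont01_slice H Uz.
have -> : int01 (Phi^~ y) - int01 (Phi^~ z) = int01 (fun t => Phi t y + (-1) * Phi t z).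
  by rewrite int01D ?int01Z ?mulN1r //; apply: cont01Z.
apply: int01_bound; first by apply: cont01D => //; apply: cont01Z.
by move=> t t01; rewrite mulN1r distrC; apply: Hz.
Qed.

(** Dominated convergence is avoided: by the mean value theorem the difference quotient of [Phi t]
    is a value of [Psi t] close to [y], and [jcont01_unif] controls it uniformly in [t]. *)
Lemma int_param_derive U Phi Psi y v : open U -> jcont01 U Phi -> jcont01 U Psi -> U y ->
  (forall t z, 0 <= t <= 1 -> U z -> is_derive z v (Phi t) (Psi t z)) ->
  is_derive y v (fun z => int01 (Phi^~ z)) (int01 (Psi^~ y)).
Proof.
move=> oU cPhi cPsi Uy D.
have cy := jcont01_slice cPhi Uy; have cpy := jcont01_slice cPsi Uy.
suff L : h^-1 *: (((fun z => int01 (Phi^~ z)) \o shift y) (h *: v) - int01 (Phi^~ y)) @[h --> 0^']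
   --> int01 (Psi^~ y) by apply: DeriveDef; [apply/cvg_ex; exists (int01 (Psi^~ y))|apply: cvg_lim].
apply/cvgrPdist_le => e e0.
have /nbhs_ballP [d d0 Hd] := jcont01_unif oU cPsi Uy e0.
near=> h.
have hn0 : h != 0 by near: h; exact: nbhs_dnbhs_neq.
have hd : `|h| * `|v| < d.
  have v1 : 0 < `|v| + 1 by apply: ltr_wpDl.
  apply: (@le_lt_trans _ _ (`|h| * (`|v| + 1))); first by rewrite ler_wpM2l // lerDl.
  rewrite -ltr_pdivlMr //; near: h; apply: dnbhs0_lt; by rewrite divr_gt0.
have B s : 0 <= s <= 1 -> U (y + s *: (h *: v)) /\
    forall t, 0 <= t <= 1 -> `|Psi t (y + s *: (h *: v)) - Psi t y| <= e.
  move=> /andP[s0 s1]; apply: Hd; rewrite -ball_normE /= opprD addrA subrr sub0r normrN !normrZ.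
  apply: le_lt_trans hd; rewrite ler_piMl ?mulr_ge0 // ger0_norm //.
have [Uh _] := B 1 (introT andP (conj ler01 (lexx 1))).
rewrite scale1r in Uh; have ch := jcont01_slice cPhi Uh.
have -> : int01 (Psi^~ y) - h^-1 *: (((fun z => int01 (Phi^~ z)) \o shift y) (h *: v) - int01 (Phi^~ y)) =
   int01 (fun t => Psi t y + (- h^-1) * (Phi t (y + h *: v) + (-1) * Phi t y)).
  rewrite int01D ?int01Z ?int01D ?int01Z //; last by do ?[apply: cont01Z|apply: cont01D].
  - by rewrite /= [h *: v + y]addrC mulN1r mulNr.
  - exact: cont01Z.
  - by apply: cont01D => //; apply: cont01Z.
apply: int01_bound; first by apply: cont01D => //; apply: cont01Z; apply: cont01D => //; apply: cont01Z.
move=> t t01.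
have [s s01 E] : exists2 s, s \in `[0, 1] & Phi t (y + 1 *: (h *: v)) - Phi t (y + 0 *: (h *: v)) = h * Psi t (y + s *: (h *: v)) * (1 - 0).
  apply: (@MVT_segment R (fun s => Phi t (y + s *: (h *: v))) (fun s => h * Psi t (y + s *: (h *: v)))) => //.
    move=> s; rewrite in_itv /= => /andP[s0 s1].
    have [Us _] := B s (introT andP (conj (ltW s0) (ltW s1))).
    have Ds := D t _ t01 Us.
    have [d1 <-] := Ds; have [d2 <-] := is_derive_scale h d1.
    exact: is_derive_line.
  apply: derivable_within_continuous => s; rewrite in_itv /= => s01.
  have [Us _] := B s s01.
  have [d1 _] := D t _ t01 Us; have [d2 _] := is_derive_scale h d1.
  by have [] := is_derive_line d2.
rewrite mulN1r; move: E; rewrite scale1r scale0r addr0 subr0 mulr1 => ->.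
rewrite mulNr mulKf // distrC.
by apply: (B s _).2 => //; move: s01; rewrite in_itv.
Unshelve. all: by end_near. Qed.

End ParamIntegral.

Section Hadamard.
Context {R : realType} {n : nat}.
Variable j : 'I_n.
Implicit Types (g h : 'rV[R]_n -> R) (U : set 'rV[R]_n) (y v : 'rV[R]_n).
Local Notation ej := (delta_mx 0 j : 'rV[R]_n).

(** The segment from the projection of [y] to the hyperplane [y_j = 0], at [t = 0], to [y] itself,
    at [t = 1]. *)
Definition contract (t : R) y : 'rV[R]_n := y + ((t - 1) * y 0 j) *: ej.

Lemma contract1 y : contract 1 y = y.
Proof. by rewrite /contract subrr mul0r scale0r addr0. Qed.

Lemma contract_entry t y l : contract t y 0 l = if l == j then t * y 0 j else y 0 l.
Proof.
rewrite !mxE eqxx /=; case: eqP => [->|_]; last by rewrite mulr0 addr0.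
by rewrite mulr1; ring.
Qed.

Lemma contract_id t y : y 0 j = 0 -> contract t y = y.
Proof. by move=> y0; rewrite /contract y0 mulr0 scale0r addr0. Qed.

Lemma contract_line t y v s : contract t (y + s *: v) = contract t y + s *: contract t v.
Proof.
by apply/rowP => l; rewrite !(contract_entry, mxE); case: eqP => _; ring.
Qed.

Lemma contract_continuous t y : {for (t, y), continuous (fun p : R * 'rV[R]_n => contract p.1 p.2)}.
Proof.
apply: continuous_row => l.
have c0 i : {for (t, y), continuous (fun p : R * 'rV[R]_n => p.2 0 i)}.
  apply: (@continuous_comp _ _ _ snd (fun z : 'rV[R]_n => z 0 i)); first exact: cvg_snd.
  exact: matrix_normedtype.coord_continuous.
have E : (fun p : R * 'rV[R]_n => contract p.1 p.2 0 l) = if l == j then (fun p : R * 'rV[R]_n => p.1 * p.2 0 j) else (fun p : R * 'rV[R]_n => p.2 0 l).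
  by apply/funext => p; rewrite contract_entry; case: eqP.
rewrite E; case: eqP => _; last exact: c0.
by apply: (@continuousM R); [exact: cvg_fst|exact: c0].
Qed.

Definition star_shaped U := forall t y, 0 <= t <= 1 -> U y -> U (contract t y).

(* For [g] vanishing on the hyperplane [y_j = 0], [hquot g] below is the mean
   [wmean 0] of ['D_ej g]; the powers of [t] come from differentiating [wmean]. *)
Definition wmean (a : nat) h (y : 'rV[R]_n) : R := int01 (fun t => t ^+ a * h (contract t y)).

Lemma wmean_jcont a h U : (forall y, U y -> {for y, continuous h}) -> star_shaped U ->
  jcont01 U (fun t y => t ^+ a * h (contract t y)).
Proof.
move=> ch sU t y t01 Uy; apply: (@continuousM R).
  apply: (@continuous_comp _ _ _ fst (fun t : R => t ^+ a)); first exact: cvg_fst.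
  exact: exprn_continuous.
apply: (@continuous_comp _ _ _ (fun p : R * 'rV[R]_n => contract p.1 p.2) h).
  exact: contract_continuous.
by apply: ch; apply: sU.
Qed.

(** [contract t] is linear, so the direction [v] becomes [v + (t - 1) v_j e_j]; the factor [t] there
    raises the weight from [a] to [a.+1]. *)
Lemma wmean_derive a h U y v : open U -> star_shaped U -> smooth_in U h -> U y ->
  is_derive y v (wmean a h)
    (wmean a ('D_v h) y + v 0 j * (wmean a.+1 ('D_ej h) y - wmean a ('D_ej h) y)).
Proof.
move=> oU sU Hh Uy.
pose Psi (t : R) y := t ^+ a * ('D_v h (contract t y) + (t - 1) * v 0 j * 'D_ej h (contract t y)).
have cD u z : U z -> {for z, continuous ('D_u h)}.
  by move=> Uz; apply: smooth_in_continuous Uz _; apply: smooth_in_derive.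
have J b u := @wmean_jcont b _ U (cD u) sU.
have S b u z : U z -> cont01 (fun t => t ^+ b * 'D_u h (contract t z)).
  by move=> Uz; apply: (jcont01_slice (J b u)).
have PsiE : Psi = fun t y => t ^+ a * 'D_v h (contract t y) +
    (v 0 j * (t ^+ a.+1 * 'D_ej h (contract t y)) + (- v 0 j) * (t ^+ a * 'D_ej h (contract t y))).
  by apply/funext => t; apply/funext => z; rewrite /Psi exprS; ring.
have JP : jcont01 U Psi.
  move=> t z t01 Uz; rewrite PsiE.
  apply: (@continuousD _ R^o); first exact: J.
  by apply: (@continuousD _ R^o); apply: (@continuousM R); try exact: J; apply: cst_continuous.
have ch z : U z -> {for z, continuous h} by move=> Uz; apply: smooth_in_continuous Uz Hh.
have := int_param_derive oU (@wmean_jcont a _ U ch sU) JP Uy.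
move=> /(_ v) H.
have -> : wmean a ('D_v h) y + v 0 j * (wmean a.+1 ('D_ej h) y - wmean a ('D_ej h) y) = int01 (Psi^~ y).
  rewrite PsiE int01D; [|exact: S|by apply: cont01D; apply: cont01Z; apply: S].
  rewrite int01D; [|by apply: cont01Z; apply: S..].
  rewrite !int01Z; [|by apply: S..].
  by rewrite mulNr mulrBr.
apply: H => t z t01 Uz.
have Ucz := sU t z t01 Uz.
have dh := smooth_in_differentiable oU Ucz Hh.
have Dl : is_derive z v (fun z => h (contract t z)) ('D_(contract t v) h (contract t z)).
  have d0 : derivable h (contract t z) (contract t v) by apply: diff_derivable.
  have := @is_derive_line _ _ h (contract t z) (contract t v) 0.
  rewrite scale0r addr0 => /(_ d0) Hl; apply/is_derive_line0.
  by under eq_fun do rewrite addrC contract_line.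
have -> : Psi t z = t ^+ a * 'D_(contract t v) h (contract t z).
  rewrite /Psi; congr (_ * _).
  rewrite {2}/contract [RHS]deriveE // linearD linearZ /= -!deriveE //.
exact: (@is_deriveZ R _ R^o (fun z => h (contract t z)) (t ^+ a) z v _ Dl).
Qed.

(** The induction runs over all weights and all [h] at once, because derivatives of such means are
    combinations of such means. *)
Lemma wmean_Ck k a h U : open U -> star_shaped U -> smooth_in U h -> Ck k U (wmean a h).
Proof.
move=> oU sU; elim: k a h => [|k IH] a h Hh.
  split=> // y Uy; apply: (int_param_cont oU _ Uy); apply: wmean_jcont => // z Uz.
  exact: smooth_in_continuous Uz Hh.
split; first by move=> y Uy; apply: Ck_cont (IH a h Hh) Uy.
move=> v; split; first by move=> y Uy; have [] := wmean_derive a v oU sU Hh Uy.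
have I1 b u : Ck k U (wmean b ('D_u h)) by apply: IH; apply: smooth_in_derive.
have : Ck k U (fun y => wmean a ('D_v h) y + v 0 j * (wmean a.+1 ('D_ej h) y - wmean a ('D_ej h) y)).
  apply: CkD => //; apply: CkM => //; first exact: Ck_cst.
  by apply: CkD => //; apply: CkN.
by apply: Ck_eq => // y Uy; have [_ ->] := wmean_derive a v oU sU Hh Uy.
Qed.

Definition hquot g (y : 'rV[R]_n) : R := if y 0 j == 0 then 'D_ej g y else g y / y 0 j.

Lemma hquotE g U y : (forall z, U z -> z 0 j = 0 -> g z = 0) -> U y -> g y = y 0 j * hquot g y.
Proof.
move=> g0 Uy; rewrite /hquot; case: eqP => [yj|/eqP yj]; first by rewrite yj mul0r g0.
by rewrite mulrC divfK.
Qed.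

(** Hadamard's lemma: [g (contract t y)] has [t]-derivative [y_j] times ['D_ej g], and it vanishes
    at [t = 0]. *)
Lemma hadamard_star g U y : open U -> star_shaped U -> smooth_in U g ->
  (forall z, U z -> z 0 j = 0 -> g z = 0) -> U y -> wmean 0 ('D_ej g) y = hquot g y.
Proof.
move=> oU sU Hg g0 Uy; rewrite /hquot; case: eqP => [yj|/eqP yj].
  rewrite /wmean -[RHS]int01_cst; apply: eq_int01 => t _.
  by rewrite contract_id // mul1r.
apply: (mulfI yj); rewrite [RHS]mulrC divfK // /wmean.
have c1 : cont01 (fun t => t ^+ 0 * 'D_ej g (contract t y)).
  have cD z : U z -> {for z, continuous ('D_ej g)}.
    by move=> Uz; apply: smooth_in_continuous Uz _; apply: smooth_in_derive.
  by apply: (jcont01_slice (@wmean_jcont 0 _ U cD sU)).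
rewrite -int01Z //.
have E (t : R) : contract t y = contract 0 y + t *: (y 0 j *: ej).
  by apply/rowP => l; rewrite !(contract_entry, mxE) eqxx /=; case: eqP => _; rewrite ?mulr1 ?mulr0; ring.
have dF (t : R) : 0 <= t <= 1 ->
    is_derive t 1 (fun t => g (contract t y)) (y 0 j * (t ^+ 0 * 'D_ej g (contract t y))).
  move=> t01; under eq_fun do rewrite E.
  have Uc := sU t y t01 Uy.
  rewrite mul1r.
  have d0 : derivable g (contract t y) ej by apply: smooth_in_derivable Uc Hg.
  have [d1 <-] := is_derive_scale (y 0 j) d0.
  by rewrite E in d1 *; exact: is_derive_line.
have /= -> := int01_FTC (@cont01Z _ _ (y 0 j) c1) dF.
rewrite contract1 [X in _ - X]g0 ?subr0 //; first by apply: sU => //; rewrite lexx ler01.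
by rewrite contract_entry eqxx mul0r.
Qed.

Lemma hquot_smooth g U : open U -> smooth_in U g -> (forall z, U z -> z 0 j = 0 -> g z = 0) ->
  smooth_in U (hquot g).
Proof.
move=> oU Hg g0; apply: smooth_in_loc => y Uy.
have [yj|yj] := eqVneq (y 0 j) 0.
  have : nbhs y U by apply: open_nbhs_nbhs.
  move=> /nbhs_ballP [r r0 Br].
  exists (ball y r); split; first exact: ballxx.
  have oB : open (ball y r) by exact: ball_open.
  have sB : star_shaped (ball y r).
    move=> t z /andP[t0 t1] [_ Bz]; split=> // i l; rewrite ord1 contract_entry.
    have := Bz 0 l; case: eqP => [->|//]; rewrite yj /ball /= !sub0r !normrN => H.
    by rewrite normrM (le_lt_trans _ H) // ger0_norm // ler_piMl.
  have HgB := smooth_in_sub Br Hg.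
  have g0B z : ball y r z -> z 0 j = 0 -> g z = 0 by move=> /Br; apply: g0.
  apply: (@smooth_in_eq _ _ _ (wmean 0 ('D_ej g))) => //.
    by move=> z Bz; apply: (hadamard_star oB).
  by move=> k; apply: wmean_Ck => //; apply: smooth_in_derive.
pose V := U `&` [set z : 'rV[R]_n | z 0 j != 0].
have oV : open V.
  apply: openI => //.
  apply: (@open_comp _ _ (fun z : 'rV[R]_n => z 0 j) [set x | x != 0]); last exact: open_neq.
  by move=> z _; apply: matrix_normedtype.coord_continuous.
exists V; split=> //.
apply: (@smooth_in_eq _ _ _ (fun z => g z * (z 0 j)^-1)) => //.
  by move=> z [_ zj]; rewrite /hquot (negbTE zj).
apply: smooth_inM => //; first by apply: smooth_in_sub Hg => z [].
by apply: smooth_inV => //; [move=> z []|apply: smooth_in_coord].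
Qed.

End Hadamard.

(** * Charts, smooth functions and vector fields *)

Section Charts.
Context {R : realType} {n : nat} {M : topologicalType}.
Implicit Types (c d e : chart R n M) (U V : set M) (f g : M -> R) (x : M).

Lemma paramK c y : (coord c @` dom c) y -> dom c (param c y) /\ coord c (param c y) = y.
Proof. by move=> [x Dx <-]; rewrite coordK. Qed.

Lemma chart_image_open c U : open U -> open (coord c @` (U `&` dom c)).
Proof.
move=> oU; rewrite openE => y [x [Ux Dx] <-].
have Ey : (coord c @` dom c) (coord c x) by exists x.
have nE : nbhs (coord c x) (coord c @` dom c) by apply: open_nbhs_nbhs; split=> //; apply: range_open.
have nU : nbhs (param c (coord c x)) U by rewrite coordK //; apply: open_nbhs_nbhs.
have := param_continuous Ey nU; rewrite nbhs_filterE /= => nP.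
apply: filterS2 nE nP => z Ez Uz.
by have [Dz <-] := paramK Ez; exists (param c z).
Qed.

Lemma chart_imageP c U y : (coord c @` (U `&` dom c)) y ->
  [/\ U (param c y), dom c (param c y) & coord c (param c y) = y].
Proof. by move=> [x [Ux Dx] <-]; rewrite coordK. Qed.

Definition smooth_via c U f := smooth_in (coord c @` (U `&` dom c)) (fun y => f (param c y)).

Lemma smooth_via_transfer c d U f : open U -> smooth_transition d c ->
  smooth_via c U f -> smooth_via d (U `&` dom c) f.
Proof.
move=> oU T H; rewrite /smooth_via.
have oW := chart_image_open (c := d) (openI oU (dom_open c)).
have := @smooth_in_comp _ _ _ _ (coord c @` (U `&` dom c)) (fun y => f (param c y))
  (fun y => coord c (param d y)) oW (chart_image_open oU) _ _ H.
move=> H'; apply: smooth_in_eq oW _ (H' _ _).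
- move=> y /chart_imageP [[Uy Dc] Dd E] /=; by rewrite coordK.
- by move=> y /chart_imageP [[Uy Dc] Dd E]; exists (param d y).
- move=> j; apply: smooth_in_sub (T j) => y /chart_imageP [[Uy Dc] Dd E].
  by exists (param d y).
Qed.

Lemma smooth_via_sub c U V f : V `<=` U -> smooth_via c U f -> smooth_via c V f.
Proof. by move=> VU; apply: smooth_in_sub => y [x [Vx Dx] <-]; exists x => //; split=> //; apply: VU. Qed.

Definition trans c d x : 'M[R]_n := jacobian (fun y => coord d (param c y)) (coord c x).

Lemma id_transition c : smooth_transition c c.
Proof.
move=> j; have oW := chart_image_open (c := c) (dom_open c).
apply: (@smooth_in_eq _ _ _ (fun y => y 0 j)) => //; last exact: smooth_in_coord.
by move=> y /chart_imageP [_ _ ->].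
Qed.

Section Transition.
Variables (c d : chart R n M) (x : M).
Hypotheses (T : smooth_transition c d) (Dc : dom c x) (Dd : dom d x).
Local Notation tau := (fun y => coord d (param c y)).

Let oW : open (coord c @` (dom c `&` dom d)).
Proof. rewrite setIC; exact/chart_image_open/dom_open. Qed.

Let Wx : (coord c @` (dom c `&` dom d)) (coord c x).
Proof. by exists x. Qed.

Lemma transition_differentiable : differentiable tau (coord c x).
Proof.
have -> : tau = \sum_j (fun y => (tau y 0 j) *: (delta_mx 0 j : 'rV[R]_n)).
  by apply/funext => y; rewrite fct_sumE [LHS]row_sum_delta.
apply: differentiable_sum => j; apply: differentiableZl.
exact: smooth_in_differentiable oW Wx (T j).
Qed.

Lemma mul_trans v : v *m trans c d x = \row_j 'D_v (fun y => tau y 0 j) (coord c x).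
Proof.
rewrite -deriveEjacobian; last exact: transition_differentiable.
rewrite derive_mx; last by apply: diff_derivable; apply: transition_differentiable.
by apply/rowP => j; rewrite !mxE.
Qed.

Lemma transE i j : trans c d x i j = 'D_(delta_mx 0 i) (fun y => tau y 0 j) (coord c x).
Proof.
transitivity (((delta_mx 0 i : 'rV[R]_n) *m trans c d x) 0 j); last by rewrite mul_trans mxE.
by rewrite -rowE [RHS]mxE.
Qed.

Lemma derive_transition (F : 'rV[R]_n -> R) (f : 'rV[R]_n -> R) v :
  (\forall y \near coord c x, f y = F (tau y)) ->
  differentiable F (coord d x) ->
  'D_v f (coord c x) = 'D_(v *m trans c d x) F (coord d x).
Proof.
move=> fF dF.
have dF' : differentiable F (tau (coord c x)) by rewrite /= coordK.
have dj j : derivable (fun y => tau y 0 j) (coord c x) v.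
  by apply: diff_derivable; apply: smooth_in_differentiable oW Wx (T j).
rewrite (near_eq_derive v fF).
have [_ /= E] := is_derive_compn dj dF'.
rewrite -[LHS]/('D_v (F \o tau) (coord c x)) E coordK // derive_delta //.
by apply: eq_bigr => j _; rewrite mul_trans mxE.
Qed.

End Transition.

Lemma near_chart_image c U x : open U -> U x -> dom c x ->
  \forall y \near coord c x, (coord c @` (U `&` dom c)) y.
Proof.
by move=> oU Ux Dx; apply: open_nbhs_nbhs; split; [apply: chart_image_open|exists x].
Qed.

Lemma trans_comp c d e x : smooth_transition c d -> smooth_transition d e -> smooth_transition c e ->
  dom c x -> dom d x -> dom e x -> trans c e x = trans c d x *m trans d e x.
Proof.
move=> Tcd Tde Tce Dc Dd De; apply/row_matrixP => i; rewrite !rowE mulmxA; move: (delta_mx 0 i) => v.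
have oW : open (coord d @` (dom d `&` dom e)).
  rewrite setIC; exact/chart_image_open/dom_open.
rewrite [LHS](mul_trans Tce Dc De v) [RHS](mul_trans Tde Dd De (v *m trans c d x)).
apply/rowP => j; rewrite [LHS]mxE [RHS]mxE.
apply: derive_transition => //.
- apply: filterS (near_chart_image (openI (dom_open d) (dom_open e)) (conj Dd De) Dc).
  by move=> y /chart_imageP [[Ddy _] _ _]; rewrite coordK.
- apply: smooth_in_differentiable oW _ (Tde j); by exists x.
Qed.

Lemma trans_id c x : dom c x -> trans c c x = 1%:M.
Proof.
move=> Dc; apply/matrixP => i j; rewrite transE //; last exact: id_transition.
have H : \forall y \near coord c x, coord c (param c y) 0 j = y 0 j.
  apply: filterS (near_chart_image (dom_open c) Dc Dc).
  by move=> y /chart_imageP [_ _ ->].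
rewrite (near_eq_derive _ H).
have := @derive_mx R 'rV[R]_n 1 n id (coord c x) (delta_mx 0 i) (@derivable_id _ _ _ _).
by rewrite derive_id => /rowP /(_ j); rewrite !mxE eqxx /= eq_sym => <-.
Qed.

End Charts.

Section SmoothFun.
Context {R : realType} {n : nat} {M : topologicalType}.
Variable S : smooth_structure R n M.
Implicit Types (c d e : chart R n M) (U V : set M) (f g : M -> R) (x : M).

Lemma atlas_smooth c : atlas S c -> smooth_chart S c.
Proof. by move=> Ac d Ad; apply: (atlas_compatible Ac Ad). Qed.

Lemma smooth_fun_loc U f :
  (forall x, U x -> exists V c, [/\ open V, V x, smooth_chart S c, dom c x & smooth_via c V f]) ->
  smooth_fun S U f.
Proof.
move=> H d Ad; apply: smooth_in_loc => y [x [Ux Dx] <-].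
have [V [c [oV Vx Sc Dc Hf]]] := H x Ux.
exists (coord d @` ((V `&` dom c) `&` dom d)); split; first by exists x.
by apply: smooth_via_transfer => //; case: (Sc d Ad).
Qed.

Lemma smooth_fun_via c U f : open U -> smooth_chart S c -> smooth_fun S U f -> smooth_via c U f.
Proof.
move=> oU Sc H; apply: smooth_in_loc => y [x [Ux Dx] <-].
have Ad := chart_at_atlas S x; have Dd := chart_at_dom S x.
exists (coord c @` ((U `&` dom (chart_at S x)) `&` dom c)); split; first by exists x.
by apply: smooth_via_transfer => //; [case: (Sc _ Ad)|apply: H].
Qed.

Lemma smooth_fun_sub U V f : V `<=` U -> smooth_fun S U f -> smooth_fun S V f.
Proof. by move=> VU H c Ac; apply: smooth_via_sub VU (H c Ac). Qed.

Lemma smooth_fun_local U f : (forall x, U x -> exists V, [/\ open V, V x & smooth_fun S V f]) ->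
  smooth_fun S U f.
Proof.
move=> H; apply: smooth_fun_loc => x /H [V [oV Vx Hf]].
exists V, (chart_at S x); split=> //; [exact/atlas_smooth/chart_at_atlas|exact: chart_at_dom|].
by apply: Hf; apply: chart_at_atlas.
Qed.

Lemma smooth_fun_eq U f g : open U -> eqon U f g -> smooth_fun S U f -> smooth_fun S U g.
Proof.
move=> oU fg H c Ac; apply: smooth_in_eq (H c Ac); first exact: chart_image_open.
by move=> y /chart_imageP [Uy _ _]; apply: fg.
Qed.

Lemma smooth_fun_cst U (a : R) : smooth_fun S U (fun=> a).
Proof. by move=> c _; apply: smooth_in_cst. Qed.

Lemma smooth_funD U f g : open U -> smooth_fun S U f -> smooth_fun S U g ->
  smooth_fun S U (fun x => f x + g x).
Proof. by move=> oU Hf Hg c Ac; apply: smooth_inD; [exact: chart_image_open|apply: Hf|apply: Hg]. Qed.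

Lemma smooth_funM U f g : open U -> smooth_fun S U f -> smooth_fun S U g ->
  smooth_fun S U (fun x => f x * g x).
Proof. by move=> oU Hf Hg c Ac; apply: smooth_inM; [exact: chart_image_open|apply: Hf|apply: Hg]. Qed.

Lemma smooth_funN U f : open U -> smooth_fun S U f -> smooth_fun S U (fun x => - f x).
Proof. by move=> oU Hf c Ac; apply: smooth_inN; [exact: chart_image_open|apply: Hf]. Qed.

Lemma smooth_funV U f : open U -> (forall x, U x -> f x != 0) -> smooth_fun S U f ->
  smooth_fun S U (fun x => (f x)^-1).
Proof.
move=> oU f0 Hf c Ac; apply: smooth_inV; [exact: chart_image_open| |exact: Hf].
by move=> y /chart_imageP [Uy _ _]; apply: f0.
Qed.

Lemma smooth_fun_sum U (I : Type) (r : seq I) (P : pred I) (F : I -> M -> R) : open U ->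
  (forall i, P i -> smooth_fun S U (F i)) -> smooth_fun S U (fun x => \sum_(i <- r | P i) F i x).
Proof.
move=> oU H c Ac; apply: (@smooth_in_sum _ _ _ _ _ _ (fun i y => F i (param c y))); first exact: chart_image_open.
by move=> i Pi; apply: H.
Qed.

Lemma smooth_fun_prod U (I : Type) (r : seq I) (P : pred I) (F : I -> M -> R) : open U ->
  (forall i, P i -> smooth_fun S U (F i)) -> smooth_fun S U (fun x => \prod_(i <- r | P i) F i x).
Proof.
move=> oU H c Ac; apply: (@smooth_in_prod _ _ _ _ _ _ (fun i y => F i (param c y))); first exact: chart_image_open.
by move=> i Pi; apply: H.
Qed.

Lemma smooth_fun_chart c U (F : 'rV[R]_n -> R) : open U -> smooth_chart S c ->
  smooth_in (coord c @` (U `&` dom c)) F -> smooth_fun S (U `&` dom c) (fun x => F (coord c x)).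
Proof.
move=> oU Sc H; apply: smooth_fun_loc => x [Ux Dx]; exists U, c; split=> //.
apply: smooth_in_eq H; first exact: chart_image_open.
by move=> y /chart_imageP [_ _ /= ->].
Qed.

Lemma smooth_fun_coord c j : smooth_chart S c -> smooth_fun S (dom c) (fun x => coord c x 0 j).
Proof.
move=> Sc; have := @smooth_fun_chart c setT (fun y => y 0 j) openT Sc.
by rewrite setTI; apply; apply: smooth_in_coord.
Qed.

Lemma smooth_fun_continuous U f x : open U -> U x -> smooth_fun S U f -> {for x, continuous f}.
Proof.
move=> oU Ux H; pose c := chart_at S x.
have Ac : atlas S c by apply: chart_at_atlas.
have Dx : dom c x by apply: chart_at_dom.
have oW : open (U `&` dom c) by apply: openI => //; apply: dom_open.
have C1 : {for coord c x, continuous (fun y => f (param c y))}.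
  by apply: smooth_in_continuous (H c Ac); exists x.
have : {for x, continuous ((fun y => f (param c y)) \o coord c)}.
  by apply: continuous_comp => //; apply: Defs.coord_continuous.
rewrite /prop_for /continuous_at /= coordK //.
apply: (@cvg_eqon _ _ (U `&` dom c)) => //.
by move=> z [Uz Dz] /=; rewrite coordK.
Qed.

Lemma smooth_fun_open U f (P : set R) : open U -> smooth_fun S U f -> open P ->
  open (U `&` [set x | P (f x)]).
Proof.
move=> oU H oP; rewrite openE => x [Ux Px].
apply: filterI; first by apply: open_nbhs_nbhs.
by apply: (smooth_fun_continuous oU Ux H); apply: open_nbhs_nbhs.
Qed.

End SmoothFun.

Section SmoothMx.
Context {R : realType} {n : nat} {M : topologicalType}.
Variable S : smooth_structure R n M.
Implicit Types (U V : set M).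

Definition smooth_mx p q U (A : M -> 'M[R]_(p, q)) :=
  forall i j, smooth_fun S U (fun x => A x i j).

Lemma smooth_mx_sub p q U V (A : M -> 'M[R]_(p, q)) : V `<=` U -> smooth_mx U A -> smooth_mx V A.
Proof. by move=> VU H i j; apply: smooth_fun_sub VU (H i j). Qed.

Lemma smooth_mx_local p q U (A : M -> 'M[R]_(p, q)) :
  (forall x, U x -> exists V, [/\ open V, V x & smooth_mx V A]) -> smooth_mx U A.
Proof.
by move=> H i j; apply: smooth_fun_local => x /H [V [oV Vx HA]]; exists V; split.
Qed.

Lemma smooth_mx_eq p q U (A B : M -> 'M[R]_(p, q)) : open U -> eqon U A B ->
  smooth_mx U A -> smooth_mx U B.
Proof. by move=> oU AB H i j; apply: smooth_fun_eq (H i j) => // x /AB ->. Qed.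

Lemma smooth_mx_cst p q U (B : 'M[R]_(p, q)) : smooth_mx U (fun=> B).
Proof. by move=> i j; apply: smooth_fun_cst. Qed.

Lemma smooth_mxM p q r U (A : M -> 'M[R]_(p, q)) (B : M -> 'M[R]_(q, r)) : open U ->
  smooth_mx U A -> smooth_mx U B -> smooth_mx U (fun x => A x *m B x).
Proof.
move=> oU HA HB i j; apply: (@smooth_fun_eq _ _ _ _ _ (fun x => \sum_k A x i k * B x k j)) => //.
  by move=> x _; rewrite mxE.
by apply: smooth_fun_sum => // k _; apply: smooth_funM.
Qed.

Lemma smooth_mxD p q U (A B : M -> 'M[R]_(p, q)) : open U ->
  smooth_mx U A -> smooth_mx U B -> smooth_mx U (fun x => A x + B x).
Proof.
move=> oU HA HB i j; apply: (@smooth_fun_eq _ _ _ _ _ (fun x => A x i j + B x i j)) => //.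
  by move=> x _; rewrite mxE.
exact: smooth_funD.
Qed.

Lemma smooth_mxZ p q U (f : M -> R) (A : M -> 'M[R]_(p, q)) : open U ->
  smooth_fun S U f -> smooth_mx U A -> smooth_mx U (fun x => f x *: A x).
Proof.
move=> oU Hf HA i j; apply: (@smooth_fun_eq _ _ _ _ _ (fun x => f x * A x i j)) => //.
  by move=> x _; rewrite mxE.
exact: smooth_funM.
Qed.

Lemma smooth_mxN p q U (A : M -> 'M[R]_(p, q)) : open U ->
  smooth_mx U A -> smooth_mx U (fun x => - A x).
Proof.
move=> oU HA i j; apply: (@smooth_fun_eq _ _ _ _ _ (fun x => - A x i j)) => //.
  by move=> x _; rewrite mxE.
exact: smooth_funN.
Qed.

Lemma smooth_mx_tr p q U (A : M -> 'M[R]_(p, q)) : open U ->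
  smooth_mx U A -> smooth_mx U (fun x => (A x)^T).
Proof. by move=> oU H i j; apply: smooth_fun_eq (H j i) => // x _; rewrite mxE. Qed.

Lemma smooth_det p U (A : M -> 'M[R]_p) : open U -> smooth_mx U A -> smooth_fun S U (fun x => \det (A x)).
Proof.
move=> oU H.
refine (@smooth_fun_sum _ _ _ S U _ _ _ (fun (s : 'S_p) x => (-1) ^+ s * \prod_i A x i (s i)) oU _) => s _.
apply: smooth_funM => //; first exact: smooth_fun_cst.
by apply: (smooth_fun_prod _ (F := fun i x => A x i (s i))).
Qed.

Lemma smooth_invmx p U (A : M -> 'M[R]_p) : open U -> (forall x, U x -> A x \in unitmx) ->
  smooth_mx U A -> smooth_mx U (fun x => invmx (A x)).
Proof.
move=> oU uA H i j.
apply: (@smooth_fun_eq _ _ _ _ _ (fun x => (\det (A x))^-1 * ((-1) ^+ (j + i) * \det (row' j (col' i (A x)))))) => //.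
  by move=> x Ux; rewrite /invmx uA // !mxE.
apply: smooth_funM => //.
  apply: smooth_funV => //; last exact: smooth_det.
  by move=> x Ux; have := uA x Ux; rewrite unitmxE unitfE.
apply: smooth_funM => //; first exact: smooth_fun_cst.
apply: smooth_det => // a b; apply: smooth_fun_eq (H (lift j a) (lift i b)) => // x _.
by rewrite !mxE.
Qed.

Lemma smooth_row_mx p q1 q2 U (A : M -> 'M[R]_(p, q1)) (B : M -> 'M[R]_(p, q2)) : open U ->
  smooth_mx U A -> smooth_mx U B -> smooth_mx U (fun x => row_mx (A x) (B x)).
Proof.
move=> oU HA HB i j; case: (splitP j) => l jl.
  have -> : j = lshift q2 l by apply: val_inj.
  by apply: smooth_fun_eq (HA i l) => // x _; rewrite row_mxEl.
have -> : j = rshift q1 l by apply: val_inj.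
by apply: smooth_fun_eq (HB i l) => // x _; rewrite row_mxEr.
Qed.

Lemma smooth_col_mx p1 p2 q U (A : M -> 'M[R]_(p1, q)) (B : M -> 'M[R]_(p2, q)) : open U ->
  smooth_mx U A -> smooth_mx U B -> smooth_mx U (fun x => col_mx (A x) (B x)).
Proof.
move=> oU HA HB i j; case: (splitP i) => l il.
  have -> : i = lshift p2 l by apply: val_inj.
  by apply: smooth_fun_eq (HA l j) => // x _; rewrite col_mxEu.
have -> : i = rshift p1 l by apply: val_inj.
by apply: smooth_fun_eq (HB l j) => // x _; rewrite col_mxEd.
Qed.

Lemma smooth_block_mx p1 p2 q1 q2 U (A : M -> 'M[R]_(p1, q1)) (B : M -> 'M[R]_(p1, q2))
    (C : M -> 'M[R]_(p2, q1)) (D : M -> 'M[R]_(p2, q2)) : open U ->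
  smooth_mx U A -> smooth_mx U B -> smooth_mx U C -> smooth_mx U D ->
  smooth_mx U (fun x => block_mx (A x) (B x) (C x) (D x)).
Proof. by move=> oU HA HB HC HD; apply: smooth_col_mx => //; apply: smooth_row_mx. Qed.

Lemma smooth_submx p1 p2 q1 q2 U (A : M -> 'M[R]_(p1 + p2, q1 + q2)) : open U -> smooth_mx U A ->
  [/\ smooth_mx U (fun x => ulsubmx (A x)), smooth_mx U (fun x => ursubmx (A x)),
      smooth_mx U (fun x => dlsubmx (A x)) & smooth_mx U (fun x => drsubmx (A x))].
Proof.
move=> oU H; split=> i j.
- by apply: smooth_fun_eq (H (lshift _ i) (lshift _ j)) => // x _; rewrite !mxE.
- by apply: smooth_fun_eq (H (lshift _ i) (rshift _ j)) => // x _; rewrite !mxE.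
- by apply: smooth_fun_eq (H (rshift _ i) (lshift _ j)) => // x _; rewrite !mxE.
- by apply: smooth_fun_eq (H (rshift _ i) (rshift _ j)) => // x _; rewrite !mxE.
Qed.

End SmoothMx.

Section Fields.
Context {R : realType} {n : nat} {M : topologicalType}.
Variable S : smooth_structure R n M.
Implicit Types (c d e : chart R n M) (U V : set M) (f g : M -> R) (x : M).
Local Notation smx := (smooth_mx S).

Lemma jacE c x : jac S c x = trans (chart_at S x) c x.
Proof. by []. Qed.

Lemma jac_trans c d x : smooth_chart S c -> smooth_chart S d -> smooth_transition c d ->
  dom c x -> dom d x -> jac S d x = jac S c x *m trans c d x.
Proof.
move=> Sc Sd Tcd Dc Dd; rewrite !jacE.
have Ad := chart_at_atlas S x; have D0 := chart_at_dom S x.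
apply: trans_comp => //; first by case: (Sc _ Ad).
by case: (Sd _ Ad).
Qed.

Lemma trans_inv c d x : smooth_transition c d -> smooth_transition d c ->
  dom c x -> dom d x -> trans c d x *m trans d c x = 1%:M.
Proof.
move=> Tcd Tdc Dc Dd; rewrite -trans_comp //; [exact: trans_id|exact: id_transition].
Qed.

Lemma jac_unit c x : smooth_chart S c -> dom c x -> jac S c x \in unitmx.
Proof.
move=> Sc Dc; have Ad := chart_at_atlas S x; have D0 := chart_at_dom S x.
have [T1 T2] := Sc _ Ad.
rewrite jacE; have [H _] := mulmx1_unit (trans_inv T2 T1 D0 Dc); exact: H.
Qed.

Lemma trans_smooth c d : smooth_chart S c -> smooth_transition c d ->
  smx (dom c `&` dom d) (trans c d).
Proof.
move=> Sc T i j.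
have oW : open (dom c `&` dom d) by apply: openI; apply: dom_open.
apply: (@smooth_fun_eq _ _ _ S _ (fun x => 'D_(delta_mx 0 i) (fun y => coord d (param c y) 0 j) (coord c x))) => //.
  by move=> x [Dc Dd]; rewrite transE.
rewrite setIC; apply: (smooth_fun_chart (F := 'D_(delta_mx 0 i) (fun y => coord d (param c y) 0 j)) (dom_open d) Sc).
by apply: smooth_in_derive; rewrite setIC.
Qed.

Global Opaque trans jac.


Lemma smooth_fieldE U X : smooth_field S U X <->
  forall c, atlas S c -> forall j, smooth_via c U (fun x => (X x *m jac S c x) 0 j).
Proof. by []. Qed.

Lemma smooth_field_sub U V X : V `<=` U -> smooth_field S U X -> smooth_field S V X.
Proof. by move=> VU /smooth_fieldE H; apply/smooth_fieldE => c Ac j; apply: smooth_via_sub VU (H c Ac j). Qed.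

Lemma field_smooth_mx c U X : open U -> smooth_chart S c -> smooth_field S U X ->
  smx (U `&` dom c) (fun x => X x *m jac S c x).
Proof.
move=> oU Sc /smooth_fieldE H; apply: smooth_mx_local => x [Ux Dc].
pose d := chart_at S x; have Ad : atlas S d by apply: chart_at_atlas.
have Dd : dom d x by apply: chart_at_dom.
have oW : open (U `&` (dom d `&` dom c)) by apply: openI => //; apply: openI; apply: dom_open.
have [Tcd Tdc] := Sc _ Ad.
exists (U `&` (dom d `&` dom c)); split=> //.
refine (@smooth_mx_eq _ _ _ _ _ _ _ (fun x => X x *m jac S d x *m trans d c x) _ oW _ _).
  by move=> z [Uz [Dzd Dzc]]; rewrite -mulmxA -jac_trans //; apply: atlas_smooth.
apply: smooth_mxM => //.
  move=> i j; rewrite ord1; apply: smooth_fun_loc => z [Uz [Dzd Dzc]].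
  by exists U, d; split=> //; [exact: atlas_smooth|exact: H].
apply: (@smooth_mx_sub _ _ _ _ _ _ (dom d `&` dom c)); first by move=> z [].
by apply: trans_smooth => //; apply: atlas_smooth.
Qed.

Lemma smooth_mx_field c U X : open U -> smooth_chart S c -> U `<=` dom c ->
  smx U (fun x => X x *m jac S c x) -> smooth_field S U X.
Proof.
move=> oU Sc Uc H; apply/smooth_fieldE => d Ad j.
have oW : open (U `&` dom d) by apply: openI => //; apply: dom_open.
have [Tcd Tdc] := Sc _ Ad.
have : smx (U `&` dom d) (fun x => X x *m jac S d x).
  refine (@smooth_mx_eq _ _ _ _ _ _ _ (fun x => X x *m jac S c x *m trans c d x) _ oW _ _).
    by move=> z [Uz Dzd]; rewrite -mulmxA -jac_trans //; [apply: atlas_smooth|apply: Uc].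
  apply: smooth_mxM => //; first by apply: smooth_mx_sub H => z [].
  apply: (@smooth_mx_sub _ _ _ _ _ _ (dom c `&` dom d)); last exact: trans_smooth.
  by move=> z [/Uc].
move=> /(_ 0 j) /(smooth_fun_via oW (atlas_smooth Ad)).
by apply: smooth_in_sub => y [x [Ux Dx] <-]; exists x.
Qed.

Lemma smooth_field_local U X : (forall x, U x -> exists V, [/\ open V, V x & smooth_field S V X]) ->
  smooth_field S U X.
Proof.
move=> H; apply/smooth_fieldE => c Ac j; apply: smooth_in_loc => y [x [Ux Dx] <-].
have [V [oV Vx /smooth_fieldE HX]] := H x Ux.
by exists (coord c @` (V `&` dom c)); split; [exists x|apply: HX].
Qed.

Lemma smooth_field_eq U X Y : open U -> eqon U X Y -> smooth_field S U X -> smooth_field S U Y.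
Proof.
move=> oU XY /smooth_fieldE H; apply/smooth_fieldE => c Ac j.
apply: smooth_in_eq (H c Ac j); first exact: chart_image_open.
by move=> y /chart_imageP [Uy _ _]; rewrite XY.
Qed.

Lemma smooth_field_lin U g X Y : open U -> smooth_fun S U g -> smooth_field S U X -> smooth_field S U Y ->
  smooth_field S U (fun x => g x *: X x + Y x).
Proof.
move=> oU Hg /smooth_fieldE HX /smooth_fieldE HY; apply/smooth_fieldE => c Ac j.
apply: (@smooth_in_eq _ _ _ (fun y => g (param c y) * (X (param c y) *m jac S c (param c y)) 0 j +
  (Y (param c y) *m jac S c (param c y)) 0 j)); first exact: chart_image_open.
  by move=> y _; rewrite mulmxDl -scalemxAl [RHS]mxE; congr (_ + _); rewrite [RHS]mxE.
apply: smooth_inD; [exact: chart_image_open| |exact: HY].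
by apply: smooth_inM; [exact: chart_image_open|exact: Hg|exact: HX].
Qed.

End Fields.

Section Differential.
Context {R : realType} {n : nat} {M : topologicalType}.
Variable S : smooth_structure R n M.
Implicit Types (c d e : chart R n M) (U V : set M) (f g : M -> R) (x : M).
Local Notation smx := (smooth_mx S).
Local Notation dfun := (dfun S).

Lemma via_differentiable c U f x : open U -> U x -> dom c x -> smooth_chart S c ->
  smooth_fun S U f -> differentiable (fun y => f (param c y)) (coord c x).
Proof.
move=> oU Ux Dx Sc H.
apply: (smooth_in_differentiable (chart_image_open (c := c) oU) _ (smooth_fun_via oU Sc H)).
by exists x.
Qed.

Lemma dfunE c U f x v : open U -> U x -> dom c x -> smooth_chart S c -> smooth_fun S U f ->
  dfun f x v = 'D_(v *m jac S c x) (fun y => f (param c y)) (coord c x).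
Proof.
move=> oU Ux Dx Sc H; have Ad := chart_at_atlas S x; have D0 := chart_at_dom S x.
rewrite /Defs.dfun jacE; apply: derive_transition => //; first by case: (Sc _ Ad).
  apply: filterS (near_chart_image (openI oU (dom_open c)) (conj Ux Dx) D0).
  by move=> y /chart_imageP [[Uy Dy] _ _]; rewrite coordK.
exact: via_differentiable H.
Qed.

Lemma dfun_lin U f x a u v : open U -> U x -> smooth_fun S U f ->
  dfun f x (a *: u + v) = a * dfun f x u + dfun f x v.
Proof.
move=> oU Ux H; have Ad := chart_at_atlas S x; have D0 := chart_at_dom S x.
have dF := via_differentiable oU Ux D0 (atlas_smooth Ad) H.
by rewrite /Defs.dfun !deriveE // linearP.
Qed.

Lemma dfun_eq U f g x : open U -> U x -> eqon U f g -> dfun f x = dfun g x.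
Proof.
move=> oU Ux fg; apply/funext => v; apply: near_eq_derive.
apply: filterS (near_chart_image oU Ux (chart_at_dom S x)).
by move=> y /chart_imageP [/fg].
Qed.

Lemma dfunM U f g x v : open U -> U x -> smooth_fun S U f -> smooth_fun S U g ->
  dfun (fun z => f z * g z) x v = f x * dfun g x v + g x * dfun f x v.
Proof.
move=> oU Ux Hf Hg; have Sd := atlas_smooth (chart_at_atlas S x); have D0 := chart_at_dom S x.
have df := via_differentiable oU Ux D0 Sd Hf.
have dg := via_differentiable oU Ux D0 Sd Hg.
have := deriveM (@diff_derivable _ _ _ _ _ v df) (@diff_derivable _ _ _ _ _ v dg).
by rewrite /= coordK.
Qed.

Lemma dfun_smooth U f X : open U -> smooth_fun S U f -> smooth_field S U X ->
  smooth_fun S U (fun x => dfun f x (X x)).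
Proof.
move=> oU Hf HX; apply: smooth_fun_local => x Ux.
have Ad := chart_at_atlas S x; have D0 := chart_at_dom S x; have Sd := atlas_smooth Ad.
pose c := chart_at S x.
have oW : open (U `&` dom c) by apply: openI => //; apply: dom_open.
exists (U `&` dom c); split=> //.
apply: (@smooth_fun_eq _ _ _ S _ (fun z => \sum_j (X z *m jac S c z) 0 j *
   'D_(delta_mx 0 j) (fun y => f (param c y)) (coord c z))) => //.
  move=> z [Uz Dz]; rewrite (dfunE _ oU Uz Dz Sd Hf) [RHS]derive_delta //.
  exact: via_differentiable Hf.
refine (@smooth_fun_sum _ _ _ S _ _ _ _ _ oW _) => j _; apply: smooth_funM => //.
  exact: (field_smooth_mx oU Sd HX).
refine (@smooth_fun_chart _ _ _ S c U ('D_(delta_mx 0 j) (fun y => f (param c y))) oU Sd _).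
by apply: smooth_in_derive; exact: (smooth_fun_via oU Sd Hf).
Qed.

Lemma dfun_coord c x v j : smooth_chart S c -> dom c x ->
  dfun (fun z => coord c z 0 j) x v = (v *m jac S c x) 0 j.
Proof.
move=> Sc Dx; rewrite (dfunE _ (dom_open c) Dx Dx Sc (smooth_fun_coord j Sc)).
move: (v *m _) => u.
have H : \forall y \near coord c x, coord c (param c y) 0 j = y 0 j.
  apply: filterS (near_chart_image (dom_open c) Dx Dx).
  by move=> y /chart_imageP [_ _ ->].
rewrite (near_eq_derive _ H).
have := @derive_mx R 'rV[R]_n 1 n id (coord c x) u (@derivable_id _ _ _ _).
by rewrite derive_id => /rowP /(_ j); rewrite [X in _ = X -> _]mxE => <-.
Qed.

Definition grad f x : 'cV[R]_n := \col_i dfun f x (delta_mx 0 i).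

Lemma dfun_grad U f x v : open U -> U x -> smooth_fun S U f -> dfun f x v = (v *m grad f x) 0 0.
Proof.
move=> oU Ux H; rewrite mxE {1}(row_sum_delta v).
have Z : dfun f x 0 = 0.
  by have := dfun_lin (-1) 0 0 oU Ux H; rewrite scaler0 addr0 mulN1r addNr.
have -> : dfun f x (\sum_j v 0 j *: delta_mx 0 j) = \sum_j v 0 j * dfun f x (delta_mx 0 j).
  elim: (index_enum _) => [|i r IH]; first by rewrite !big_nil.
  by rewrite !big_cons (dfun_lin _ _ _ oU Ux H) IH.
by apply: eq_bigr => j _; rewrite mxE.
Qed.

Definition chart_field c (u : M -> 'rV[R]_n) : vfield := fun x => u x *m invmx (jac S c x).

Lemma chart_fieldK c u x : smooth_chart S c -> dom c x -> chart_field c u x *m jac S c x = u x.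
Proof. by move=> Sc Dx; rewrite /chart_field mulmxKV // jac_unit. Qed.

Lemma chart_field_smooth c u U : open U -> smooth_chart S c -> U `<=` dom c -> smx U u ->
  smooth_field S U (chart_field c u).
Proof.
move=> oU Sc Uc Hu; apply: (smooth_mx_field oU Sc Uc).
by refine (@smooth_mx_eq _ _ _ _ _ _ _ u _ oU _ Hu) => x Ux; rewrite chart_fieldK //; apply: Uc.
Qed.

Lemma jac_inj c x u v : smooth_chart S c -> dom c x -> u *m jac S c x = v *m jac S c x -> u = v :> 'rV_n.
Proof. by move=> Sc Dx H; rewrite -[u](mulmxK (jac_unit Sc Dx)) H mulmxK // jac_unit. Qed.

Lemma smooth_field0 U : open U -> smooth_field S U (fun=> 0).
Proof.
move=> oU; apply: smooth_field_local => x Ux; pose c := chart_at S x.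
have Sc : smooth_chart S c by apply: atlas_smooth; apply: chart_at_atlas.
have oW : open (U `&` dom c) by apply: openI => //; apply: dom_open.
exists (U `&` dom c); split=> //; first by split=> //; apply: chart_at_dom.
apply: (smooth_mx_field oW Sc); first by move=> z [].
by refine (@smooth_mx_eq _ _ _ _ _ _ _ (fun=> 0) _ oW _ (@smooth_mx_cst _ _ _ S 1 n _ 0)) => z _; rewrite mul0mx.
Qed.

Lemma smooth_field_sum U (I : Type) (r : seq I) (P : pred I) (g : I -> M -> R) (X : I -> vfield) : open U ->
  (forall i, P i -> smooth_fun S U (g i) /\ smooth_field S U (X i)) ->
  smooth_field S U (fun x => \sum_(i <- r | P i) g i x *: X i x).
Proof.
move=> oU H; elim: r => [|i r IH].
  by refine (smooth_field_eq oU _ (smooth_field0 oU)) => x _; rewrite big_nil.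
have [Pi|Pi] := boolP (P i).
  have [Hg HX] := H i Pi.
  by refine (smooth_field_eq oU _ (smooth_field_lin oU Hg HX IH)) => x _; rewrite big_cons Pi.
by refine (smooth_field_eq oU _ IH) => x _; rewrite big_cons (negbTE Pi).
Qed.

End Differential.

(** * Gluing local sections *)

Lemma near_open (T : topologicalType) (P : T -> Prop) z : (\forall w \near z, P w) ->
  exists V, [/\ open V, V z & forall w, V w -> P w].
Proof.
move=> H; exists (interior P); split=> //; first exact: open_interior.
by move=> w /interior_subset.
Qed.

Section Bump.
Context {R : realType} {n : nat} {M : topologicalType}.
Variable S : smooth_structure R n M.
Hypothesis hM : hausdorff_space M.

(** A closed box in a chart is compact, so its image [K] is closed in the Hausdorff space [M]. The
    bump extended by 0 is then smooth on the two open sets [dom c] and the complement of [K], which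
    cover [M]. *)
Lemma manifold_bump (U : set M) (x : M) : open U -> U x ->
  exists (rho : M -> R) (V K : set M),
    [/\ smooth_fun S [set: M] rho, forall z, 0 <= rho z <= 1,
        open V /\ V x, closed K /\ K `<=` U &
        (forall z, V z -> rho z = 1) /\ (forall z, ~ K z -> rho z = 0)].
Proof.
move=> oU Ux; pose c := chart_at S x.
have Dx : dom c x := chart_at_dom S x.
have Sc : smooth_chart S c := atlas_smooth (chart_at_atlas S x).
set y0 := coord c x.
have /nbhs_ballP [r r0 Br] : nbhs y0 (coord c @` (U `&` dom c)).
  by apply: open_nbhs_nbhs; split; [exact: chart_image_open|exists x].
(* The closed box of radius [b] has to fit into the open ball of radius [r]; the bump is 1 on the
   box of radius [a]. *)
pose b := r / 2; pose a := b / 2.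
have b0 : 0 < b by rewrite divr_gt0.
have ab : 0 < a < b by rewrite divr_gt0 //= ltr_pdivrMr // ltr_pMr // ltr1n.
pose B := [set y : 'rV[R]_n | `|y - y0| <= b].
have BU : B `<=` coord c @` (U `&` dom c).
  move=> y By; apply: Br; rewrite -ball_normE /= distrC (le_lt_trans By) //.
  by rewrite ltr_pdivrMr // ltr_pMr // ltr1n.
have cB : compact B.
  apply: bounded_closed_compact.
    exists (b + `|y0|); split; first exact: num_real.
    move=> m bm y By /=; apply: le_trans (ltW bm).
    by rewrite -{1}[y](subrK y0); apply: le_trans (ler_normD _ _) _; rewrite lerD2r.
  apply: (@closed_comp _ _ (fun y : 'rV[R]_n => `|y - y0|) [set t | t <= b]); last exact: closed_le.
  move=> y _; apply: (@continuous_comp _ _ _ (fun y : 'rV[R]_n => y - y0) (fun y => `|y|)).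
    by apply: (@cvgD _ _ _ (nbhs y) _ id (fun=> - y0)); [exact: cvg_id|exact: cvg_cst].
  exact: norm_continuous.
pose K := param c @` B.
have cK : closed K.
  apply: compact_closed => //; apply: continuous_compact => //.
  apply: continuous_in_subspaceT => y /set_mem /BU /chart_imageP [_ Dy E].
  by apply: param_continuous; exists (param c y).
have KU z : K z -> U z /\ dom c z.
  by move=> [y /BU /chart_imageP [Uy Dy _] <-].
pose rho z := if `[< dom c z >] then box_bump y0 a b (coord c z) else 0.
have rho0 z : ~ K z -> rho z = 0.
  move=> nK; rewrite /rho; case: asboolP => // Dz; apply: box_bump0 => //.
  rewrite leNgt; apply/negP => H; apply: nK; exists (coord c z); last by rewrite coordK.
  exact: ltW.
exists rho, (dom c `&` (coord c @^-1` ball y0 a)), K; split.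
- apply: smooth_fun_local => z _; have [Dz|nDz] := pselect (dom c z).
    exists (dom c); split=> //; first exact: dom_open.
    have H : smooth_fun S (setT `&` dom c) (fun z => box_bump y0 a b (coord c z)).
      by apply: smooth_fun_chart => //; [exact: openT|apply: box_bump_smooth; apply: chart_image_open; exact: openT].
    rewrite setTI in H; refine (smooth_fun_eq (dom_open c) _ H) => w Dw.
    by rewrite /rho; case: asboolP.
  exists (~` K); split; first exact: closed_openC.
    by move=> /KU [].
  refine (smooth_fun_eq (closed_openC cK) _ (@smooth_fun_cst _ _ _ S _ 0)) => w Kw.
  by rewrite rho0.
- move=> z; rewrite /rho; case: asboolP => _; first exact: box_bump_bound.
  by rewrite lexx ler01.
- split; last by split=> //; apply: ballxx; case/andP: ab.
  rewrite openE => z [Dz Bz]; apply: filterI.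
    by apply: open_nbhs_nbhs; split=> //; apply: dom_open.
  apply: (coord_continuous Dz); apply: open_nbhs_nbhs; split=> //; exact: ball_open.
- by split=> // z /KU [].
- split=> // z [Dz Bz]; rewrite /rho; case: asboolP => // _; apply: box_bump1 => //.
  by move: Bz; rewrite /= -ball_normE /= distrC => /ltW.
Qed.

(** Each basic open set selects one [x] whose [V x] contains it. The values are in [option M]
    because a basic set may lie in no [V x]. *)
Lemma lindelof (V : M -> set M) : @second_countable M -> (forall x, open (V x) /\ V x x) ->
  exists s : nat -> option M, forall y, exists m x, s m = Some x /\ V x y.
Proof.
move=> [B /countable_injP [f fi] [Bo Bb]] HV.
pose P m x := exists b, [/\ B b, f b = m & b `<=` V x].
have H m : exists o : option M, (forall x, o = Some x -> P m x) /\ ((exists x, P m x) -> o != None).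
  have [[x Px]|nP] := pselect (exists x, P m x).
    by exists (Some x); split=> // z [<-].
  by exists None; split.
have [s Hs] := choice H; exists s => y.
have [b [Bbb yb] bV] : filter_from [set U | B U /\ U y] id (V y).
  by apply: Bb; apply: open_nbhs_nbhs; apply: HV.
have [H1 H2] := Hs (f b).
have : s (f b) != None by apply: H2; exists y, b.
case E : (s (f b)) => [x|//] _; exists (f b), x; split=> //.
have [b' [Bb' fbb' b'V]] := H1 x E.
by apply: b'V; rewrite (fi b' b) ?inE.
Qed.

End Bump.

Section Glue.
Context {R : realType} {n : nat} {M : topologicalType}.
Variable S : smooth_structure R n M.
Hypothesis (hM : hausdorff_space M) (cM : @second_countable M).
Variables (T : Type) (t0 : T) (Sm : set M -> (M -> T) -> Prop) (interp : M -> R -> T -> T -> T).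
Hypothesis Sm_local : forall U s,
  (forall x, U x -> exists V s', [/\ open V, V x, Sm V s' & eqon V s' s]) -> Sm U s.
Hypothesis Sm_sub : forall U V s, open V -> V `<=` U -> Sm U s -> Sm V s.
Hypothesis Sm_interp : forall U chi s0 s1, open U -> smooth_fun S U chi ->
  (forall x, U x -> 0 <= chi x <= 1) -> Sm U s0 -> Sm U s1 ->
  Sm U (fun x => interp x (chi x) (s0 x) (s1 x)).
Hypothesis interp0 : forall U s0 s1 x, open U -> U x -> Sm U s0 -> Sm U s1 ->
  interp x 0 (s0 x) (s1 x) = s0 x.
Hypothesis interp1 : forall U s0 s1 x, open U -> U x -> Sm U s0 -> Sm U s1 ->
  interp x 1 (s0 x) (s1 x) = s1 x.

(** Two nested cutoffs accompany a local section. [bd_rho], supported in the domain and 1 on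
    [bd_nbhd], inserts the section; [bd_rho'], supported in [bd_nbhd] and 1 on [bd_core], protects
    the core from later insertions. *)
Record bump_data := BumpData {
  bd_dom : set M; bd_sec : M -> T;
  bd_rho : M -> R; bd_rho' : M -> R;
  bd_supp : set M; bd_supp' : set M;
  bd_nbhd : set M; bd_core : set M }.

Definition bump_ok (d : bump_data) :=
  [/\ [/\ open (bd_dom d), Sm (bd_dom d) (bd_sec d), closed (bd_supp d) & bd_supp d `<=` bd_dom d],
      [/\ smooth_fun S [set: M] (bd_rho d), forall z, 0 <= bd_rho d z <= 1,
          forall z, bd_nbhd d z -> bd_rho d z = 1 & forall z, ~ bd_supp d z -> bd_rho d z = 0],
      [/\ smooth_fun S [set: M] (bd_rho' d), forall z, 0 <= bd_rho' d z <= 1,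
          forall z, bd_core d z -> bd_rho' d z = 1 & forall z, ~ bd_supp' d z -> bd_rho' d z = 0] &
      [/\ open (bd_nbhd d), open (bd_core d), closed (bd_supp' d) & bd_supp' d `<=` bd_nbhd d]].

Section Sequence.
Variable ds : nat -> option bump_data.
Hypothesis ds_ok : forall m d, ds m = Some d -> bump_ok d.

Definition rho'_at m z : R := if ds m is Some d then bd_rho' d z else 0.
Definition cut m z : R :=
  if ds m is Some d then bd_rho d z * \prod_(i < m) (1 - rho'_at i z) else 0.

(* The data [ds] are inserted one after the other. The cutoff of the m-th one
   vanishes where some earlier [bd_rho'] is 1, so that the sequence is locally
   stationary. *)
Fixpoint glued m : M -> T :=
  if m is m'.+1 then fun z =>
    if ds m' is Some d then
      if cut m' z == 0 then glued m' z
      else if cut m' z == 1 then bd_sec d z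
      else interp z (cut m' z) (glued m' z) (bd_sec d z)
    else glued m' z
  else fun=> t0.

Lemma rho'_at_bound i z : 0 <= rho'_at i z <= 1.
Proof.
rewrite /rho'_at; case E : (ds i) => [d|]; last by rewrite lexx ler01.
by have [_ _ [_ + _ _] _] := ds_ok E; apply.
Qed.

Lemma cut_bound m z : 0 <= cut m z <= 1.
Proof.
rewrite /cut; case E : (ds m) => [d|]; last by rewrite lexx ler01.
have [_ [_ /(_ z) /andP[r0 r1] _ _] _ _] := ds_ok E.
have P i : 0 <= 1 - rho'_at i z <= 1.
  by have /andP[h0 h1] := rho'_at_bound i z; rewrite subr_ge0 h1 /= gerBl.
have p0 : 0 <= \prod_(i < m) (1 - rho'_at i z) by apply: prodr_ge0 => i _; case/andP: (P i).
have p1 : \prod_(i < m) (1 - rho'_at i z) <= 1 by apply: prodr_ile1 => i _.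
by rewrite mulr_ge0 //= mulr_ile1.
Qed.

Lemma cut_smooth m : smooth_fun S [set: M] (cut m).
Proof.
have oT := @openT M.
rewrite /cut; case E : (ds m) => [d|]; last exact: smooth_fun_cst.
have [_ [Hr _ _ _] _ _] := ds_ok E.
apply: smooth_funM => //.
refine (@smooth_fun_prod _ _ _ S _ _ _ _ (fun (i : 'I_m) z => 1 - rho'_at i z) oT _) => i _.
apply: smooth_funD => //; first exact: smooth_fun_cst.
apply: smooth_funN => //; rewrite /rho'_at; case E' : (ds i) => [d'|]; last exact: smooth_fun_cst.
by have [_ _ [H _ _ _] _] := ds_ok E'; exact: H.
Qed.

Lemma cut_support m d z : ds m = Some d -> cut m z != 0 -> bd_supp d z.
Proof.
move=> E; rewrite /cut E => H; apply: contrapT => nK.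
have [_ [_ _ _ /(_ z nK) r0] _ _] := ds_ok E.
by move: H; rewrite r0 mul0r eqxx.
Qed.

Lemma cut_core i d m z : ds i = Some d -> (i < m)%N -> bd_core d z -> cut m z = 0.
Proof.
move=> E im Cz; rewrite /cut; case: (ds m) => // d'.
have [_ _ [_ _ /(_ z Cz) r1 _] _] := ds_ok E.
by rewrite (bigD1 (Ordinal im)) //= /rho'_at E r1 subrr mul0r mulr0.
Qed.

(** Near these points some section was inserted with cutoff exactly 1, which overwrites the
    meaningless starting value [t0]. *)
Definition settled m : set M :=
  [set z | exists i V, [/\ (i < m)%N, ds i <> None, open V, V z & forall w, V w -> cut i w = 1]].

Lemma settled_open m : open (settled m).
Proof.
rewrite openE => z [i [V [im di oV Vz HV]]].
have : nbhs z V by apply: open_nbhs_nbhs.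
by apply: filterS => w Vw; exists i, V.
Qed.

(** Near a point settled at step [m] itself the glued section is [bd_sec d]. Near a point settled
    earlier it is an interpolation of two valid sections inside [bd_dom d], and unchanged outside
    the closed support. The branches of [glued] at 0 and 1 keep [interp] away from invalid
    arguments. *)
Lemma glued_ok m : Sm (settled m) (glued m).
Proof.
elim: m => [|m IH]; first by apply: Sm_local => z [i [V []]].
have oW := settled_open m.
case E : (ds m) => [d|]; last first.
  have -> : settled m.+1 = settled m.
    apply/seteqP; split=> z [i [V [im di oV Vz HV]]]; exists i, V; split=> //.
      by move: im; rewrite ltnS leq_eqVlt => /predU1P[im|//]; rewrite im E in di.
    exact: ltnW.
  by have -> : glued m.+1 = glued m by apply/funext => z /=; rewrite E.
have [[oU SU cK KU] _ _ _] := ds_ok E.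
apply: Sm_local => z [i [V [im di oV Vz HV]]].
move: im; rewrite ltnS leq_eqVlt => /predU1P[im|im].
  rewrite im in HV; exists (V `&` bd_dom d), (bd_sec d); split=> //.
  - exact: openI.
  - split=> //; apply: KU; apply: (cut_support E); by rewrite HV // oner_eq0.
  - by apply: Sm_sub SU; [exact: openI|move=> w []].
  - by move=> w [Vw _] /=; rewrite E HV // oner_eq0 eqxx.
have Wz : settled m z by exists i, V.
have [Uz|nUz] := pselect (bd_dom d z).
  have oWU : open (settled m `&` bd_dom d) by apply: openI.
  exists (settled m `&` bd_dom d), (fun w => interp w (cut m w) (glued m w) (bd_sec d w)).
  have S0 : Sm (settled m `&` bd_dom d) (glued m) by apply: Sm_sub IH => // w [].
  have S1 : Sm (settled m `&` bd_dom d) (bd_sec d) by apply: Sm_sub SU => // w [].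
  split=> //.
    apply: Sm_interp => //; first by apply: smooth_fun_sub (cut_smooth m).
    by move=> w _; apply: cut_bound.
  move=> w Ww /=; rewrite E; case: eqP => [->|_]; first exact: (interp0 oWU Ww S0 S1).
  by case: eqP => [->|_] //; exact: (interp1 oWU Ww S0 S1).
have oK : open (~` bd_supp d) by apply: closed_openC.
exists (settled m `&` ~` bd_supp d), (glued m); split=> //.
- exact: openI.
- by split=> // /KU.
- by apply: (Sm_sub _ _ IH); [exact: openI|move=> w []].
- move=> w [_ nK] /=; rewrite E; case: eqP => // /eqP H.
  by case: nK; apply: (cut_support E).
Qed.

Lemma glued_stable i d m z : ds i = Some d -> bd_core d z -> (i < m)%N -> glued m z = glued i.+1 z.
Proof.
move=> E Cz; elim: m => // m IH; rewrite ltnS leq_eqVlt => /predU1P[->//|im].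
rewrite /= -/(glued i.+1 z) -(IH im); case: (ds m) => // d'.
by rewrite (cut_core E im Cz) eqxx.
Qed.

(** Take the least [m] such that [z] is in the support of the m-th [bd_rho']. The earlier supports
    are closed, so their factors are 1 near [z], and [bd_rho] of the m-th datum is 1 there because
    that support lies in [bd_nbhd]. *)
Lemma settled_core i d z : ds i = Some d -> bd_core d z -> settled i.+1 z.
Proof.
move=> E Cz.
have K'z : exists m, `[< exists d', ds m = Some d' /\ bd_supp' d' z >].
  exists i; apply/asboolP; exists d; split=> //; apply: contrapT => nK.
  have [_ _ [_ _ r1 r0] _] := ds_ok E.
  by have := r1 z Cz; rewrite (r0 z nK) => /esym /eqP; rewrite oner_eq0.
case: (ex_minnP K'z) => m /asboolP [d' [E' Kz]] min.
have mi : (m <= i)%N.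
  apply: min; apply/asboolP; exists d; split=> //; apply: contrapT => nK.
  have [_ _ [_ _ r1 r0] _] := ds_ok E.
  by have := r1 z Cz; rewrite (r0 z nK) => /esym /eqP; rewrite oner_eq0.
have [_ [_ _ r1 _] _ [oN _ cK' KN]] := ds_ok E'.
have H : \forall w \near z, bd_nbhd d' w /\ forall i : 'I_m, rho'_at i w = 0.
  have H1 : nbhs z (bd_nbhd d') by apply: open_nbhs_nbhs; split=> //; apply: KN.
  have H2 : \forall w \near z, forall i : 'I_m, rho'_at i w = 0.
    apply: near_all => -[j jm] /=; rewrite /rho'_at; case Ej : (ds j) => [dj|]; last exact: nearW.
    have [_ _ [_ _ _ r0] [_ _ cKj _]] := ds_ok Ej.
    have : nbhs z (~` bd_supp' dj).
      apply: open_nbhs_nbhs; split; first exact: closed_openC.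
      move=> Kj; have : (m <= j)%N by apply: min; apply/asboolP; exists dj.
      by rewrite leqNgt jm.
    by apply: filterS => w; apply: r0.
  by apply: filterS2 H1 H2.
have [V [oV Vz VH]] := near_open H.
exists m, V; split=> //; first by rewrite E'.
move=> w /VH [Nw Rw]; rewrite /cut E' r1 // mul1r big1 // => j _.
by rewrite Rw subr0.
Qed.

End Sequence.

(** No linear structure is required of the sections: an interpolation between two of them, exact at
    0 and 1, takes the place of a partition of unity. *)
Theorem glue_sections : (forall x, exists U s, [/\ open U, U x & Sm U s]) -> exists s, Sm [set: M] s.
Proof.
move=> ex.
have H x : exists d, bump_ok d /\ bd_core d x.
  have [U [s [oU Ux SU]]] := ex x.
  have [rho [V [K [h1 h2 [oV Vx] [cK KU] [h3 h4]]]]] := manifold_bump S hM oU Ux.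
  have [rho' [V' [K' [h1' h2' [oV' Vx'] [cK' KU'] [h3' h4']]]]] := manifold_bump S hM oV Vx.
  by exists (BumpData U s rho rho' K K' V V').
have [d Hd] := choice H.
have dV x : open (bd_core (d x)) /\ bd_core (d x) x.
  by have [[_ _ _ []]] := Hd x.
have [idx Hidx] := lindelof cM dV.
pose ds m := if idx m is Some x then Some (d x) else None.
have ds_ok m e : ds m = Some e -> bump_ok e.
  by rewrite /ds; case: (idx m) => // x [<-]; case: (Hd x).
have C y : exists m e, ds m = Some e /\ bd_core e y.
  by have [m [x [E Vy]]] := Hidx y; exists m, (d x); rewrite /ds E.
have [N HN] := choice C.
exists (fun z => glued ds (N z).+1 z); apply: Sm_local => z _.
have [e [E Cz]] := HN z.
have [_ _ _ [_ oC _ _]] := ds_ok _ _ E.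
exists (settled ds (N z).+1 `&` bd_core e), (glued ds (N z).+1); split.
- by apply: openI => //; apply: settled_open.
- by split=> //; apply: settled_core E Cz.
- apply: Sm_sub (glued_ok ds_ok (N z).+1); last by move=> w [].
  by apply: openI => //; apply: settled_open.
- move=> w [_ Cw]; have [e' [E' Cw']] := HN w.
  (* Both indices are past the stage at which the sequence becomes stationary at [w], so they give
     the value of stage [L]. *)
  pose L := (maxn (N z) (N w)).+1.
  rewrite -(@glued_stable ds ds_ok _ _ L _ E Cw) ?ltnS ?leq_maxl //.
  by rewrite -(@glued_stable ds ds_ok _ _ L _ E' Cw') ?ltnS ?leq_maxr.
Qed.

End Glue.

(** * Adapted charts of a normal crossing divisor *)

Section SignChange.
Context {R : realType} {n : nat}.
Implicit Types (F : 'rV[R]_n -> R) (W : set 'rV[R]_n) (y z u v : 'rV[R]_n).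

(** [F] changes sign along [u] through [y]. By continuity it does so along the parallel segments
    through nearby points, and the intermediate value theorem gives a zero on each. *)
Lemma derive_sign_change F W y u : open W -> W y -> smooth_in W F -> F y = 0 -> 'D_u F y != 0 ->
  \forall z \near y, exists s : R, W (z + s *: u) /\ F (z + s *: u) = 0.
Proof.
move=> oW Wy HF F0 D0.
have [r r0 Br] : exists2 r : R, 0 < r & forall z, `|z - y| < r -> W z.
  have /nbhs_ballP [r r0 Br] : nbhs y W by apply: open_nbhs_nbhs.
  by exists r => // z H; apply: Br; rewrite -ball_normE /= distrC.
have L : h^-1 *: ((F \o shift y) (h *: u) - F y) @[h --> 0^'] --> 'D_u F y.
  exact: (smooth_in_derivable Wy HF).
have nL : \forall h \near (0 : R)^', `|'D_u F y - h^-1 * F (h *: u + y)| < `|'D_u F y|.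
  have /cvgrPdist_lt /(_ _ _) H := L.
  have := H `|'D_u F y|; rewrite normr_gt0 D0 => /(_ isT).
  by apply: filterS => h /=; rewrite F0 subr0.
have [d d0 Hd] : exists2 d : R, 0 < d & forall h, h != 0 -> `|h| < d -> 0 < 'D_u F y * (h^-1 * F (h *: u + y)).
  move: nL; rewrite /= => -[d /= d0 Hd]; exists d => // h hn0 hd.
  have := Hd h; rewrite /ball_ /= sub0r normrN => /(_ hd hn0).
  set a := 'D_u F y; set b := h^-1 * _ => ab.
  have [a0|a0|a0] := ltgtP a 0.
  - rewrite nmulr_rgt0 //; move: ab; rewrite (ltr0_norm a0) ltr_norml => /andP[+ _]; lra.
  - rewrite pmulr_rgt0 //; move: ab; rewrite (gtr0_norm a0) ltr_norml => /andP[_ +]; lra.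
  - by move: D0; rewrite -/a a0 eqxx.
(* Below [d] for the sign of the difference quotients; the second bound keeps [s u] below [r / 2],
   leaving [r / 2] for the displacement of [z]. The [+ 1] covers [u = 0]. *)
pose h := Num.min (d / 2) (r / 2 / (`|u| + 1)).
have u1 : 0 < `|u| + 1 by apply: ltr_wpDl.
have h0 : 0 < h by rewrite lt_min !divr_gt0.
have hd : `|h| < d.
  by rewrite gtr0_norm // gt_min ltr_pdivrMr // ltr_pMr // ltr1n.
have hr s : `|s| <= h -> `|s *: u| < r / 2.
  move=> sh; rewrite normrZ; apply: (@le_lt_trans _ _ (h * `|u|)); first by rewrite ler_wpM2r.
  apply: (@lt_le_trans _ _ (h * (`|u| + 1))); first by rewrite ltr_pM2l // ltrDl.
  by rewrite -ler_pdivlMr // ge_min lexx orbT.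
have P1 := Hd h (lt0r_neq0 h0) hd.
have P2 : 0 < 'D_u F y * ((- h)^-1 * F ((- h) *: u + y)).
  by apply: Hd; rewrite ?oppr_eq0 ?lt0r_neq0 // normrN.
(* The difference quotients at [h] and [- h] have the same sign, so the values of [F] have opposite
   signs. *)
have P : F (y + h *: u) * F (y + (- h) *: u) < 0.
  have := mulr_gt0 P1 P2; rewrite invrN [h *: u + y]addrC [- h *: u + y]addrC.
  set a := 'D_u F y; set b := F _; set c := F _.
  have -> : a * (h^-1 * b) * (a * (- h^-1 * c)) = - ((a * h^-1) ^+ 2 * (b * c)) by ring.
  have q0 : 0 < (a * h^-1) ^+ 2.
    by rewrite lt0r sqr_ge0 andbT sqrf_eq0 mulf_neq0 // invr_eq0 lt0r_neq0.
  by rewrite oppr_gt0 pmulr_rlt0.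
have Wz z s : `|z - y| < r / 2 -> `|s| <= h -> W (z + s *: u).
  move=> zy sh; apply: Br; rewrite addrAC (splitr r) (le_lt_trans (ler_normD _ _)) // ltrD // hr //.
have cS s : `|s| <= h -> {for y, continuous (fun z => F (z + s *: u))}.
  move=> sh; apply: (@continuous_comp _ _ _ (fun z => z + s *: u) F).
    by apply: (@cvgD _ _ _ (nbhs y) _ id (fun=> s *: u)); [exact: cvg_id|exact: cvg_cst].
  apply: smooth_in_continuous HF; apply: Wz => //; by rewrite subrr normr0 divr_gt0.
have ch : `|h| <= h by rewrite gtr0_norm.
have cnh : `|- h| <= h by rewrite normrN gtr0_norm.
have N1 : \forall z \near y, F (z + h *: u) * F (z + (- h) *: u) < 0.
  have C : {for y, continuous (fun z => F (z + h *: u) * F (z + (- h) *: u))}.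
    by apply: (@continuousM R); apply: cS.
  by apply: (C (fun t => t < 0)); exact: lt_nbhsl.
have N2 : \forall z \near y, `|z - y| < r / 2.
  have : nbhs y (ball y (r / 2)) by apply: nbhsx_ballx; rewrite divr_gt0.
  by apply: filterS => z; rewrite -ball_normE /= distrC.
apply: filterS2 N1 N2 => z Nz zy.
have cI : {within `[- h, h], continuous (fun s : R => F (z + s *: u))}.
  apply: derivable_within_continuous => s; rewrite in_itv /= -ler_norml => sh.
  have Ws := Wz z s zy sh.
  by have [] := @is_derive_line _ _ F z u s (smooth_in_derivable Ws HF).
have hh : - h <= h by rewrite (le_trans _ (ltW h0)) // oppr_le0 ltW.
have [|s] := @IVT R (fun s : R => F (z + s *: u)) (- h) h 0 hh cI.
  move: Nz; set a := F _; set b := F _ => ab.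
  have [b0|b0|b0] := ltgtP b 0.
  - have a0 : 0 < a by rewrite -(nmulr_llt0 _ b0).
    by rewrite ge_min le_max (ltW b0) (ltW a0) orbT.
  - have a0 : a < 0 by rewrite -(pmulr_llt0 _ b0).
    by rewrite ge_min le_max (ltW b0) (ltW a0) orbT.
  - by move: ab; rewrite b0 mulr0 ltxx.
rewrite in_itv /= -ler_norml => sh Fs; exists s; split=> //.
exact: Wz.
Qed.

Variable j : 'I_n.
Local Notation ej := (delta_mx 0 j : 'rV[R]_n).

(** Otherwise some [u] tangent to the hyperplane has a nonzero derivative. Starting off the
    hyperplane and moving along [u], which fixes coordinate [j], one would reach a zero of [F] off
    the hyperplane. *)
Lemma normal_derivative F W y : open W -> W y -> smooth_in W F ->
  (forall z, W z -> F z = 0 -> z 0 j = 0) -> F y = 0 -> (exists v, 'D_v F y != 0) ->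
  'D_ej F y != 0.
Proof.
move=> oW Wy HF Z0 F0 [v Dv]; apply/eqP => E.
have dF := smooth_in_differentiable oW Wy HF.
pose u := v - v 0 j *: ej.
have Du : 'D_u F y != 0.
  have : 'D_v F y = 'D_u F y + v 0 j * 'D_ej F y.
    by rewrite !deriveE // /u linearB linearZ /= subrK.
  by rewrite E mulr0 addr0 => <-.
have yj := Z0 y Wy F0.
have uj : u 0 j = 0 by rewrite !mxE !eqxx mulr1 subrr.
have N := derive_sign_change oW Wy HF F0 Du.
have [d d0 Hd] : exists2 d : R, 0 < d & forall z, `|z - y| < d -> exists s : R, W (z + s *: u) /\ F (z + s *: u) = 0.
  move: N => /nbhs_ballP [d d0 Hd]; exists d => // z H; apply: Hd; by rewrite -ball_normE /= distrC.
(* A point near [y] whose coordinate [j] is [d / 2], hence nonzero. *)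
have [|s [Ws Fs]] := Hd (y + (d / 2) *: ej).
  rewrite addrAC subrr add0r; apply: (@le_lt_trans _ _ (d / 2)).
    apply: mx_norm_le; first by rewrite divr_ge0 // ltW.
    move=> l; rewrite !mxE eqxx /=; case: eqP => _; last by rewrite mulr0 normr0 divr_ge0 // ltW.
    by rewrite mulr1 gtr0_norm // divr_gt0.
  by rewrite ltr_pdivrMr // ltr_pMr // ltr1n.
have := Z0 _ Ws Fs; rewrite 2!mxE [(s *: u) 0 j]mxE uj mulr0 addr0 yj add0r !mxE !eqxx mulr1 => /eqP.
by rewrite gt_eqF // divr_gt0.
Qed.

(** The line through [z] in the direction [e_j] contains a zero of [F]. Zeros lie in the hyperplane,
    and for [z] in the hyperplane this line meets it only at [z]. *)
Lemma hyperplane_local F W y : open W -> W y -> smooth_in W F ->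
  (forall z, W z -> F z = 0 -> z 0 j = 0) -> F y = 0 -> (exists v, 'D_v F y != 0) ->
  \forall z \near y, (z : 'rV[R]_n) 0 j = 0 -> F z = 0.
Proof.
move=> oW Wy HF Z0 F0 Dv; have Dj := normal_derivative oW Wy HF Z0 F0 Dv.
have := derive_sign_change oW Wy HF F0 Dj; apply: filterS => z [s [Ws Fs]] zj.
have := Z0 _ Ws Fs; rewrite !mxE zj !eqxx mulr1 add0r => s0.
by move: Fs; rewrite s0 scale0r addr0.
Qed.

End SignChange.

Section Cancel.
Context {R : realType} {n : nat} {M : topologicalType}.
Variable S : smooth_structure R n M.
Implicit Types (U V : set M) (f g h : M -> R) (x : M).

(** On the open set where [h] and [h'] differ, [f] vanishes identically, and so does its
    differential, against the hypothesis. *)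
Lemma submersion_cancel V f h h' : open V -> smooth_fun S V f ->
  (forall x, V x -> f x = 0 -> exists v, dfun S f x v != 0) ->
  smooth_fun S V h -> smooth_fun S V h' -> eqon V (fun x => h x * f x) (fun x => h' x * f x) ->
  eqon V h h'.
Proof.
move=> oV Hf df Hh Hh' E x Vx; apply/eqP; rewrite -subr_eq0; apply/eqP; apply: contrapT => /eqP d0.
have Hd : smooth_fun S V (fun x => h x - h' x) by apply: smooth_funD => //; apply: smooth_funN.
pose W := V `&` [set z | [set t : R | t != 0] (h z - h' z)].
have oW : open W by apply: (smooth_fun_open oV Hd); exact: open_neq.
have f0 : eqon W f (fun=> 0).
  move=> z [Vz /= dz]; have /eqP := E z Vz; rewrite -subr_eq0 -mulrBl mulf_eq0 (negbTE dz) /=.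
  by move/eqP.
have Wx : W x by [].
have [v] := df x Vx (f0 x Wx).
by rewrite (dfun_eq S oW Wx f0) /dfun derive_cst eqxx.
Qed.

End Cancel.

Section Divisor.
Context {R : realType} {n : nat} {M : topologicalType}.
Variable S : smooth_structure R n M.
Context {k : nat}.
Variable Z : 'I_k -> set M.
Hypothesis ncZ : normal_crossing S Z.
Variable gf : 'I_k -> M -> R.
Hypothesis gfP : forall i, global_defining S (Z i) (gf i).
Implicit Types (c d : chart R n M) (U V : set M) (f g h : M -> R) (x : M).
Local Notation smx := (smooth_mx S).
Local Notation dfun := (dfun S).

Lemma divisor_compl_open i : open (~` Z i).
Proof.
have [sf Zf _] := gfP i.
have -> : ~` Z i = setT `&` [set x | [set t : R | t != 0] (gf i x)].
  apply/seteqP; split=> x /=; first by move=> nZ; split=> //; apply/eqP => /Zf.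
  by move=> [_ /eqP H] /Zf.
by apply: (smooth_fun_open openT sf); exact: open_neq.
Qed.

(** [idx] says which hypersurface a coordinate cuts out, [None] marking the free coordinates. Unlike
    in [normal_crossing] the zero sets are equal on all of [U], and a hypersurface without a
    coordinate misses [U]. *)
Definition adapted c U (idx : 'I_n -> option 'I_k) :=
  [/\ smooth_chart S c, open U, U `<=` dom c,
      forall j j' i, idx j = Some i -> idx j' = Some i -> j = j' &
      forall i x, U x -> (Z i x <-> exists2 j, idx j = Some i & coord c x 0 j = 0)].

(** [normal_crossing] only includes each hypersurface through [p] in a hyperplane; its defining
    function gives the converse near [p], by [hyperplane_local]. The other hypersurfaces are closed,
    hence avoided by a small [U]. *)
Lemma adapted_chart p : exists c U idx, adapted c U idx /\ U p.
Proof.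
pose A := [pred i : 'I_k | `[< Z i p >]].
pose s (l : 'I_#|A|) : 'I_k := enum_val l.
have sinj : injective s by apply: enum_val_inj.
have sZ l : Z (s l) p by apply/asboolP; have := enum_valP l.
have [_ _ /(_ _ s p sinj sZ) [c [mn [[Sc Dc cp0] Hc]]]] := ncZ.
pose w := widen_ord mn.
pose idx (j : 'I_n) : option 'I_k := omap s (insub (val j)).
have idxw l : idx (w l) = Some (s l).
  rewrite /idx insubT /=; first by case: l.
  by move=> H; congr (Some (s _)); apply: val_inj.
have idxP j i : idx j = Some i -> exists l, j = w l /\ i = s l.
  rewrite /idx; case: insubP => //= l _ lj [<-]; exists l; split=> //; exact: val_inj.
have loc l : \forall x \near p, coord c x 0 (w l) = 0 -> Z (s l) x.
  have [sf Zf df] := gfP (s l).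
  pose F y := gf (s l) (param c y).
  have oW : open (coord c @` (setT `&` dom c)) by apply: chart_image_open; exact: openT.
  have Wp : (coord c @` (setT `&` dom c)) (coord c p) by exists p.
  have HF : smooth_in (coord c @` (setT `&` dom c)) F by apply: (smooth_fun_via openT Sc sf).
  have Z0 y : (coord c @` (setT `&` dom c)) y -> F y = 0 -> y 0 (w l) = 0.
    by move=> /chart_imageP [_ Dy E] /Zf Zy; rewrite -E; apply: Hc.
  have F0 : F (coord c p) = 0 by rewrite /F coordK //; apply/Zf.
  have Dv : exists v, 'D_v F (coord c p) != 0.
    have [v dv] := df p (sZ l); exists (v *m jac S c p).
    by rewrite -(dfunE v openT I Dc Sc sf).
  have N := hyperplane_local oW Wp HF Z0 F0 Dv.
  have N' : \forall x \near p, (coord c x) 0 (w l) = 0 -> F (coord c x) = 0.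
    exact: (coord_continuous Dc N).
  have ND : nbhs p (dom c) by apply: open_nbhs_nbhs; split=> //; apply: dom_open.
  by apply: filterS2 ND N' => x Dx H /H; rewrite /F coordK // => /Zf.
have far i : \forall x \near p, Z i x -> Z i p.
  have [Zp|nZ] := pselect (Z i p); first exact: nearW.
  have : nbhs p (~` Z i) by apply: open_nbhs_nbhs; split=> //; apply: divisor_compl_open.
  by apply: filterS => x.
have N : \forall x \near p, [/\ dom c x, forall l, coord c x 0 (w l) = 0 -> Z (s l) x & forall i, Z i x -> Z i p].
  have N0 : nbhs p (dom c) by apply: open_nbhs_nbhs; split=> //; apply: dom_open.
  have N1 := near_all (nbhs_filter p) loc.
  have N2 := near_all (nbhs_filter p) far.
  by apply: filterS3 N0 N1 N2 => x *; split.
have [U [oU Up UP]] := near_open N.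
exists c, U, idx; split=> //; split=> //.
- by move=> x /UP [].
- by move=> j j' i /idxP [l [-> ->]] /idxP [l' [-> /sinj ->]].
- move=> i x /UP [Dx H1 H2]; split=> [Zx|[j /idxP [l [-> ->]]]]; last exact: H1.
  have iA : i \in A by apply/asboolP; exact: H2 Zx.
  have E : s (enum_rank_in iA i) = i by rewrite /s enum_rankK_in.
  exists (w (enum_rank_in iA i)); first by rewrite idxw E.
  by apply: Hc => //; rewrite E.
Qed.

Section Adapted.
Variables (c : chart R n M) (U : set M) (idx : 'I_n -> option 'I_k).
Hypothesis ad : adapted c U idx.

Local Notation xj j := (fun x => coord c x 0 j).

Lemma adapted_zero i j x : idx j = Some i -> U x -> (Z i x <-> coord c x 0 j = 0).
Proof.
have [_ _ _ inj HZ] := ad => ij Ux; rewrite HZ //; split=> [[j' ij' <-]|H]; last by exists j.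
by rewrite (inj _ _ _ ij ij').
Qed.

Lemma coord_smooth_on j V : V `<=` U -> smooth_fun S V (xj j).
Proof. have [Sc _ Uc _ _] := ad => VU; apply: smooth_fun_sub (smooth_fun_coord j Sc) => x /VU /Uc. exact. Qed.

Lemma coord_submersion j x : U x -> exists v, dfun (xj j) x v != 0.
Proof.
have [Sc _ Uc _ _] := ad => Ux; exists (delta_mx 0 j *m invmx (jac S c x)).
rewrite dfun_coord //; last exact: Uc.
by rewrite mulmxKV ?jac_unit //; [rewrite mxE !eqxx oner_eq0|exact: Uc].
Qed.

Lemma coord_cancel j V h h' : open V -> V `<=` U -> smooth_fun S V h -> smooth_fun S V h' ->
  eqon V (fun x => h x * xj j x) (fun x => h' x * xj j x) -> eqon V h h'.
Proof.
move=> oV VU Hh Hh'.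
apply: (@submersion_cancel _ _ _ S V (xj j) h h' oV (coord_smooth_on j VU)) => //.
by move=> x /VU Ux _; apply: coord_submersion.
Qed.

Lemma coord_quotient j V g : open V -> V `<=` U -> smooth_fun S V g ->
  (forall x, V x -> coord c x 0 j = 0 -> g x = 0) ->
  let q := fun x => hquot j (fun y => g (param c y)) (coord c x) in
  smooth_fun S V q /\ eqon V g (fun x => q x * xj j x).
Proof.
have [Sc _ Uc _ _] := ad => oV VU Hg g0 q.
have oW := chart_image_open (c := c) oV.
have HG := smooth_fun_via oV Sc Hg.
have G0 y : (coord c @` (V `&` dom c)) y -> y 0 j = 0 -> g (param c y) = 0.
  by move=> /chart_imageP [Vy Dy <-]; rewrite coordK //; apply: g0.
have Vc : V `&` dom c = V by apply/seteqP; split=> [x []|x Vx] //; split=> //; apply/Uc/VU.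
split.
  have := @smooth_fun_chart _ _ _ S c V (hquot j (fun y => g (param c y))) oV Sc.
  by rewrite Vc; apply; rewrite -{1}Vc; apply: (hquot_smooth oW HG G0).
move=> x Vx; have Dx : dom c x by apply/Uc/VU.
have := hquotE G0 (y := coord c x); rewrite coordK // => -> //; last by exists x.
by rewrite mulrC.
Qed.

(** Write [f = q x_j] by Hadamard's lemma. Where [q] vanishes so does [f], hence also [x_j], and
    then [df = q dx_j + x_j dq = 0] on the hypersurface, which is excluded. *)
Lemma defining_unit i j f : idx j = Some i -> global_defining S (Z i) f ->
  exists u, [/\ smooth_fun S U u, forall x, U x -> u x != 0 & eqon U f (fun x => u x * xj j x)].
Proof.
have [Sc oU Uc _ _] := ad => ij [sf Zf df].
have sfU : smooth_fun S U f by apply: smooth_fun_sub sf.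
have f0 x : U x -> coord c x 0 j = 0 -> f x = 0.
  by move=> Ux /(adapted_zero ij Ux) /Zf.
have [Hq E] := coord_quotient oU (@subset_refl _ U) sfU f0.
eexists; split; [exact: Hq| |exact: E] => x Ux; apply/eqP => q0.
have fx : f x = 0 by rewrite E // q0 mul0r.
have xj0 : coord c x 0 j = 0 by apply/(adapted_zero ij Ux)/Zf.
have [v] := df x ((Zf x).1 fx).
rewrite (dfun_eq S oU Ux E) (dfunM _ oU Ux Hq (coord_smooth_on j (@subset_refl _ U))).
by rewrite q0 xj0 !mul0r addr0 eqxx.
Qed.

Lemma vanish_coord i j V g : idx j = Some i -> open V -> V `<=` U -> vanishing S (Z i) V g ->
  exists q, smooth_fun S V q /\ eqon V g (fun x => q x * xj j x).
Proof.
move=> ij oV VU [Hg g0]; eexists; apply: (coord_quotient (j := j) oV VU Hg) => x Vx H.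
by apply: g0 => //; apply/(adapted_zero ij (VU x Vx)).
Qed.

End Adapted.

(** Values are chosen pointwise among the local solutions, and uniqueness identifies the result with
    each of them. *)
Lemma smooth_quotient_glue (P : set M -> (M -> R) -> Prop) V :
  open V ->
  (forall U h h' x, open U -> P U h -> P U h' -> U x -> h x = h' x) ->
  (forall U W h, open W -> W `<=` U -> P U h -> P W h) ->
  (forall U h, P U h -> smooth_fun S U h) ->
  (forall x, V x -> exists U h, [/\ open U, U x, U `<=` V & P U h]) ->
  exists h, smooth_fun S V h /\
    forall x, V x -> exists U h', [/\ open U, U x, U `<=` V, P U h' & eqon U h' h].
Proof.
move=> oV uniq sub sm ex.
have H x : exists r : R, V x -> exists U h, [/\ open U, U x, U `<=` V, P U h & h x = r].
  have [Vx|nV] := pselect (V x); last by exists 0.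
  by have [U [h [oU Ux UV PU]]] := ex x Vx; exists (h x) => _; exists U, h.
have [h Hh] := choice H.
have K x : V x -> exists U h', [/\ open U, U x, U `<=` V, P U h' & eqon U h' h].
  move=> Vx; have [U [h' [oU Ux UV PU]]] := ex x Vx; exists U, h'; split=> // z Uz.
  have [U' [h'' [oU' Uz' UV' PU' <-]]] := Hh z (UV z Uz).
  apply: (uniq (U `&` U')) => //; first exact: openI.
    by apply: sub PU; [exact: openI|move=> w []].
  by apply: sub PU'; [exact: openI|move=> w []].
exists h; split=> //; apply: smooth_fun_local => x /K [U [h' [oU Ux UV PU E]]].
by exists U; split=> //; refine (smooth_fun_eq oU E (sm _ _ PU)).
Qed.

(** In an adapted chart around a point of the hypersurface, [g = q x_j] and [f = u x_j] with [u]
    nonvanishing, so [q / u] is the quotient; elsewhere it is [g / f]. *)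
Lemma global_defining_frame i f : global_defining S (Z i) f -> ideal_frame S (Z i) [set: M] f.
Proof.
move=> gd; have [sf Zf df] := gd; split; first by split=> // x _ /Zf.
move=> V g oV _ [Hg g0].
have cancel U h h' : open U -> smooth_fun S U h -> smooth_fun S U h' ->
    eqon U (fun x => h x * f x) (fun x => h' x * f x) -> eqon U h h'.
  move=> oU; apply: (submersion_cancel oU (smooth_fun_sub (@subsetT _ U) sf)).
  by move=> x _ /Zf /df.
pose P U h := [/\ smooth_fun S U h, U `<=` V & eqon U g (fun x => h x * f x)].
have [h [Hh Kh]] : exists h, smooth_fun S V h /\
    forall x, V x -> exists U h', [/\ open U, U x, U `<=` V, P U h' & eqon U h' h].
  apply: smooth_quotient_glue => //.
  - move=> U h h' x oU [Hh _ E] [Hh' _ E'] Ux; apply: (cancel U) => // z Uz.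
    by rewrite -E // -E'.
  - move=> U W h oW WU [Hh UV E]; split; [exact: smooth_fun_sub Hh|by move=> x /WU /UV|].
    by move=> x /WU; apply: E.
  - by move=> U h [].
  - move=> x Vx.
    have [Zx|nZx] := pselect (Z i x).
      have [c [U [idx [ad Ux]]]] := adapted_chart x.
      have [Sc oU Uc _ HZ] := ad.
      have [j ij _] := (HZ i x Ux).1 Zx.
      have oW : open (U `&` V) by apply: openI.
      have WU : U `&` V `<=` U by move=> z [].
      have vW : vanishing S (Z i) (U `&` V) g.
        by split; [apply: smooth_fun_sub Hg => z []|move=> z [_ Vz]; apply: g0].
      have [q [Hq Eq]] := vanish_coord ad ij oW WU vW.
      have [u [Hu u0 Eu]] := defining_unit ad ij gd.
      exists (U `&` V), (fun z => q z * (u z)^-1); split=> //.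
      split; [|by move=> z []|].
        apply: smooth_funM => //; apply: smooth_funV => //; first by move=> z [/u0].
        by apply: smooth_fun_sub Hu => z [].
      by move=> z Wz; have Uz := WU _ Wz; rewrite (Eq z Wz) (Eu z Uz) mulrA divfK //; apply: u0.
    have oW : open (V `&` [set z | [set t : R | t != 0] (f z)]).
      by apply: (smooth_fun_open oV (smooth_fun_sub (@subsetT _ V) sf)); exact: open_neq.
    exists (V `&` [set z | [set t : R | t != 0] (f z)]), (fun z => g z * (f z)^-1); split=> //.
    - by split=> //=; apply/eqP => /Zf.
    - split; [|by move=> z []|by move=> z [_ /= fz]; rewrite divfK].
      apply: smooth_funM => //; first by apply: smooth_fun_sub Hg => z [].
      apply: smooth_funV => //; first by move=> z [].
      by apply: smooth_fun_sub sf.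
exists h; split=> //.
  by move=> x /Kh [U [h' [oU Ux UV [_ _ E] <-]]] //; apply: E.
move=> h' Hh' E; apply: (cancel V) => // x Vx; rewrite -E //.
by have [U [h'' [oU Ux UV [_ _ E''] <-]]] := Kh x Vx; rewrite // E''.
Qed.

End Divisor.

(** * Log frames *)

Section LogFields.
Context {R : realType} {n : nat} {M : topologicalType}.
Variable S : smooth_structure R n M.
Context {k : nat}.
Variable Z : 'I_k -> set M.
Implicit Types (c d : chart R n M) (U V : set M) (f : M -> R) (x : M) (X Y : @vfield R n M).
Local Notation smx := (smooth_mx S).
Local Notation dfun := (dfun S).
Local Notation logf := (log_field S Z).

Lemma log_field_sub U V X : V `<=` U -> logf U X -> logf V X.
Proof. by move=> VU [HX TX]; split; [exact: smooth_field_sub HX|move=> i x /VU; apply: TX]. Qed.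

Lemma log_field_eq U X Y : open U -> eqon U X Y -> logf U X -> logf U Y.
Proof.
move=> oU XY [HX TX]; split; first by refine (smooth_field_eq oU XY HX).
by move=> i x Ux Zx; rewrite -XY //; apply: TX.
Qed.

Lemma log_field_local U X : (forall x, U x -> exists V, [/\ open V, V x & logf V X]) -> logf U X.
Proof.
move=> H; split.
  by refine (smooth_field_local _) => x /H [V [oV Vx [HX _]]]; exists V.
by move=> i x /H [V [oV Vx [_ TX]]] Zx; apply: TX.
Qed.

Lemma tangent_lin (D : set M) x a (u v : 'rV[R]_n) :
  tangent_to S D x u -> tangent_to S D x v -> tangent_to S D x (a *: u + v).
Proof.
move=> Hu Hv U g oU Ux vg; have [Hg _] := vg.
by rewrite (dfun_lin _ _ _ oU Ux Hg) (Hu U) // (Hv U) // mulr0 addr0.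
Qed.

Lemma log_field_lin U g X Y : open U -> smooth_fun S U g -> logf U X -> logf U Y ->
  logf U (fun x => g x *: X x + Y x).
Proof.
move=> oU Hg [HX TX] [HY TY]; split; first by refine (smooth_field_lin oU Hg HX HY).
by move=> i x Ux Zx; apply: tangent_lin; [exact: TX|exact: TY].
Qed.

Lemma log_field0 U : open U -> logf U (fun=> 0).
Proof.
move=> oU; split; first exact: smooth_field0.
move=> i x Ux Zx W g oW Wx [Hg _]; have := dfun_lin (-1) 0 0 oW Wx Hg.
by rewrite scaler0 addr0 mulN1r addNr.
Qed.

Lemma log_field_sum U (I : Type) (r : seq I) (g : I -> M -> R) (X : I -> vfield) : open U ->
  (forall i, smooth_fun S U (g i)) -> (forall i, logf U (X i)) ->
  logf U (fun x => \sum_(i <- r) g i x *: X i x).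
Proof.
move=> oU Hg HX; elim: r => [|i r IH].
  by apply: log_field_eq (log_field0 oU) => // x _; rewrite big_nil.
by apply: log_field_eq (log_field_lin oU (Hg i) (HX i) IH) => // x _; rewrite big_cons.
Qed.

Definition lincomb (e : 'I_n -> @vfield R n M) (g : M -> 'rV[R]_n) : vfield :=
  fun x => \sum_l g x 0 l *: e l x.

Definition frame_mx (e : 'I_n -> @vfield R n M) (x : M) : 'M[R]_n := \matrix_l e l x.

Lemma lincombE e g x : lincomb e g x = g x *m frame_mx e x.
Proof. by rewrite /lincomb mulmx_sum_row; apply: eq_bigr => l _; rewrite rowK. Qed.

Definition log_frame U (e : 'I_n -> @vfield R n M) :=
  [/\ open U, forall l, logf U (e l),
      forall V X, open V -> V `<=` U -> logf V X ->
        exists g, smooth_vec S V g /\ eqon V X (lincomb e g) &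
      forall V g g', open V -> V `<=` U -> smooth_vec S V g -> smooth_vec S V g' ->
        eqon V (lincomb e g) (lincomb e g') -> eqon V g g'].

(* Only meaningful where [X] is a log field and [e] is a log frame. *)
Definition coef (e : 'I_n -> @vfield R n M) X x : 'rV[R]_n :=
  xget 0 [set r | exists V (g : M -> 'rV[R]_n), [/\ open V, V x, smooth_vec S V g, eqon V X (lincomb e g) & g x = r]].

Lemma smooth_vec_sub p U V (a : M -> 'rV[R]_p) : V `<=` U -> smooth_vec S U a -> smooth_vec S V a.
Proof. by move=> VU H i; apply: smooth_fun_sub VU (H i). Qed.

Lemma smooth_vec_mx p U (a : M -> 'rV[R]_p) : smooth_vec S U a <-> smx U a.
Proof. by split=> H; [move=> i j; rewrite ord1; apply: H|move=> j; apply: H]. Qed.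

Section Frame.
Variables (U : set M) (e : 'I_n -> @vfield R n M).
Hypothesis fr : log_frame U e.

Lemma lincomb_log V g : open V -> V `<=` U -> smooth_vec S V g -> logf V (lincomb e g).
Proof.
have [_ le _ _] := fr => oV VU Hg.
by apply: (@log_field_sum V _ _ (fun l x => g x 0 l) e) => // l; apply: log_field_sub VU (le l).
Qed.

Lemma coef_unique V X g : open V -> V `<=` U -> smooth_vec S V g -> eqon V X (lincomb e g) ->
  eqon V (coef e X) g.
Proof.
have [_ _ _ un] := fr => oV VU Hg E x Vx; rewrite /coef.
case: xgetP => [r _ [V' [g' [oV' Vx' Hg' E' <-]]]|].
  apply: (un (V `&` V')) => //; first exact: openI.
  - by move=> z [/VU].
  - by apply: smooth_vec_sub Hg' => z [].
  - by apply: smooth_vec_sub Hg => z [].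
  - by move=> z [Vz Vz']; rewrite -E' // -E.
by move=> /(_ (g x)); case; exists V, g.
Qed.

Lemma coef_spec V X : open V -> V `<=` U -> logf V X ->
  smooth_vec S V (coef e X) /\ eqon V X (lincomb e (coef e X)).
Proof.
have [_ _ ex _] := fr => oV VU HX; have [g [Hg E]] := ex V X oV VU HX.
have C := coef_unique oV VU Hg E; split; last by move=> x Vx; rewrite E // /lincomb C.
by move=> i; refine (smooth_fun_eq oV _ (Hg i)) => x Vx; rewrite C.
Qed.

Lemma coef_eq V X Y : open V -> V `<=` U -> logf V X -> eqon V X Y -> eqon V (coef e X) (coef e Y).
Proof.
move=> oV VU HX XY x Vx; have [H1 E1] := coef_spec oV VU HX.
by rewrite (coef_unique oV VU H1 _ Vx) // => z Vz; rewrite -XY //; apply: E1.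
Qed.

Lemma coef_lin V g X Y : open V -> V `<=` U -> smooth_fun S V g -> logf V X -> logf V Y ->
  eqon V (coef e (fun x => g x *: X x + Y x)) (fun x => g x *: coef e X x + coef e Y x).
Proof.
move=> oV VU Hg HX HY; have [H1 E1] := coef_spec oV VU HX; have [H2 E2] := coef_spec oV VU HY.
apply: coef_unique => //.
  move=> i; refine (smooth_fun_eq oV _ (smooth_funD oV (smooth_funM oV Hg (H1 i)) (H2 i))) => x _.
  by rewrite !mxE.
move=> x Vx; rewrite (E1 x Vx) (E2 x Vx) !lincombE.
by rewrite mulmxDl scalemxAl.
Qed.

Lemma coef_lincomb V g : open V -> V `<=` U -> smooth_vec S V g -> eqon V (coef e (lincomb e g)) g.
Proof. by move=> oV VU Hg; apply: coef_unique. Qed.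

Lemma coef_frame l : eqon U (coef e (e l)) (fun=> delta_mx 0 l).
Proof.
have [oU _ _ _] := fr; apply: coef_unique => //; first by move=> i; apply: smooth_fun_cst.
by move=> x _; rewrite lincombE -rowE rowK.
Qed.

Lemma coef_big V (I : Type) (r : seq I) (g : I -> M -> R) (X : I -> vfield) : open V -> V `<=` U ->
  (forall i, smooth_fun S V (g i)) -> (forall i, logf V (X i)) ->
  eqon V (coef e (fun x => \sum_(i <- r) g i x *: X i x)) (fun x => \sum_(i <- r) g i x *: coef e (X i) x).
Proof.
move=> oV VU Hg HX; elim: r => [|i r IH] x Vx.
  rewrite big_nil; apply: (@coef_unique V _ (fun=> 0)) => //; first by move=> i; apply: smooth_fun_cst.
  by move=> z _; rewrite lincombE mul0mx big_nil.
rewrite big_cons -IH //.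
have Hr := log_field_sum r oV Hg HX.
rewrite -(coef_lin oV VU (Hg i) (HX i) Hr Vx).
apply: esym; apply: (coef_eq oV VU) Vx; first exact: log_field_lin.
by move=> z _; rewrite big_cons.
Qed.

(** [coef] is linear over functions, so it vanishes at [x] on a combination whose coefficients do;
    conversely the frame expansion is such a combination. The germ condition becomes linear
    algebra. *)
Lemma coef_log_zero V X x : open V -> V `<=` U -> logf V X -> V x ->
  (log_zero_at S Z x X <-> coef e X x = 0).
Proof.
have [oU le _ _] := fr => oV VU HX Vx; split=> [[W [m [g [Y [oW Wx H E]]]]]|c0].
  have oVW : open (V `&` W) by apply: openI.
  have VW : V `&` W `<=` U by move=> z [/VU].
  have Hg i : smooth_fun S (V `&` W) (g i).
    by have [h _ _] := H i; apply: smooth_fun_sub h => z [].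
  have HY i : logf (V `&` W) (Y i).
    by have [_ h _] := H i; apply: log_field_sub h => z [].
  have HX' : logf (V `&` W) X by apply: log_field_sub HX => z [].
  have E' : eqon (V `&` W) X (fun y => \sum_i g i y *: Y i y) by move=> z [_ /E].
  rewrite (coef_eq oVW VW HX' E') // (coef_big _ oVW VW Hg HY) //.
  by apply: big1 => i _; have [_ _ ->] := H i; rewrite scale0r.
have [H1 E1] := coef_spec oV VU HX.
exists V, n, (fun l z => coef e X z 0 l), e; split=> // i; split=> //; first exact: log_field_sub (le i).
by rewrite c0 mxE.
Qed.

End Frame.

Definition frame_tr (e e' : 'I_n -> @vfield R n M) (x : M) : 'M[R]_n := \matrix_l coef e' (e l) x.

Section Change.
Variables (U U' : set M) (e e' : 'I_n -> @vfield R n M).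
Hypotheses (fr : log_frame U e) (fr' : log_frame U' e').

Lemma frame_tr_smooth : smx (U `&` U') (frame_tr e e').
Proof.
have [oU le _ _] := fr; have [oU' _ _ _] := fr'.
have oW : open (U `&` U') by apply: openI.
move=> i j.
have [H _] : smooth_vec S (U `&` U') (coef e' (e i)) /\ eqon (U `&` U') (e i) (lincomb e' (coef e' (e i))).
  by apply: (coef_spec fr') => //; apply: log_field_sub (le i) => z [].
by refine (smooth_fun_eq oW _ (H j)) => x _; rewrite mxE.
Qed.

Lemma frame_trE V X : open V -> V `<=` U -> V `<=` U' -> logf V X ->
  eqon V (coef e' X) (fun x => coef e X x *m frame_tr e e' x).
Proof.
have [oU le _ _] := fr => oV VU VU' HX x Vx.
have [H1 E1] := coef_spec fr oV VU HX.
have le' l : logf V (e l) by apply: log_field_sub (le l).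
rewrite (coef_eq fr' oV VU' HX E1) //.
rewrite (coef_big fr' (index_enum _) oV VU' H1 le') //.
by rewrite mulmx_sum_row; apply: eq_bigr => l _; rewrite rowK.
Qed.

Lemma frame_tr_mxE x : U x -> U' x -> frame_mx e x = frame_tr e e' x *m frame_mx e' x.
Proof.
have [oU le _ _] := fr; have [oU' _ _ _] := fr' => Ux Ux'.
apply/row_matrixP => l; rewrite rowK row_mul rowK -lincombE.
have [_ ->] : smooth_vec S (U `&` U') (coef e' (e l)) /\ eqon (U `&` U') (e l) (lincomb e' (coef e' (e l))).
- by apply: (coef_spec fr'); [exact: openI|move=> z []|apply: log_field_sub (le l) => z []].
- by [].
- by [].
Qed.

End Change.

Lemma frame_tr_comp U U' U'' e e' e'' x : log_frame U e -> log_frame U' e' -> log_frame U'' e'' ->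
  U x -> U' x -> U'' x -> frame_tr e e'' x = frame_tr e e' x *m frame_tr e' e'' x.
Proof.
move=> fr fr' fr'' Ux Ux' Ux''; have [oU le _ _] := fr.
have [oU' _ _ _] := fr'; have [oU'' _ _ _] := fr''.
apply/row_matrixP => l; rewrite row_mul !rowK.
apply: (frame_trE fr' fr'' (V := U `&` (U' `&` U''))) => //.
- by apply: openI => //; apply: openI.
- by move=> z [_ []].
- by move=> z [_ []].
- by apply: log_field_sub (le l) => z [].
Qed.

Lemma frame_tr_id U e x : log_frame U e -> U x -> frame_tr e e x = 1%:M.
Proof. by move=> fr Ux; apply/row_matrixP => l; rewrite rowK row1 (coef_frame fr). Qed.

Lemma frame_tr_inv U U' e e' x : log_frame U e -> log_frame U' e' -> U x -> U' x ->
  frame_tr e e' x *m frame_tr e' e x = 1%:M.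
Proof. by move=> fr fr' Ux Ux'; rewrite -(frame_tr_comp fr fr' fr) // (frame_tr_id fr). Qed.

Lemma frame_tr_unit U U' e e' x : log_frame U e -> log_frame U' e' -> U x -> U' x ->
  frame_tr e e' x \in unitmx.
Proof. by move=> fr fr' Ux Ux'; have [H _] := mulmx1_unit (frame_tr_inv fr fr' Ux Ux'). Qed.

End LogFields.

Section ExFrame.
Context {R : realType} {n : nat} {M : topologicalType}.
Variable S : smooth_structure R n M.
Context {k : nat}.
Variable Z : 'I_k -> set M.
Hypothesis ncZ : normal_crossing S Z.
Variable gf : 'I_k -> M -> R.
Hypothesis gfP : forall i, global_defining S (Z i) (gf i).
Implicit Types (c d : chart R n M) (U V : set M) (f : M -> R) (x : M) (X Y : @vfield R n M).
Local Notation smx := (smooth_mx S).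
Local Notation dfun := (dfun S).
Local Notation logf := (log_field S Z).

Section Adapted.
Variables (c : chart R n M) (U : set M) (idx : 'I_n -> option 'I_k).
Hypothesis ad : adapted S Z c U idx.

(** Local sections of the ideal of [Z i] are multiples of [x_j], so tangency has to be tested
    against [dx_j] alone. *)
Lemma log_field_adapted V X : open V -> V `<=` U -> smooth_field S V X ->
  (logf V X <-> forall j i x, idx j = Some i -> V x -> coord c x 0 j = 0 -> (X x *m jac S c x) 0 j = 0).
Proof.
have [Sc oU Uc inj HZ] := ad => oV VU HX; split.
  move=> [_ T] j i x ij Vx xj.
  rewrite -(dfun_coord _ _ Sc (Uc _ (VU _ Vx))); apply: (T i x Vx _ V) => //.
    by apply/(adapted_zero ad ij (VU x Vx)).
  split; first exact: (coord_smooth_on ad j VU).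
  by move=> z Vz; move/(adapted_zero ad ij (VU z Vz)).
move=> H; split=> // i x Vx Zx W g oW Wx vg.
have [j ij xj] := (HZ i x (VU x Vx)).1 Zx.
have oWV : open (W `&` V) by apply: openI.
have WU : W `&` V `<=` U by move=> z [_ /VU].
have vg' : vanishing S (Z i) (W `&` V) g.
  by case: vg => h0 h1; split; [apply: smooth_fun_sub h0 => z []|move=> z [Wz _]; apply: h1].
have [q [Hq E]] := vanish_coord ad ij oWV WU vg'.
have WVx : (W `&` V) x by [].
rewrite (dfun_eq S oWV WVx E) (dfunM _ oWV WVx Hq (coord_smooth_on ad j WU)).
rewrite dfun_coord //; last exact/Uc/VU.
by rewrite (H j i x ij Vx xj) xj mulr0 mul0r addr0.
Qed.

(** These weights give the standard log frame: [x_j d/dx_j] for the coordinates that cut out a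
    hypersurface, [d/dx_j] for the others. *)
Definition weight (j : 'I_n) (x : M) : R := if idx j is Some _ then coord c x 0 j else 1.
Definition adapted_frame (j : 'I_n) : vfield := chart_field S c (fun x => weight j x *: delta_mx 0 j).

Lemma weight_smooth j V : V `<=` U -> smooth_fun S V (weight j).
Proof.
move=> VU; rewrite /weight; case: (idx j) => [i|]; last exact: smooth_fun_cst.
exact: (coord_smooth_on ad j VU).
Qed.

Lemma adapted_frame_coord g x : U x ->
  lincomb adapted_frame g x *m jac S c x = \row_j (weight j x * g x 0 j).
Proof.
have [Sc oU Uc inj HZ] := ad => Ux; rewrite /lincomb mulmx_suml.
rewrite (eq_bigr (fun l => (g x 0 l * weight l x) *: delta_mx 0 l)); last first.
  by move=> l _; rewrite -scalemxAl chart_fieldK ?scalerA //; apply: Uc.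
apply/rowP => j; rewrite summxE (bigD1 j) //= big1 ?addr0; last first.
  by move=> l lj; rewrite !mxE eqxx /= eq_sym (negbTE lj) mulr0.
by rewrite !mxE !eqxx mulr1 mulrC.
Qed.

(** Coordinate [j] of a log field vanishes on [x_j = 0], so Hadamard's lemma divides it by [x_j].
    The quotient is unique also on the divisor, by [coord_cancel]. *)
Lemma adapted_log_frame : log_frame S Z U adapted_frame.
Proof.
have [Sc oU Uc inj HZ] := ad; split=> //.
- move=> l; apply/log_field_adapted => //.
    apply: chart_field_smooth => //.
    refine (@smooth_mxZ _ _ _ S 1 n U _ _ oU (weight_smooth l (@subset_refl _ U)) _).
    exact: (@smooth_mx_cst _ _ _ S 1 n _ (delta_mx 0 l)).
  move=> j i x ij Ux xj; rewrite chart_fieldK //; last exact: Uc.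
  rewrite !mxE eqxx /=; case: eqP => [<-|_]; last by rewrite mulr0.
  by rewrite /weight ij xj mul0r.
- move=> V X oV VU HX; have [sX _] := HX.
  have Vc : V `&` dom c = V by apply/seteqP; split=> [x []|x Vx] //; split=> //; apply/Uc/VU.
  have sC := field_smooth_mx oV Sc sX; rewrite Vc in sC.
  have H l : exists g, smooth_fun S V g /\ forall x, V x -> (X x *m jac S c x) 0 l = weight l x * g x.
    rewrite /weight; case E : (idx l) => [i|].
      have [|Hq Eq] := @coord_quotient _ _ _ S _ Z c U idx ad l V (fun x => (X x *m jac S c x) 0 l) oV VU (sC 0 l).
        by move=> x Vx xj; apply: ((log_field_adapted oV VU sX).1 HX l i x E Vx xj).
      by eexists; split; [exact: Hq|move=> x Vx; exact: (etrans (Eq x Vx) (mulrC _ _))].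
    by exists (fun x => (X x *m jac S c x) 0 l); split; [exact: sC|move=> x _; rewrite mul1r].
  have [g Hg] := choice H.
  exists (fun x => \row_l g l x); split.
    by move=> l; refine (smooth_fun_eq oV _ (proj1 (Hg l))) => x _; rewrite mxE.
  move=> x Vx; have Dx : dom c x by exact/Uc/VU.
  apply: (jac_inj Sc Dx).
  rewrite adapted_frame_coord; last exact: VU.
  by apply/rowP => l; rewrite !mxE; have [_ /(_ x Vx)] := Hg l; rewrite mxE.
- move=> V g g' oV VU Hg Hg' E.
  have K l : eqon V (fun x => weight l x * g x 0 l) (fun x => weight l x * g' x 0 l).
    move=> x Vx; have Ux := VU x Vx.
    have := adapted_frame_coord g Ux; rewrite E // adapted_frame_coord // => /rowP /(_ l).
    by rewrite !mxE.
  suff C l : eqon V (fun x => g x 0 l) (fun x => g' x 0 l).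
    by move=> x Vx; apply/rowP => l; apply: C.
  move: (K l); rewrite /weight; case: (idx l) => [i|] Kl.
    apply: (coord_cancel ad (j := l) oV VU (Hg l) (Hg' l)) => x Vx.
    by rewrite mulrC Kl // mulrC.
  by move=> x /Kl; rewrite !mul1r.
Qed.

End Adapted.

Lemma ex_log_frame p : exists U e, log_frame S Z U e /\ U p.
Proof.
have [c [U [idx [ad Up]]]] := adapted_chart ncZ gfP p.
by exists U, (adapted_frame c idx); split=> //; apply: adapted_log_frame ad.
Qed.

End ExFrame.

(** * Compatible complex structures *)

Section Compatible.
Context {R : realFieldType}.

Definition form_pos n (W A : 'M[R]_n) := forall v : 'rV_n, v != 0 -> 0 < (v *m W *m (v *m A)^T) 0 0.

Definition compat n (W A : 'M[R]_n) := [/\ A *m A = - 1%:M, A *m W *m A^T = W & form_pos W A].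

Lemma ker0_unitmx n (K : 'M[R]_n) : (forall v : 'rV_n, v *m K = 0 -> v = 0) -> K \in unitmx.
Proof.
move=> H; rewrite -row_free_unit -kermx_eq0; apply/eqP/row_matrixP => i.
by rewrite row0; apply: H; rewrite -row_mul mulmx_ker row0.
Qed.

Lemma sqrN1_unit n (A : 'M[R]_n) : A *m A = - 1%:M -> A \in unitmx.
Proof.
move=> s; have [] // : A \in unitmx /\ - A \in unitmx.
by apply: mulmx1_unit; rewrite mulmxN s opprK.
Qed.

Lemma compat_conj n (B W A : 'M[R]_n) : B \in unitmx -> compat (B *m W *m B^T) A ->
  compat W (invmx B *m A *m B).
Proof.
move=> uB [A2 AW P]; split.
- rewrite !mulmxA mulmxK // -[invmx B *m A *m A]mulmxA A2 mulmxN mulmx1 mulNmx mulVmx //.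
- rewrite !trmx_mul !mulmxA.
  have -> : invmx B *m A *m B *m W *m B^T *m A^T = invmx B *m (A *m (B *m W *m B^T) *m A^T).
    by rewrite !mulmxA.
  by rewrite AW !mulmxA mulVmx // mul1mx -mulmxA -trmx_mul mulVmx // trmx1 mulmx1.
- move=> v v0; pose y := v *m invmx B.
  have vy : v = y *m B by rewrite /y mulmxKV.
  have y0 : y != 0 by apply: contraNneq v0 => y0; rewrite vy y0 mul0mx.
  have := P y y0; congr (0 < _ 0 0).
  rewrite vy !mulmxA mulmxK // !trmx_mul !mulmxA //.
Qed.

Lemma compat_sum m n (W1 A1 : 'M[R]_m) (W2 A2 : 'M[R]_n) : compat W1 A1 -> compat W2 A2 ->
  compat (block_mx W1 0 0 W2) (block_mx A1 0 0 A2).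
Proof.
move=> [s1 c1 p1] [s2 c2 p2]; split.
- by rewrite mulmx_block !(mulmx0, mul0mx, addr0, add0r) s1 s2 scalar_mx_block opp_block_mx !oppr0.
- rewrite tr_block_mx !trmx0 !mulmx_block !(mulmx0, mul0mx, addr0, add0r) c1 c2 //.
- move=> v; rewrite -[v]hsubmxK; move: (lsubmx v) (rsubmx v) => v1 v2 v0.
  rewrite !mul_row_block !(mulmx0, mul0mx, addr0, add0r) tr_row_mx mul_row_col mxE.
  have q1 : 0 <= (v1 *m W1 *m (v1 *m A1)^T) 0 0.
    by have [->|/p1/ltW//] := eqVneq v1 0; rewrite !mul0mx mxE.
  have q2 : 0 <= (v2 *m W2 *m (v2 *m A2)^T) 0 0.
    by have [->|/p2/ltW//] := eqVneq v2 0; rewrite !mul0mx mxE.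
  have [v10|/p1 H] := eqVneq v1 0; last by rewrite ltr_pwDl.
  have [v20|/p2 H] := eqVneq v2 0; last by rewrite ltr_wpDl.
  by move: v0; rewrite v10 v20 row_mx0 eqxx.
Qed.

(* With [K = cs_mid s A0 A1], [K = 2 A0] for [s = 0] and [A0 K = K A1] for [s = 1]. *)
Definition cs_mid n (s : R) (A0 A1 : 'M[R]_n) := (2 - s) *: A0 + s *: A1.
Definition cs_interp n (s : R) (A0 A1 : 'M[R]_n) :=
  invmx (cs_mid s A0 A1) *m A0 *m cs_mid s A0 A1.

(** Paired with [v] through [W], [v K] gives a combination of two positive numbers with weights
    [2 - s > 0] and [s >= 0]. Only positivity is used, with no invariance of [W]. *)
Lemma cs_mid_unit n s (W A0 A1 : 'M[R]_n) : 0 <= s <= 1 -> form_pos W A0 -> form_pos W A1 ->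
  cs_mid s A0 A1 \in unitmx.
Proof.
move=> /andP[s0 s1] P0 P1; apply: ker0_unitmx => v H; apply/eqP; apply: contraT => v0.
have : (v *m W *m (v *m cs_mid s A0 A1)^T) 0 0 = 0 by rewrite H trmx0 mulmx0 mxE.
rewrite /cs_mid mulmxDr -!scalemxAr linearD !linearZ /= mulmxDr -!scalemxAr mxE [X in X + _]mxE [X in _ + X]mxE.
have h0 := P0 v v0; have h1 := P1 v v0.
move=> E; have : 0 < (2 - s) * (v *m W *m (v *m A0)^T) 0 0 + s * (v *m W *m (v *m A1)^T) 0 0.
  by rewrite ltr_pwDl ?mulr_gt0 ?mulr_ge0 ?(ltW h1) //; lra.
by rewrite E ltxx.
Qed.

Lemma cs_interp_sqr n s (A0 A1 : 'M[R]_n) : cs_mid s A0 A1 \in unitmx -> A0 *m A0 = - 1%:M ->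
  cs_interp s A0 A1 *m cs_interp s A0 A1 = - 1%:M.
Proof.
move=> uK s0; rewrite /cs_interp; set K := cs_mid _ _ _.
by rewrite !mulmxA mulmxK // -[invmx K *m A0 *m A0]mulmxA s0 mulmxN mulmx1 mulNmx mulVmx.
Qed.

Lemma cs_interp0 n (A0 A1 : 'M[R]_n) : A0 *m A0 = - 1%:M -> cs_interp 0 A0 A1 = A0.
Proof.
move=> s0; have u0 := sqrN1_unit s0.
rewrite /cs_interp /cs_mid subr0 scale0r addr0.
have n2 : (2 : R) != 0 by rewrite pnatr_eq0.
have u2 : 2 *: A0 \in unitmx by rewrite unitmxZ // unitfE.
by rewrite -mulmxA -scalemxAr scalemxAl mulKmx.
Qed.

Lemma cs_interp1 n (A0 A1 : 'M[R]_n) : cs_mid 1 A0 A1 \in unitmx ->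
  A0 *m A0 = - 1%:M -> A1 *m A1 = - 1%:M -> cs_interp 1 A0 A1 = A1.
Proof.
rewrite /cs_interp; set K := cs_mid _ _ _ => uK s0 s1.
have KE : K = A0 + A1 by rewrite /K /cs_mid (_ : 2 - 1 = 1 :> R) ?scale1r //; lra.
have E : A0 *m K = K *m A1 by rewrite KE mulmxDr mulmxDl s0 s1 addrC.
by rewrite -mulmxA E mulKmx.
Qed.

Lemma compat_skew n (W A : 'M[R]_n) : compat W A -> A *m W = - (W *m A^T).
Proof.
move=> [s c _]; rewrite -{2}c -mulmxA -trmx_mul s linearN /= trmx1 mulmxN mulmx1 opprK //.
Qed.

(* [K] is skew for [W] and [K^2] is a combination of [1] and [A0 A1 + A1 A0], which
   commutes with [A0]; so [K^-1 A0 K = K A0 K^-1] preserves [W]. *)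
Lemma cs_interp_compat n s (W A0 A1 : 'M[R]_n) : 0 <= s <= 1 -> compat W A0 -> compat W A1 ->
  compat W (cs_interp s A0 A1).
Proof.
move=> s01 c0 c1; have [q0 e0 p0] := c0; have [q1 e1 p1] := c1.
have uK := cs_mid_unit s01 p0 p1.
have k0 := compat_skew c0; have k1 := compat_skew c1.
have As := cs_interp_sqr uK q0; rewrite /cs_interp in As *.
set K := cs_mid s A0 A1 in uK As *.
have KW : K *m W = - (W *m K^T).
  rewrite /K /cs_mid mulmxDl -!scalemxAl k0 k1 linearD !linearZ /= mulmxDr -!scalemxAr.
  by rewrite !scalerN opprD.
pose T := A0 *m A1 + A1 *m A0.
have KK : K *m K = (- ((2 - s) ^+ 2 + s ^+ 2)) *: 1%:M + ((2 - s) * s) *: T.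
  rewrite /K /cs_mid mulmxDl !mulmxDr -!scalemxAl -!scalemxAr q0 q1 !scalerA /T scalerDr.
  move: (A0 *m A1) (A1 *m A0) (1%:M) => P Q I1; apply/matrixP => i j; rewrite !mxE; ring.
have TA : T *m A0 = A0 *m T.
  by rewrite /T mulmxDl mulmxDr !mulmxA q0 -[A1 *m A0 *m A0]mulmxA q0 mulmxN mulmx1 mulNmx mul1mx addrC.
have CK : K *m K *m A0 = A0 *m (K *m K).
  rewrite KK mulmxDl mulmxDr -!scalemxAl -!scalemxAr TA mul1mx mulmx1 //.
have AK : invmx K *m A0 *m K = K *m A0 *m invmx K.
  have : K *m (invmx K *m A0 *m K) *m K = K *m (K *m A0 *m invmx K) *m K.
    by rewrite !mulmxA mulmxV // mul1mx -[A0 *m K *m K]mulmxA -CK -!mulmxA mulVmx // mulmx1 !mulmxA.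
  by move=> /(can_inj (mulmxK uK)) /(can_inj (mulKmx uK)).
have IW : invmx K *m W = - (W *m (invmx K)^T).
  apply: (can_inj (mulKmx uK)); rewrite mulmxA mulmxV // mul1mx mulmxN mulmxA KW mulNmx opprK.
  by rewrite -mulmxA -trmx_mul mulVmx // trmx1 mulmx1.
split=> //.
- have AW : invmx K *m A0 *m K *m W = - (W *m (invmx K *m A0 *m K)^T).
    rewrite -[invmx K *m A0 *m K *m W]mulmxA KW mulmxN mulmxA -[invmx K *m A0 *m W]mulmxA k0 mulmxN mulmxA IW.
    by rewrite !mulNmx !opprK AK !trmx_mul !mulmxA.
  move: As AW; set Q := invmx K *m A0 *m K => As AW.
  by rewrite AW mulNmx -mulmxA -trmx_mul As linearN /= trmx1 mulmxN mulmx1 opprK.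
- move=> v v0; pose y := v *m invmx K.
  have vy : v = y *m K by rewrite /y mulmxKV.
  have y0 : y != 0 by apply: contraNneq v0 => y0; rewrite vy y0 mul0mx.
  (* Moving [K] across [W] by skewness leaves only [K^2], which [KK] computes. *)
  have -> : v *m W *m (v *m (invmx K *m A0 *m K))^T = - (y *m (K *m K) *m W *m (y *m A0)^T).
    rewrite !mulmxA -/y trmx_mul vy.
    have -> : y *m K *m W *m (K^T *m (y *m A0)^T) = y *m K *m (W *m K^T) *m (y *m A0)^T by rewrite !mulmxA.
    have -> : W *m K^T = - (K *m W) by rewrite KW opprK.
    by rewrite mulmxN mulNmx !mulmxA.
  (* The three positive values into which the expansion of [K^2] decomposes: two at [y], and one of
     [A1] at [y A0]. *)
  pose g0 := (y *m W *m (y *m A0)^T) 0 0.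
  pose g1 := (y *m W *m (y *m A1)^T) 0 0.
  pose g2 := ((y *m A0) *m W *m ((y *m A0) *m A1)^T) 0 0.
  have yA0 : y *m A0 != 0.
    apply: contraNneq y0 => H; have : y *m (A0 *m A0) = 0 by rewrite mulmxA H mul0mx.
    by rewrite q0 mulmxN mulmx1 => /eqP; rewrite oppr_eq0.
  have h0 : 0 < g0 := p0 y y0. have h1 : 0 < g1 := p1 y y0. have h2 : 0 < g2 := p1 _ yA0.
  have E1 : y *m (A0 *m A1) *m W *m (y *m A0)^T = - ((y *m A0) *m W *m ((y *m A0) *m A1)^T).
    have -> : y *m (A0 *m A1) *m W *m (y *m A0)^T = y *m A0 *m (A1 *m W) *m (y *m A0)^T by rewrite !mulmxA.
    by rewrite k1 mulmxN mulNmx [(y *m A0 *m A1)^T]trmx_mul !mulmxA.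
  have E2 : y *m (A1 *m A0) *m W *m (y *m A0)^T = - (y *m W *m (y *m A1)^T).
    have -> : y *m (A1 *m A0) *m W *m (y *m A0)^T = y *m A1 *m (A0 *m W *m A0^T) *m y^T.
      by rewrite trmx_mul !mulmxA.
    rewrite e0; have -> : y *m A1 *m W *m y^T = y *m (A1 *m W) *m y^T by rewrite !mulmxA.
    rewrite k1 mulmxN mulNmx; congr (- _); by rewrite [(y *m A1)^T]trmx_mul !mulmxA.
  have -> : (- (y *m (K *m K) *m W *m (y *m A0)^T)) 0 0 = ((2 - s) ^+ 2 + s ^+ 2) * g0 + ((2 - s) * s) * (g1 + g2).
    rewrite KK /T mulmxDr -!scalemxAr mulmx1 mulmxDr scalerDr !mulmxDl -!scalemxAl E1 E2 /g0 /g1 /g2.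
    move: (y *m W *m (y *m A0)^T) (y *m W *m (y *m A1)^T) (y *m A0 *m W *m (y *m A0 *m A1)^T) => P Q P2.
    by rewrite !mxE; ring.
  have c2 : 0 < (2 - s) ^+ 2 + s ^+ 2.
    by rewrite ltr_pwDl ?sqr_ge0 // exprn_gt0 //; case/andP: s01 => ? ?; lra.
  rewrite ltr_pwDl ?mulr_gt0 // mulr_ge0 ?addr_ge0 ?(ltW h1) ?(ltW h2) // mulr_ge0 //; case/andP: s01 => ? ?; lra.
Qed.

Definition rot2 : 'M[R]_2 := \matrix_(i, j) (if (i == 0) && (j == 1) then 1 else if (i == 1) && (j == 0) then -1 else 0).

Lemma skew2 (a : 'M[R]_2) : a^T = - a -> a = a 0 1 *: rot2.
Proof.
move=> sk; have E i j : a j i = - a i j by have /matrixP /(_ i j) := sk; rewrite !mxE.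
have D i : a i i = 0 by have := E i i => H; lra.
apply/matrixP => i j; rewrite !mxE.
case: i => -[|[|//]] hi; case: j => -[|[|//]] hj; rewrite /= ?mulr0 ?mulr1 ?mulrN1.
- by rewrite -[RHS](D (Ordinal hi)); congr (a _ _); apply: val_inj.
- by congr (a _ _); apply: val_inj.
- by rewrite -E; congr (a _ _); apply: val_inj.
- by rewrite -[RHS](D (Ordinal hi)); congr (a _ _); apply: val_inj.
Qed.

Lemma rot2_sqr : rot2 *m rot2 = - 1%:M.
Proof.
apply/matrixP => i j; rewrite !mxE !big_ord_recl big_ord0 !mxE.
by case: i => -[|[|//]] hi; case: j => -[|[|//]] hj; rewrite /= -?val_eqE /=; ring.
Qed.

Lemma rot2_tr : rot2^T = - rot2.
Proof.
apply/matrixP => i j; rewrite !mxE.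
by case: i => -[|[|//]] hi; case: j => -[|[|//]] hj; rewrite /= -?val_eqE /= ?oppr0 ?opprK.
Qed.

(** In the plane a skew form is a multiple of [rot2]; of the two rotations [rot2] and [- rot2], the
    one with the sign of [w] is positive, with value [w e |v|^2]. *)
Lemma compat2 (w e : R) : 0 < w * e -> e ^+ 2 = 1 -> compat (w *: rot2) (e *: rot2).
Proof.
move=> we e2.
have T : (e *: rot2)^T = - (e *: rot2) by rewrite linearZ /= rot2_tr scalerN.
split.
- by rewrite -scalemxAl -scalemxAr scalerA -expr2 e2 scale1r rot2_sqr.
- have -> : e *: rot2 *m (w *: rot2) *m (e *: rot2)^T = - ((e * e * w) *: (rot2 *m rot2 *m rot2)).
    by rewrite T mulmxN -!(scalemxAl, scalemxAr) !scalerA; congr (- (_ *: _)); ring.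
  by rewrite rot2_sqr mulNmx mul1mx scalerN opprK -expr2 e2 mul1r.
- move=> v v0; rewrite trmx_mul T mulNmx mulmxN mulmxA -[v *m _ *m _]mulmxA.
  have -> : w *: rot2 *m (e *: rot2) = - ((w * e) *: 1%:M).
    by rewrite -!(scalemxAl, scalemxAr) scalerA rot2_sqr scalerN.
  rewrite mulmxN mulNmx opprK -scalemxAr mulmx1 -scalemxAl mxE.
  rewrite pmulr_rgt0 // mxE.
  have [j vj] : exists j, v 0 j != 0.
    by apply/existsP; rewrite -negb_forall; apply: contraNN v0 => /forallP H; apply/eqP/rowP => j; rewrite mxE; apply/eqP.
  rewrite (bigD1 j) //= ltr_pwDl ?sumr_ge0 // => [|i _]; rewrite mxE -expr2 ?sqr_ge0 //.
  by rewrite lt0r sqrf_eq0 vj sqr_ge0.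
Qed.

End Compatible.

Lemma skew_blocks (R : pzRingType) p q (A : 'M[R]_(p + q)) : A^T = - A ->
  [/\ (ulsubmx A)^T = - ulsubmx A, dlsubmx A = - (ursubmx A)^T & (drsubmx A)^T = - drsubmx A].
Proof.
move=> H; split; apply/matrixP => i j.
- by have /matrixP /(_ (lshift q i) (lshift q j)) := H; rewrite !mxE.
- by have /matrixP /(_ (lshift q j) (rshift p i)) := H; rewrite !mxE.
- by have /matrixP /(_ (rshift p i) (rshift p j)) := H; rewrite !mxE.
Qed.

Lemma ulsubmx01 (R : Type) m (A : 'M[R]_(2 + m)) : ulsubmx A 0 1 = A 0 (lift 0 0).
Proof. by rewrite !mxE; congr (A _ _); apply: val_inj. Qed.

Section LocalCompatible.
Context {R : realType} {n : nat} {M : topologicalType}.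
Variable S : smooth_structure R n M.
Local Notation smx := (smooth_mx S).

(* The first basis vector and one that [W] pairs non-trivially with it span a
   plane; the Schur complement of [W] is treated by induction. *)
Lemma local_compat (p : M) m (U : set M) (W : M -> 'M[R]_m) : open U -> U p -> smx U W ->
  (forall x, U x -> (W x)^T = - W x) -> (forall x, U x -> W x \in unitmx) ->
  exists V A, [/\ open V, V p, V `<=` U, smx V A & forall x, V x -> compat (W x) (A x)].
Proof.
elim/ltn_ind: m => m IH in U W *.
case: m => [|[|m]] in IH W *.
- move=> oU Up sW sk un; exists U, (fun=> 0); split=> //; first exact: (@smooth_mx_cst _ _ _ S 0 0 U 0).
  by move=> x _; split; [apply/matrixP => -[]|apply/matrixP => -[]|move=> v; rewrite thinmx0 eqxx].
(* A skew matrix of size 1 is zero, so it cannot be invertible. *)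
- move=> oU Up sW sk un; have := un p Up; rewrite unitmxE det_mx11 unitfE.
  have /matrixP /(_ 0 0) := sk p Up; rewrite !mxE => H.
  have -> : W p 0 0 = 0 by lra.
  by rewrite eqxx.
move=> oU Up sW sk un.
have [j Wj] : exists j, W p 0 j != 0.
  apply/existsP; rewrite -negb_forall; apply/negP => /forallP H.
  have : row 0 (W p) *m invmx (W p) = 0.
    have -> : row 0 (W p) = 0 by apply/rowP => j; rewrite !mxE; apply/eqP; exact: H.
    by rewrite mul0mx.
  rewrite -row_mul mulmxV; last exact: un.
  by move=> /rowP /(_ 0) /eqP; rewrite !mxE eqxx oner_eq0.
have Wpp x i : U x -> W x i i = 0.
  by move=> /sk /matrixP /(_ i i); rewrite !mxE => H; lra.
have j0 : j != 0 by apply: contraNneq Wj => ->; rewrite Wpp.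
pose i1 : 'I_m.+2 := lift 0 0.
have i10 : i1 != 0 by [].
(* Brings the partner [j] of the first basis vector next to it, so that the plane is the upper left
   block. *)
pose s := tperm i1 j.
pose B0 : 'M[R]_m.+2 := perm_mx s.
have uB0 : B0 \in unitmx by apply: unitmx_perm.
pose W0 x : 'M[R]_(2 + m) := B0 *m W x *m B0^T.
have W0E x a b : W0 x a b = W x (s a) (s b).
  by rewrite /W0 /B0 tr_perm_mx -col_permE -row_permE !mxE.
have W0p : W0 p 0 i1 != 0 by rewrite W0E /s tpermD // tpermL.
pose w x := W0 x 0 i1.
have sW0 : smx U W0.
  refine (@smooth_mxM _ _ _ S m.+2 m.+2 m.+2 U (fun x => B0 *m W x) (fun=> B0^T) oU _ _); last exact: smooth_mx_cst.
  by refine (@smooth_mxM _ _ _ S m.+2 m.+2 m.+2 U (fun=> B0) W oU _ _); [exact: smooth_mx_cst|].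
(* The sign is fixed at [p], and [U1] is the set where [w] keeps it, so that [e] is constant
   there. *)
pose e := Num.sg (w p).
have e2 : e ^+ 2 = 1 by rewrite /e sqr_sg W0p.
pose U1 := U `&` [set x | [set t : R | 0 < t] (w x * e)].
have swe : smooth_fun S U (fun x => w x * e).
  by apply: smooth_funM => //; [exact: sW0|exact: smooth_fun_cst].
have oU1 : open U1 by apply: (smooth_fun_open oU swe); exact: open_gt.
have U1p : U1 p by split=> //=; rewrite /e mulrC -normrEsg normr_gt0.
have U1U : U1 `<=` U by move=> x [].
have sW1 := smooth_mx_sub U1U sW0.
have [sa sb sc sd] := smooth_submx oU1 sW1.
pose a x := ulsubmx (W0 x); pose b x := ursubmx (W0 x); pose d x := drsubmx (W0 x).
have skW0 x : U x -> (W0 x)^T = - W0 x.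
  by move=> /sk E; rewrite /W0 !trmx_mul trmxK E mulNmx mulmxN mulmxA.
have ska x : U x -> (a x)^T = - a x.
  by move=> /skW0 /skew_blocks [].
have skd x : U x -> (d x)^T = - d x.
  by move=> /skW0 /skew_blocks [].
have cE x : U x -> dlsubmx (W0 x) = - (b x)^T.
  by move=> /skW0 /skew_blocks [].
have aE x : U x -> a x = w x *: rot2.
  move=> Ux; rewrite (skew2 (ska x Ux)); congr (_ *: _).
  exact: ulsubmx01.
have ua x : U1 x -> a x \in unitmx.
  move=> [Ux we]; rewrite aE // unitmxZ; last by rewrite unitfE; apply: contraTneq we => ->; rewrite /= mul0r ltxx.
  exact: (sqrN1_unit rot2_sqr).
(* Clears the block below [a], which is [- b^T] by skewness; [W1] is the resulting Schur
   complement. *)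
pose X x := (b x)^T *m invmx (a x).
pose W1 x := d x + X x *m b x.
have sia : smx U1 (fun x => invmx (a x)) by apply: (smooth_invmx oU1 ua sa).
have sX : smx U1 X by apply: (smooth_mxM oU1 _ sia); exact: (smooth_mx_tr oU1 sb).
have sW1' : smx U1 W1 by apply: (smooth_mxD oU1 sd); exact: (smooth_mxM oU1 sX sb).
pose B1 x : 'M[R]_(2 + m) := block_mx 1%:M 0 (X x) 1%:M.
have uB1 x : B1 x \in unitmx by rewrite unitmxE /B1 det_lblock !det1 mulr1 unitr1.
have iaT x : U1 x -> (invmx (a x))^T = - invmx (a x).
  move=> Ux; rewrite trmx_inv ska; last exact: U1U.
  have u := ua x Ux; apply: (can_inj (mulKmx u)).
  have v : - a x \in unitmx by rewrite -scaleN1r unitmxZ // unitrN unitr1.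
  by rewrite mulmxN mulmxV // -{1}[a x]opprK mulNmx mulmxV.
have XT x : U1 x -> (X x)^T = - (invmx (a x) *m b x).
  by move=> Ux; rewrite /X trmx_mul trmxK iaT // mulNmx.
have BWB x : U1 x -> B1 x *m W0 x *m (B1 x)^T = block_mx (a x) 0 0 (W1 x).
  move=> Ux; have Ux' := U1U x Ux; have u := ua x Ux.
  have -> : W0 x = block_mx (a x) (b x) (- (b x)^T) (d x) by rewrite -cE // submxK.
  rewrite /B1 tr_block_mx trmx0 !trmx1 !mulmx_block !(mul1mx, mulmx1, mul0mx, mulmx0, addr0, add0r).
  rewrite XT // mulmxN mulmxA mulmxV // mul1mx addNr /X mulmxKV // subrr mul0mx add0r.
  by rewrite /W1 /X addrC.
have W1sk x : U1 x -> (W1 x)^T = - W1 x.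
  move=> Ux; have Ux' := U1U x Ux.
  by rewrite /W1 linearD /= skd // trmx_mul XT // mulmxN /X mulmxA opprD.
have W1u x : U1 x -> W1 x \in unitmx.
  move=> Ux; have Ux' := U1U x Ux.
  have : B1 x *m W0 x *m (B1 x)^T \in unitmx.
    have uW0 : W0 x \in unitmx.
      by rewrite /W0 unitmx_mul unitmx_tr uB0 andbT unitmx_mul uB0 un.
    by rewrite unitmx_mul unitmx_tr uB1 andbT unitmx_mul uB1 uW0.
  by rewrite BWB // !unitmxE det_lblock unitrM => /andP[].
have mm : (m < m.+2)%N by rewrite ltnS leqnSn.
have [V [A1 [oV Vp VU1 sA1 cA1]]] := IH m mm U1 W1 oU1 U1p sW1' W1sk W1u.
(* A structure compatible with the block diagonal form [diag (a, W1)], to be carried back to [W]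
   through [B]. *)
pose D x : 'M[R]_(2 + m) := block_mx (e *: rot2) 0 0 (A1 x).
pose B x : 'M[R]_m.+2 := B1 x *m B0.
have uB x : B x \in unitmx by rewrite unitmx_mul uB1.
exists V, (fun x => invmx (B x) *m D x *m B x); split=> //.
- by move=> x /VU1 /U1U.
- have sB1 : smx V B1.
    apply: (smooth_block_mx oV); [exact: smooth_mx_cst|exact: smooth_mx_cst|exact: smooth_mx_sub VU1 sX|exact: smooth_mx_cst].
  have sB : smx V B.
    by apply: (smooth_mxM oV sB1); exact: smooth_mx_cst.
  have sD : smx V D.
    by apply: (smooth_block_mx oV); [exact: smooth_mx_cst|exact: smooth_mx_cst|exact: smooth_mx_cst|].
  apply: (smooth_mxM oV _ sB); apply: (smooth_mxM oV _ sD).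
  by apply: (smooth_invmx oV _ sB) => x _; apply: uB.
- move=> x Vx; have U1x := VU1 x Vx; have Ux := U1U x U1x.
  apply: (@compat_conj R m.+2 (B x) (W x) (D x) (uB x)).
  have -> : B x *m W x *m (B x)^T = block_mx (a x) 0 0 (W1 x).
    by rewrite -BWB // /B /W0 trmx_mul !mulmxA.
  have C2 : compat (a x) (e *: rot2) by rewrite aE //; apply: compat2 => //; case: U1x.
  exact: (@compat_sum R 2 m (a x) (e *: rot2) (W1 x) (A1 x) C2 (cA1 x Vx)).
Qed.

End LocalCompatible.

(** * Matrices of forms and endomorphisms in a log frame *)

Section Form.
Context {R : realType} {n : nat} {M : topologicalType}.
Variable S : smooth_structure R n M.
Context {k : nat}.
Variable Z : 'I_k -> set M.
Implicit Types (U V : set M) (x : M) (X Y : @vfield R n M) (e : 'I_n -> @vfield R n M).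
Local Notation smx := (smooth_mx S).
Local Notation logf := (log_field S Z).
Local Notation logfr := (log_frame S Z).

Lemma form1_sum U (al : vfield -> M -> R) (I : Type) (r : seq I) (g : I -> M -> R) (X : I -> vfield) :
  open U -> log_form1 S Z U al -> (forall i, smooth_fun S U (g i)) -> (forall i, logf U (X i)) ->
  eqon U (al (fun x => \sum_(i <- r) g i x *: X i x)) (fun x => \sum_(i <- r) g i x * al (X i) x).
Proof.
move=> oU H Hg HX; have [_ E L] := H U oU (@subset_refl _ U).
have H0 := log_field0 S Z oU.
elim: r => [|i r IH] x Ux.
  rewrite big_nil (E _ (fun=> 0)) //; last by move=> z _; rewrite big_nil.
    have := L (fun=> -1) _ _ (@smooth_fun_cst _ _ _ S U (-1)) H0 H0 x Ux.
    rewrite (E _ (fun=> 0)) //; first by rewrite mulN1r addNr.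
      by apply: log_field_eq H0 => // z _; rewrite scaler0 addr0.
    by move=> z _; rewrite scaler0 addr0.
  by apply: log_field_eq H0 => // z _; rewrite big_nil.
have Hr := log_field_sum r oU Hg HX.
rewrite big_cons -IH // -(L _ _ _ (Hg i) (HX i) Hr x Ux).
have Hs := log_field_lin oU (Hg i) (HX i) Hr.
apply: E => //; last by move=> z _; rewrite big_cons.
by refine (log_field_eq oU _ Hs) => z _; rewrite big_cons.
Qed.

Lemma form1_coef U e al V X : logfr U e -> open V -> V `<=` U -> log_form1 S Z V al -> logf V X ->
  eqon V (al X) (fun x => \sum_l coef S e X x 0 l * al (e l) x).
Proof.
move=> fr oV VU H HX x Vx; have [_ E _] := H V oV (@subset_refl _ V).
have [_ le _ _] := fr.
have [H1 E1] := coef_spec fr oV VU HX.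
have le' l : logf V (e l) by apply: log_field_sub (le l).
by rewrite -(form1_sum (index_enum _) oV H H1 le') //; apply: E => //; apply: log_field_eq HX.
Qed.

(** The dual frame, to which nondegeneracy is applied in [form_mx_unit]. *)
Lemma coef_form1 U e j : logfr U e -> log_form1 S Z U (fun X x => coef S e X x 0 j).
Proof.
move=> fr V oV VU; split.
- by move=> X HX; have [H _] := coef_spec fr oV VU HX; apply: H.
- by move=> X Y HX HY XY x Vx; rewrite (coef_eq fr oV VU HX XY).
- by move=> g X Y Hg HX HY x Vx; rewrite (coef_lin fr oV VU Hg HX HY) // !mxE.
Qed.

Variable w : @vfield R n M -> @vfield R n M -> M -> R.
Hypothesis w2 : log_form2 S Z w.

Definition form_mx e x : 'M[R]_n := \matrix_(i, j) w (e i) (e j) x.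

Lemma mulmx3E (A : 'M[R]_n) (u v : 'rV[R]_n) :
  (u *m A *m v^T) 0 0 = \sum_l v 0 l * \sum_i u 0 i * A i l.
Proof. by rewrite mxE; apply: eq_bigr => l _; rewrite mulrC !mxE. Qed.

Lemma formE U e V X Y : logfr U e -> open V -> V `<=` U -> logf V X -> logf V Y ->
  eqon V (w X Y) (fun x => (coef S e X x *m form_mx e x *m (coef S e Y x)^T) 0 0).
Proof.
move=> fr oV VU HX HY x Vx; have [H _ _] := w2 oV HX.
rewrite mulmx3E (form1_coef fr oV VU H HY) //; apply: eq_bigr => l _; congr (_ * _).
have [_ le _ _] := fr; have le' : logf V (e l) by apply: log_field_sub (le l).
have [_ H' _] := w2 oV le'.
by rewrite (form1_coef fr oV VU H' HX) //; apply: eq_bigr => i _; rewrite mxE.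
Qed.

Lemma form_mx_smooth U e : logfr U e -> smx U (form_mx e).
Proof.
move=> fr i j; have [oU le _ _] := fr; have [H _ _] := w2 oU (le i).
have [H1 _ _] := H U oU (@subset_refl _ U).
by refine (smooth_fun_eq oU _ (H1 _ (le j))) => x _; rewrite mxE.
Qed.

Lemma skew_of_null (A : 'M[R]_n) : (forall v : 'rV_n, (v *m A *m v^T) 0 0 = 0) -> A^T = - A.
Proof.
move=> K; have D (i j : 'I_n) : ((delta_mx 0 i : 'rV_n) *m A *m (delta_mx 0 j : 'rV_n)^T) 0 0 = A i j.
  by rewrite -rowE trmx_delta -colE !mxE.
apply/matrixP => i j; rewrite !mxE.
have := K (delta_mx 0 i + delta_mx 0 j).
rewrite linearD /= !mulmxDl !mulmxDr.
have := K (delta_mx 0 i); have := K (delta_mx 0 j); have := D i j; have := D j i.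
move: (_ *m _ *m (delta_mx 0 j)^T) (_ *m (delta_mx 0 i)^T) (_ *m (delta_mx 0 j)^T) (_ *m (delta_mx 0 i)^T) => a b c d.
move=> <- <- c0 b0; rewrite !mxE c0 b0 add0r addr0 => /eqP; rewrite addr_eq0 => /eqP ->.
by rewrite opprK.
Qed.

Lemma form_mx_skew U e x : logfr U e -> U x -> (form_mx e x)^T = - form_mx e x.
Proof.
move=> fr Ux; have [oU le _ _] := fr; apply: skew_of_null => v.
have sv : smooth_vec S U (fun=> v) by move=> i; apply: smooth_fun_cst.
have lv := lincomb_log fr oU (@subset_refl _ U) sv.
have [_ _ A] := w2 oU lv; have := A x Ux.
by rewrite (formE fr oU (@subset_refl _ U) lv lv) // (coef_lincomb fr oU (@subset_refl _ U) sv).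
Qed.

(** The fields that contraction with [w] sends to the dual frame have, as coefficients, the rows of
    a left inverse. *)
Lemma form_mx_unit U e x : log_nondegenerate S Z w -> logfr U e -> U x -> form_mx e x \in unitmx.
Proof.
move=> nd fr Ux; have [oU le _ _] := fr; have [ex _] := nd U oU.
have H j : exists X, logf U X /\ forall V Y, open V -> V `<=` U -> logf V Y -> eqon V (w X Y) (fun x => coef S e Y x 0 j).
  exact: ex (coef_form1 j fr).
have [X HX] := choice H.
have : (\matrix_j coef S e (X j) x) *m form_mx e x = 1%:M.
  apply/row_matrixP => j; apply/rowP => l; rewrite row_mul rowK.
  have [lX wX] := HX j.
  have := wX U (e l) oU (@subset_refl _ U) (le l) x Ux.
  rewrite (formE fr oU (@subset_refl _ U) lX (le l)) // (coef_frame fr) //.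
  rewrite trmx_delta -colE (_ : forall u : 'rV[R]_n, col l u 0 0 = u 0 l) => [->|u]; last by rewrite mxE.
  by rewrite row1 !mxE eqxx eq_sym.
by case/mulmx1_unit.
Qed.

Lemma form_mx_tr U U' e e' x : logfr U e -> logfr U' e' -> U x -> U' x ->
  form_mx e x = frame_tr S e e' x *m form_mx e' x *m (frame_tr S e e' x)^T.
Proof.
move=> fr fr' Ux Ux'; have [oU le _ _] := fr; have [oU' le' _ _] := fr'.
have oV : open (U `&` U') by apply: openI.
have lV l : logf (U `&` U') (e l) by apply: log_field_sub (le l) => z [].
have VU' : U `&` U' `<=` U' by move=> z [].
apply/matrixP => i j; rewrite mxE (formE fr' oV VU' (lV i) (lV j)) //.
rewrite !mulmx3E mxE; apply: eq_bigr => l _; rewrite mulrC !mxE; congr (_ * _).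
by apply: eq_bigr => m _; rewrite !mxE.
Qed.

Definition endo_mx e (I : vfield -> vfield) x : 'M[R]_n := \matrix_l coef S e (I (e l)) x.

Lemma endo_mxE I U e V X : log_complex S Z I -> logfr U e -> open V -> V `<=` U -> logf V X ->
  eqon V (coef S e (I X)) (fun x => coef S e X x *m endo_mx e I x).
Proof.
move=> cI fr oV VU HX x Vx; have [_ le _ _] := fr.
have [Il Ie IL _] := cI V oV.
have [H1 E1] := coef_spec fr oV VU HX.
have le' l : logf V (e l) by apply: log_field_sub (le l).
have I0 : eqon V (I (fun=> 0)) (fun=> 0).
  have H0 := log_field0 S Z oV; move=> z Vz.
  have := IL (fun=> -1) _ _ (@smooth_fun_cst _ _ _ S V (-1)) H0 H0 z Vz.
  rewrite (Ie _ (fun=> 0)) //; first by rewrite scaleN1r addNr.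
    by apply: log_field_eq H0 => // y _; rewrite scaler0 addr0.
  by move=> y _; rewrite scaler0 addr0.
have Isum (r : seq 'I_n) : eqon V (I (fun x => \sum_(l <- r) coef S e X x 0 l *: e l x))
    (fun x => \sum_(l <- r) coef S e X x 0 l *: I (e l) x).
  elim: r => [|i r IH] z Vz.
    rewrite [RHS]big_nil; apply: etrans (I0 z Vz); apply: Ie => //.
      by apply: log_field_eq (log_field0 S Z oV) => // y _; rewrite big_nil.
      exact: log_field0.
    by move=> y _; rewrite big_nil.
  have Hr := log_field_sum r oV H1 le'.
  rewrite big_cons -IH // -(IL _ _ _ (H1 i) (le' i) Hr z Vz).
  have Hs := log_field_lin oV (H1 i) (le' i) Hr.
  apply: Ie => //; last by move=> y _; rewrite big_cons.
  by refine (log_field_eq oV _ Hs) => y _; rewrite big_cons.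
have E2 : eqon V (I X) (fun x => \sum_l coef S e X x 0 l *: I (e l) x).
  move=> z Vz; rewrite -Isum //; apply: Ie => //.
  by refine (log_field_eq oV _ HX) => y Vy; exact: E1.
rewrite (coef_eq fr oV VU (Il X HX) E2) //.
rewrite (coef_big fr (index_enum _) oV VU H1) // => [|l]; last exact: Il.
by rewrite mulmx_sum_row; apply: eq_bigr => l _; rewrite rowK.
Qed.

Lemma endo_mx_smooth I U e : log_complex S Z I -> logfr U e -> smx U (endo_mx e I).
Proof.
move=> cI fr i j; have [oU le _ _] := fr; have [Il _ _ _] := cI U oU.
have [H _] := coef_spec fr oU (@subset_refl _ U) (Il _ (le i)).
by refine (smooth_fun_eq oU _ (H j)) => x _; rewrite mxE.
Qed.

Lemma endo_mx_tr I U U' e e' x : log_complex S Z I -> logfr U e -> logfr U' e' -> U x -> U' x ->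
  endo_mx e I x *m frame_tr S e e' x = frame_tr S e e' x *m endo_mx e' I x.
Proof.
move=> cI fr fr' Ux Ux'; have [oU le _ _] := fr; have [oU' _ _ _] := fr'.
have oV : open (U `&` U') by apply: openI.
have lV l : logf (U `&` U') (e l) by apply: log_field_sub (le l) => z [].
have VU : U `&` U' `<=` U by move=> z [].
have VU' : U `&` U' `<=` U' by move=> z [].
have [Il _ _ _] := cI _ oV.
apply/row_matrixP => l; rewrite !row_mul !rowK.
rewrite -(frame_trE fr fr' oV VU VU' (Il _ (lV l))) //.
by rewrite (endo_mxE cI fr' oV VU' (lV l)).
Qed.

(** Every vector of the fibre at [x] is the value of a combination of the frame with constant
    coefficients, so the conditions on sections give conditions on matrices at [x]. *)
Lemma endo_mx_compat I U e x : log_compatible S Z w I -> logfr U e -> U x ->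
  compat (form_mx e x) (endo_mx e I x).
Proof.
move=> [cI inv pos] fr Ux; have [oU le _ _] := fr; have UU := @subset_refl _ U.
have [Il _ _ sq] := cI U oU.
have cv v : [/\ smooth_vec S U (fun=> v), logf U (lincomb e (fun=> v)) & coef S e (lincomb e (fun=> v)) x = v].
  have sv : smooth_vec S U (fun=> v) by move=> i; apply: smooth_fun_cst.
  have lv := lincomb_log fr oU UU sv.
  by split; [exact: sv|exact: lv|exact: (coef_lincomb fr oU UU sv)].
split.
- apply/row_matrixP => l; rewrite row_mul rowK.
  rewrite -(endo_mxE cI fr oU UU (Il _ (le l))) //.
  have HN : smooth_vec S U (fun=> - delta_mx 0 l : 'rV_n) by move=> i; apply: smooth_fun_cst.
  have -> : row l (- 1%:M) = - delta_mx 0 l :> 'rV[R]_n by rewrite -row1; apply/rowP => j; rewrite !mxE.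
  apply: (coef_unique fr oU UU HN _ Ux).
  by move=> z Uz; rewrite (sq _ (le l)) // lincombE mulNmx -rowE rowK.
- apply/matrixP => i j; rewrite [RHS]mxE -(inv U oU _ _ (le i) (le j) x Ux).
  rewrite (formE fr oU UU (Il _ (le i)) (Il _ (le j)) Ux).
  rewrite !mulmx3E mxE; apply: eq_bigr => l _; rewrite mulrC !mxE; congr (_ * _).
  by apply: eq_bigr => m _; rewrite !mxE.
- move=> v v0; have [sv lv cvv] := cv v.
  have := pos U oU _ x lv Ux; rewrite (formE fr oU UU lv (Il _ lv) Ux) cvv.
  rewrite (endo_mxE cI fr oU UU lv Ux) cvv; apply.
  by move/(coef_log_zero fr oU UU lv Ux); rewrite cvv; apply/eqP.
Qed.

End Form.

Section ExCompatible.
Context {R : realType} {n : nat} {M : topologicalType}.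
Variable S : smooth_structure R n M.
Hypothesis (hM : hausdorff_space M) (cM : @second_countable M).
Context {k : nat}.
Variable Z : 'I_k -> set M.
Implicit Types (U V : set M) (x : M) (X Y : @vfield R n M) (e : 'I_n -> @vfield R n M).
Local Notation smx := (smooth_mx S).
Local Notation logf := (log_field S Z).
Local Notation logfr := (log_frame S Z).
Variable w : @vfield R n M -> @vfield R n M -> M -> R.
Hypotheses (w2 : log_form2 S Z w) (nd : log_nondegenerate S Z w).
Variables (pU : M -> set M) (pe : M -> 'I_n -> @vfield R n M).
Hypothesis pfr : forall x, logfr (pU x) (pe x) /\ pU x x.

Lemma invmx_conj (G K : 'M[R]_n) : G \in unitmx -> K \in unitmx ->
  invmx (G *m K *m invmx G) = G *m invmx K *m invmx G.
Proof.
move=> uG uK.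
have uC : G *m K *m invmx G \in unitmx by rewrite !unitmx_mul uG uK unitmx_inv.
apply: (can_inj (mulKmx uC)); rewrite mulmxV //.
by rewrite !mulmxA mulmxKV // mulmxK // mulmxV.
Qed.

(** The interpolation commutes with changes of frame, so its smoothness can be checked in a fixed
    frame. *)
Lemma cs_interp_conj s (G A0 A1 : 'M[R]_n) : G \in unitmx -> cs_mid s A0 A1 \in unitmx ->
  G *m cs_interp s A0 A1 *m invmx G = cs_interp s (G *m A0 *m invmx G) (G *m A1 *m invmx G).
Proof.
move=> uG uK; rewrite /cs_interp.
have -> : cs_mid s (G *m A0 *m invmx G) (G *m A1 *m invmx G) = G *m cs_mid s A0 A1 *m invmx G.
  by rewrite /cs_mid mulmxDr mulmxDl -!(scalemxAl, scalemxAr).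
by rewrite invmx_conj // !mulmxA !mulmxKV.
Qed.

(** [A x] refers to the frame [pe x], which varies with [x] without regularity; smoothness only
    makes sense after passing to a fixed frame [e]. *)
Definition in_frame e (A : M -> 'M[R]_n) x :=
  frame_tr S e (pe x) x *m A x *m invmx (frame_tr S e (pe x) x).

Definition endo_ok U (A : M -> 'M[R]_n) :=
  (forall V e, logfr V e -> smx (V `&` U) (in_frame e A)) /\
  forall x, U x -> compat (form_mx w (pe x) x) (A x).

Lemma pref_unit V e x : logfr V e -> V x -> frame_tr S e (pe x) x \in unitmx.
Proof. by move=> fr Vx; have [fr' Ux] := pfr x; apply: (frame_tr_unit fr fr'). Qed.

Lemma in_frame_change V V' e e' A x : logfr V e -> logfr V' e' -> V x -> V' x ->
  in_frame e A x = frame_tr S e e' x *m in_frame e' A x *m frame_tr S e' e x.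
Proof.
move=> fr fr' Vx Vx'; have [fp px] := pfr x.
rewrite /in_frame (frame_tr_comp fr fr' fp) //.
have ue' := pref_unit fr' Vx'; have ug := frame_tr_unit fr fr' Vx Vx'.
have -> : invmx (frame_tr S e e' x *m frame_tr S e' (pe x) x) = invmx (frame_tr S e' (pe x) x) *m frame_tr S e' e x.
  have uu : frame_tr S e e' x *m frame_tr S e' (pe x) x \in unitmx by rewrite unitmx_mul ug.
  apply: (can_inj (mulKmx uu)); rewrite mulmxV // mulmxA mulmxK //.
  by rewrite (frame_tr_inv fr fr').
by rewrite !mulmxA.
Qed.

(** Endomorphisms are encoded as matrix-valued functions for the sake of [glue_sections], with
    [cs_interp] as interpolation; [local_compat] supplies the local ones. *)
Lemma ex_endo : exists A, endo_ok [set: M] A.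
Proof.
apply: (@glue_sections _ _ _ S hM cM _ 0 endo_ok (fun _ s A0 A1 => cs_interp s A0 A1)).
- move=> U A H; split.
    move=> V e fr; refine (smooth_mx_local _) => x [Vx Ux].
    have [W [A' [oW Wx [H' _] E]]] := H x Ux; have [oV _ _ _] := fr.
    have oVW : open (V `&` W) by apply: openI.
    exists (V `&` W); split=> //.
    by refine (smooth_mx_eq oVW _ (H' V e fr)) => z [_ Wz]; rewrite /in_frame E.
  by move=> x /H [W [A' [oW Wx [_ C] E]]]; rewrite -E //; apply: C.
- move=> U V A oV VU [H C]; split; last by move=> x /VU; apply: C.
  by move=> W e fr; refine (smooth_mx_sub _ (H W e fr)) => z [Wz /VU].
- move=> U chi A0 A1 oU schi chi01 [H0 C0] [H1 C1].
  have uK x : U x -> cs_mid (chi x) (A0 x) (A1 x) \in unitmx.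
    move=> Ux; have [_ _ P0] := C0 x Ux; have [_ _ P1] := C1 x Ux.
    exact: cs_mid_unit (chi01 x Ux) P0 P1.
  split; last by move=> x Ux; apply: cs_interp_compat; [exact: chi01|exact: C0|exact: C1].
  move=> V e fr; have [oV _ _ _] := fr.
  have oW : open (V `&` U) by apply: openI.
  have s0 := H0 V e fr; have s1 := H1 V e fr.
  have sc : smooth_fun S (V `&` U) chi by apply: smooth_fun_sub schi => z [].
  pose K x := cs_mid (chi x) (in_frame e A0 x) (in_frame e A1 x).
  have E : eqon (V `&` U) (fun x => invmx (K x) *m in_frame e A0 x *m K x)
      (in_frame e (fun x => cs_interp (chi x) (A0 x) (A1 x))).
    move=> x [Vx Ux]; rewrite /in_frame cs_interp_conj //; last exact: uK.
    exact: (pref_unit fr Vx).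
  refine (smooth_mx_eq oW E _).
  have sK : smx (V `&` U) K.
    refine (@smooth_mxD _ _ _ S n n _ (fun x => (2 - chi x) *: in_frame e A0 x) (fun x => chi x *: in_frame e A1 x) oW _ _); refine (smooth_mxZ oW _ _) => //.
    by apply: (smooth_funD oW); [exact: smooth_fun_cst|exact: smooth_funN].
  have uK' x : (V `&` U) x -> K x \in unitmx.
    move=> [Vx Ux]; rewrite /K /in_frame /cs_mid.
    have uG := pref_unit fr Vx; move: (uK x Ux); rewrite /cs_mid => u.
    set G := frame_tr _ _ _ _.
    rewrite (_ : _ + _ = G *m ((2 - chi x) *: A0 x + chi x *: A1 x) *m invmx G).
      by rewrite !unitmx_mul unitmx_inv uG u.
    by rewrite mulmxDr mulmxDl -!(scalemxAl, scalemxAr).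
  refine (smooth_mxM oW _ sK); refine (smooth_mxM oW _ s0).
  exact: (smooth_invmx oW uK' sK).
- move=> U A0 A1 x oU Ux [_ C0] _; apply: cs_interp0; by have [] := C0 x Ux.
- move=> U A0 A1 x oU Ux [_ C0] [_ C1].
  have [q0 _ p0] := C0 x Ux; have [q1 _ p1] := C1 x Ux.
  by apply: cs_interp1 => //; apply: (cs_mid_unit _ p0 p1); rewrite ler01 lexx.
- move=> p; have [fp pp] := pfr p; have [oU _ _ _] := fp.
  have [V [A [oV Vp VU sA cA]]] := local_compat oU pp (form_mx_smooth w2 fp)
     (fun x => form_mx_skew w2 fp (x := x)) (fun x => form_mx_unit w2 nd fp (x := x)).
  (* [A] is expressed in the single frame [pe p]; it is rewritten in the frame chosen at each
     [x]. *)
  exists V, (fun x => invmx (frame_tr S (pe p) (pe x) x) *m A x *m frame_tr S (pe p) (pe x) x).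
  split=> //; split.
    move=> W e fr; have [oW _ _ _] := fr.
    have oWV : open (W `&` V) by apply: openI.
    have E : eqon (W `&` V) (fun x => frame_tr S e (pe p) x *m A x *m frame_tr S (pe p) e x)
       (in_frame e (fun x => invmx (frame_tr S (pe p) (pe x) x) *m A x *m frame_tr S (pe p) (pe x) x)).
      move=> x [Wx Vx]; rewrite (in_frame_change _ fr fp Wx (VU x Vx)) /in_frame.
      have u := pref_unit fp (VU x Vx).
      set F := frame_tr S (pe p) (pe x) x.
      have -> : F *m (invmx F *m A x *m F) *m invmx F = A x by rewrite !mulmxA mulmxV // mul1mx mulmxK.
      by [].
    refine (smooth_mx_eq oWV E _).
    have WVU : W `&` V `<=` W `&` pU p by move=> z [Wz /VU].
    have WVU' : W `&` V `<=` pU p `&` W by move=> z [Wz /VU].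
    refine (smooth_mxM oWV _ (smooth_mx_sub WVU' (frame_tr_smooth fp fr))).
    refine (smooth_mxM oWV (smooth_mx_sub WVU (frame_tr_smooth fr fp)) _).
    by refine (smooth_mx_sub _ sA) => z [].
  move=> x Vx; have [fx xx] := pfr x; apply: compat_conj; first exact: (pref_unit fp (VU x Vx)).
  by rewrite -(form_mx_tr w2 fp fx (VU x Vx) xx); apply: cA.
Qed.

Variable A : M -> 'M[R]_n.
Hypothesis Aok : endo_ok [set: M] A.

Definition endo_of (X : @vfield R n M) : @vfield R n M :=
  fun x => coef S (pe x) X x *m A x *m frame_mx (pe x) x.

Lemma endo_ofE U V e X : logfr U e -> open V -> V `<=` U -> logf V X ->
  eqon V (endo_of X) (lincomb e (fun x => coef S e X x *m in_frame e A x)).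
Proof.
move=> fr oV VU HX x Vx; have [fp px] := pfr x; have Ux := VU x Vx.
have u := pref_unit fr Ux; have [oP _ _ _] := fp.
rewrite /endo_of lincombE /in_frame (frame_tr_mxE fr fp) //.
have oVP : open (V `&` pU x) by apply: openI.
rewrite (@frame_trE _ _ _ S _ Z U (pU x) e (pe x) fr fp (V `&` pU x)) //; last first.
- by apply: log_field_sub HX => z [].
- by move=> z [/VU].
by rewrite !mulmxA mulmxKV.
Qed.

Lemma endo_of_coef U V e X : logfr U e -> open V -> V `<=` U -> logf V X ->
  smooth_vec S V (coef S e (endo_of X)) /\
  eqon V (coef S e (endo_of X)) (fun x => coef S e X x *m in_frame e A x).
Proof.
move=> fr oV VU HX.
have sA : smx V (in_frame e A) by refine (smooth_mx_sub _ (Aok.1 U e fr)) => z /VU.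
have [/smooth_vec_mx H1 _] := coef_spec fr oV VU HX.
have sv : smooth_vec S V (fun x => coef S e X x *m in_frame e A x).
  by apply/smooth_vec_mx; exact: (smooth_mxM oV H1 sA).
have E := coef_unique fr oV VU sv (endo_ofE fr oV VU HX); split=> //.
by move=> i; refine (smooth_fun_eq oV _ (sv i)) => x Vx; rewrite E.
Qed.

Lemma endo_of_log U X : open U -> logf U X -> logf U (endo_of X).
Proof.
move=> oU HX; apply: log_field_local => x Ux; have [fp px] := pfr x.
have [oP _ _ _] := fp; have oV : open (U `&` pU x) by apply: openI.
have VP : U `&` pU x `<=` pU x by move=> z [].
have HX' : logf (U `&` pU x) X by apply: log_field_sub HX => z [].
exists (U `&` pU x); split=> //.
have [sv E] := endo_of_coef fp oV VP HX'.
have E2 := endo_ofE fp oV VP HX'.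
refine (log_field_eq oV _ (lincomb_log fp oV VP sv)) => z Vz.
by rewrite E2 // !lincombE E.
Qed.

Lemma endo_of_compatible : log_compatible S Z w endo_of.
Proof.
have loc U X x : open U -> logf U X -> U x -> [/\ open (U `&` pU x), (U `&` pU x) x,
    U `&` pU x `<=` pU x & logf (U `&` pU x) X].
  move=> oU HX Ux; have [fp px] := pfr x; have [oP _ _ _] := fp.
  split; [exact: openI|by []|by move=> z []|by apply: log_field_sub HX => z []].
have inE x : in_frame (pe x) A x = A x.
  by have [fp px] := pfr x; rewrite /in_frame (frame_tr_id fp px) invmx1 mul1mx mulmx1.
have CE U X x : open U -> logf U X -> U x -> coef S (pe x) (endo_of X) x = coef S (pe x) X x *m A x.
  move=> oU HX Ux; have [fp px] := pfr x; have [oV Vx VP HX'] := loc U X x oU HX Ux.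
  by rewrite (endo_of_coef fp oV VP HX').2 // inE.
have WE U X Y x : open U -> logf U X -> logf U Y -> U x ->
    w X Y x = (coef S (pe x) X x *m form_mx w (pe x) x *m (coef S (pe x) Y x)^T) 0 0.
  move=> oU HX HY Ux; have [fp px] := pfr x; have [oV Vx VP HX'] := loc U X x oU HX Ux.
  have [_ _ _ HY'] := loc U Y x oU HY Ux.
  by rewrite (formE w2 fp oV VP HX' HY').
split.
- move=> U oU; split.
  + by move=> X HX; apply: endo_of_log.
  + move=> X Y HX HY XY x Ux; have [fp px] := pfr x; have [oV Vx VP HX'] := loc U X x oU HX Ux.
    have XY' : eqon (U `&` pU x) X Y by move=> z [Uz _]; apply: XY.
    by rewrite /endo_of (coef_eq fp oV VP HX' XY').
  + move=> g X Y Hg HX HY x Ux; have [fp px] := pfr x; have [oV Vx VP HX'] := loc U X x oU HX Ux.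
    have [_ _ _ HY'] := loc U Y x oU HY Ux.
    have Hg' : smooth_fun S (U `&` pU x) g by apply: smooth_fun_sub Hg => z [].
    by rewrite /endo_of (coef_lin fp oV VP Hg' HX' HY') // !mulmxDl -!scalemxAl.
  + move=> X HX x Ux; have [fp px] := pfr x; have [oV Vx VP HX'] := loc U X x oU HX Ux.
    rewrite {1}/endo_of (CE U) //; have [sq _ _] := Aok.2 x Logic.I.
    rewrite -(mulmxA (coef S (pe x) X x)) sq mulmxN mulmx1 mulNmx; congr (- _).
    by rewrite -lincombE; have [_ ->] := coef_spec fp oV VP HX'.
- move=> U oU X Y HX HY x Ux.
  rewrite (WE U _ _ x oU (endo_of_log oU HX) (endo_of_log oU HY) Ux) (WE U _ _ x oU HX HY Ux).
  rewrite (CE U X x) // (CE U Y x) //; have [_ inv _] := Aok.2 x Logic.I.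
  rewrite trmx_mul !mulmxA -[_ *m A x *m form_mx w (pe x) x]mulmxA -[_ *m _ *m (A x)^T]mulmxA.
  by rewrite inv.
- move=> U oU X x HX Ux nz; have [fp px] := pfr x; have [oV Vx VP HX'] := loc U X x oU HX Ux.
  rewrite (WE U _ _ x oU HX (endo_of_log oU HX) Ux) (CE U X x) //.
  have [_ _ pos] := Aok.2 x Logic.I; apply: pos; apply/eqP => c0; apply: nz.
  by apply/(coef_log_zero fp oV VP HX' Vx).
Qed.

End ExCompatible.

(** * Orientations and splittings *)

Section IdealFrames.
Context {R : realType} {n : nat} {M : topologicalType}.
Variable S : smooth_structure R n M.
Implicit Types (U V D : set M) (f g h : M -> R) (x : M) (O : M -> (M -> R) -> Prop).

Lemma ideal_frame_inj D U V f h h' : ideal_frame S D U f -> open V -> V `<=` U ->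
  smooth_fun S V h -> smooth_fun S V h' -> eqon V (fun x => h x * f x) (fun x => h' x * f x) -> eqon V h h'.
Proof.
move=> [[sf f0] fr] oV VU sh sh' E.
have vg : vanishing S D V (fun x => h x * f x).
  split; first exact: (smooth_funM oV sh (smooth_fun_sub VU sf)).
  by move=> x Vx Dx; rewrite f0 ?mulr0 //; apply: VU.
have [h0 [_ _ un]] := fr V _ oV VU vg.
by move=> x Vx; rewrite (un h sh (fun _ _ => erefl)) // (un h' sh' E).
Qed.

Lemma ideal_frame_unit D U V f f' : ideal_frame S D U f -> ideal_frame S D U f' ->
  open V -> V `<=` U ->
  exists h, [/\ smooth_fun S V h, eqon V f' (fun x => h x * f x) & forall x, V x -> h x != 0].
Proof.
move=> F F' oV VU; have [[sf f0] fr] := F; have [[sf' f0'] fr'] := F'.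
have v : vanishing S D V f by split; [exact: smooth_fun_sub VU sf|move=> x /VU; apply: f0].
have v' : vanishing S D V f' by split; [exact: smooth_fun_sub VU sf'|move=> x /VU; apply: f0'].
have [h [sh E _]] := fr V _ oV VU v'; have [h' [sh' E' _]] := fr' V _ oV VU v.
exists h; split=> // x Vx.
have : h' x * h x = 1.
  apply: (ideal_frame_inj F oV VU (smooth_funM oV sh' sh) (@smooth_fun_cst _ _ _ S V 1)) Vx.
  by move=> z Vz; rewrite mul1r -mulrA -E // -E'.
by move=> H; apply/eqP => h0; move: H; rewrite h0 mulr0 => /esym /eqP; rewrite oner_eq0.
Qed.

Lemma ideal_frameN D U f : open U -> ideal_frame S D U f -> ideal_frame S D U (fun x => - f x).
Proof.
move=> oU F; have [[sf f0] fr] := F; split.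
  by split; [exact: smooth_funN|move=> x Ux Dx; rewrite f0 // oppr0].
move=> V g oV VU vg; have [h [sh E un]] := fr V g oV VU vg.
exists (fun x => - h x); split; first exact: smooth_funN.
  by move=> x Vx; rewrite mulrNN E.
move=> h' sh' E' x Vx; apply: oppr_inj; rewrite opprK.
apply: (un (fun x => - h' x)) Vx; first exact: smooth_funN.
by move=> z Vz; rewrite mulNr -mulrN E'.
Qed.

(** Any global frame orients its line bundle. This yields the existence statement when no
    orientation is given. *)
Lemma frame_orientation D f : ideal_frame S D [set: M] f ->
  orientation S D (fun x g => exists V h, [/\ open V, V x, smooth_fun S V h, eqon V g (fun y => h y * f y) & 0 < h x]).
Proof.
move=> F x0; exists [set: M], f; split=> //; first exact: openT.
move=> V x g oV VU Vx vg; split=> [[V' [h [oV' Vx' sh E h0]]]|[h [sh E h0]]]; last by exists V, h.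
have [_ fr] := F; have [h' [sh' E' _]] := fr V g oV VU vg.
exists h'; split=> //.
suff -> : h' x = h x by [].
have oW : open (V `&` V') by apply: openI.
apply: (@ideal_frame_inj _ _ (V `&` V') _ _ _ F oW) => //.
- by apply: smooth_fun_sub sh' => z [].
- by apply: smooth_fun_sub sh => z [].
- by move=> z [Vz Vz']; rewrite -E' // E.
Qed.

(** [h] is the ratio of [f] to the local frame that defines the orientation, so the sign of [h]
    tells whether [f] is positive. *)
Lemma orientation_local D O f x0 : ideal_frame S D [set: M] f -> orientation S D O ->
  exists U h, [/\ open U, U x0, smooth_fun S U h, forall x, U x -> h x != 0 &
    forall g q, smooth_fun S [set: M] q -> vanishing S D [set: M] g -> (forall x, g x = q x * f x) ->
      forall x, U x -> (O x g <-> 0 < q x * h x)].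
Proof.
move=> F HO; have [U [f0 [oU Ux0 F0 H]]] := HO x0.
have FU : ideal_frame S D U f.
  have [[sf ff0] fr] := F; split; first by split; [apply: smooth_fun_sub sf|move=> x _; apply: ff0].
  by move=> V g oV VU; apply: fr.
have [h [sh E hn]] := ideal_frame_unit F0 FU oU (@subset_refl _ U).
exists U, h; split=> // g q sq vg Eg x Ux.
have vU : vanishing S D U g.
  by case: vg => sg g0; split; [apply: smooth_fun_sub sg|move=> z _; apply: g0].
have sqU : smooth_fun S U q by apply: smooth_fun_sub sq.
rewrite (H U x g oU (@subset_refl _ U) Ux vU).
split=> [[h' [sh' E' h0]]|h0]; last first.
  exists (fun z => q z * h z); split=> //; first exact: smooth_funM.
  by move=> z Uz; rewrite Eg E // mulrA.
suff -> : q x * h x = h' x by [].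
apply: (ideal_frame_inj F0 oU (@subset_refl _ U) (smooth_funM oU sqU sh) sh') Ux.
by move=> z Uz; rewrite -E' // Eg E // mulrA.
Qed.

(** By [orientation_local] the set where [f] is positive is open and closed. As [M] is connected,
    [f] or [- f] is positive everywhere. *)
Lemma ex_positive_frame D O f : connected [set: M] -> ideal_frame S D [set: M] f -> orientation S D O ->
  exists f', positive_frame S D O f'.
Proof.
move=> cn F HO.
have vf : vanishing S D [set: M] f by case: F.
have FN := ideal_frameN openT F.
have vfN : vanishing S D [set: M] (fun x => - f x) by case: FN.
pose P := [set x | O x f].
have loc x0 : exists U h, [/\ open U, U x0, smooth_fun S U h, forall x, U x -> h x != 0 &
    forall x, U x -> (O x f <-> 0 < h x) /\ (O x (fun z => - f z) <-> h x < 0)].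
  have [U [h [oU Ux sh hn H]]] := orientation_local x0 F HO; exists U, h; split=> // x Ux'; split.
    rewrite (H f (fun=> 1) (@smooth_fun_cst _ _ _ S _ 1) vf _ x Ux') ?mul1r // => z.
    by rewrite mul1r.
  rewrite (H _ (fun=> -1) (@smooth_fun_cst _ _ _ S _ (-1)) vfN _ x Ux') ?mulN1r ?oppr_gt0 // => z.
  by rewrite mulN1r.
have oP : open P.
  rewrite openE => x Px; have [U [h [oU Ux sh hn HH]]] := loc x; have H z Uz := (HH z Uz).1.
  have oW := smooth_fun_open oU sh (@open_gt _ (0 : R)).
  apply: (@filterS _ _ _ (U `&` [set x | [set t : R | 0 < t] (h x)])).
    by move=> z [Uz hz]; apply/(H z Uz).
  by apply: open_nbhs_nbhs; split=> //; split=> //=; apply/(H x Ux).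
have oPC : open (~` P).
  rewrite openE => x Px; have [U [h [oU Ux sh hn HH]]] := loc x; have H z Uz := (HH z Uz).1.
  have oW := smooth_fun_open oU sh (@open_lt _ (0 : R)).
  apply: (@filterS _ _ _ (U `&` [set x | [set t : R | t < 0] (h x)])).
    by move=> z [Uz hz] /(H z Uz) hz'; move: hz; rewrite /= ltNge ltW.
  apply: open_nbhs_nbhs; split=> //; split=> //=.
  by rewrite lt_neqAle hn //= leNgt; apply/negP => /(H x Ux).
have [[x0 Px0]|nP] := pselect (exists x, P x).
  have PT : P = [set: M].
    apply: cn; first by exists x0.
      by exists P => //; rewrite setTI.
    by exists P; [rewrite -openC|rewrite setTI].
  by exists f; split=> // x; change (P x); rewrite PT.
exists (fun x => - f x); split=> // x; have [U [h [oU Ux sh hn HH]]] := loc x.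
have [H HN] := HH x Ux; apply/HN; rewrite lt_neqAle hn //= leNgt; apply/negP => /H Px.
by apply: nP; exists x.
Qed.

Lemma positive_frame_ratio D O f f' : orientation S D O -> positive_frame S D O f -> positive_frame S D O f' ->
  exists h, [/\ smooth_fun S [set: M] h, forall x, f' x = h x * f x & forall x, 0 < h x].
Proof.
move=> HO [F Of] [F' Of']; have sT := @subset_refl _ [set: M].
have [h [sh E hn]] := ideal_frame_unit F F' openT sT.
exists h; split=> // x; first exact: E.
have vf : vanishing S D [set: M] f by case: F.
have vf' : vanishing S D [set: M] f' by case: F'.
have [U [q [oU Ux sq qn H]]] := orientation_local x F HO.
have q0 : 0 < q x.
  have := (H f (fun=> 1) (@smooth_fun_cst _ _ _ S _ 1) vf (fun z => esym (mul1r _)) x Ux).1 (Of x).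
  by rewrite mul1r.
have := (H f' h sh vf' (fun z => E z Logic.I) x Ux).1 (Of' x).
by rewrite pmulr_lgt0.
Qed.

End IdealFrames.

Section Splitting.
Context {R : realType} {n : nat} {M : topologicalType}.
Variable S : smooth_structure R n M.
Hypothesis (hM : hausdorff_space M) (cM : @second_countable M).
Context {k : nat}.
Variable Z : 'I_k -> set M.
Hypothesis ncZ : normal_crossing S Z.
Variable gf : 'I_k -> M -> R.
Hypothesis gfP : forall i, global_defining S (Z i) (gf i).
Variable f : 'I_k -> M -> R.
Hypothesis ff : forall i, ideal_frame S (Z i) [set: M] (f i).
Implicit Types (c d : chart R n M) (U V : set M) (x : M) (X Y : @vfield R n M).
Local Notation smx := (smooth_mx S).
Local Notation dfun := (dfun S).

Lemma frame_smooth i U : smooth_fun S U (f i).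
Proof. by have [[H _] _] := ff i; apply: smooth_fun_sub H. Qed.

(** [f i] is only known to generate the ideal. From [f_i = q x_l] and [x_l = h f_i] one gets
    [h q = 1], and on [Z i] the product rule leaves [df_i = q dx_l]. *)
Lemma adapted_dframe c U idx i l : adapted S Z c U idx -> idx l = Some i ->
  exists q, [/\ smooth_fun S U q, forall x, U x -> q x != 0 &
    forall x v, U x -> Z i x -> dfun (f i) x v = q x * (v *m jac S c x) 0 l].
Proof.
move=> ad il; have [Sc oU Uc inj HZ] := ad; have UU := @subset_refl _ U.
have vf : vanishing S (Z i) U (f i).
  by have [[H H0] _] := ff i; split; [apply: smooth_fun_sub H|move=> x _; apply: H0].
have [q [sq E]] := vanish_coord ad il oU UU vf.
have vx : vanishing S (Z i) U (fun x => coord c x 0 l).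
  split; first exact: (coord_smooth_on ad l UU).
  by move=> x Ux /(adapted_zero ad il Ux).
have [_ fr] := ff i; have [h [sh E' _]] := fr U _ oU (@subsetT _ U) vx.
exists q; split=> //.
  move=> x Ux; have : h x * q x = 1.
    apply: (coord_cancel ad (j := l) oU UU (smooth_funM oU sh sq) (@smooth_fun_cst _ _ _ S U 1)) Ux.
    by move=> z Uz; rewrite mul1r -mulrA -E // -E'.
  by move=> H; apply/eqP => q0; move: H; rewrite q0 mulr0 => /esym /eqP; rewrite oner_eq0.
move=> x v Ux Zx; rewrite (dfun_eq S oU Ux E) (dfunM _ oU Ux sq (coord_smooth_on ad l UU)).
rewrite dfun_coord //; last exact: Uc.
by have /(adapted_zero ad il Ux) -> := Zx; rewrite mul0r addr0.
Qed.

(** The conditions on [nu] are affine, so affine interpolation preserves them. *)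
Lemma ex_normal_field j : exists nu : @vfield R n M, smooth_field S [set: M] nu /\
  forall i x, Z i x -> dfun (f i) x (nu x) = (i == j)%:R.
Proof.
pose Sm U (s : M -> 'rV[R]_n) := smooth_field S U s /\
  forall i x, U x -> Z i x -> dfun (f i) x (s x) = (i == j)%:R.
suff [nu [H1 H2]] : exists s, Sm [set: M] s by exists nu; split=> // i x; apply: H2.
have dl i x a u v : dfun (f i) x (a *: u + v) = a * dfun (f i) x u + dfun (f i) x v.
  exact: dfun_lin _ _ _ openT Logic.I (frame_smooth i setT).
apply: (@glue_sections _ _ _ S hM cM _ 0 Sm (fun _ t s0 s1 => t *: (s1 - s0) + s0)).
- move=> U s H; split.
    refine (smooth_field_local _) => x /H [V [s' [oV Vx [Hs _] E]]]; exists V; split=> //.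
    by refine (smooth_field_eq oV E Hs).
  by move=> i x /H [V [s' [oV Vx [_ Hs] E]]] Zx; rewrite -E // Hs.
- move=> U V s oV VU [H1 H2]; split; first by refine (smooth_field_sub VU H1).
  by move=> i x /VU; apply: H2.
- move=> U chi s0 s1 oU sc _ [H0 D0] [H1 D1]; split.
    refine (smooth_field_lin oU sc _ H0).
    refine (smooth_field_eq oU _ (smooth_field_lin oU (@smooth_fun_cst _ _ _ S U (-1)) H0 H1)) => x _.
    by rewrite scaleN1r addrC.
  move=> i x Ux Zx; rewrite dl -scaleN1r [s1 x + _]addrC dl (D0 i x Ux Zx) (D1 i x Ux Zx).
  by rewrite mulN1r addNr mulr0 add0r.
- by move=> U s0 s1 x _ _ _ _; rewrite scale0r add0r.
- by move=> U s0 s1 x _ _ _ _; rewrite scale1r subrK.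
move=> p; have [c [U [idx [ad Up]]]] := adapted_chart ncZ gfP p.
have [Sc oU Uc inj HZ] := ad; exists U.
have [[l jl]|nj] := pselect (exists l, idx l = Some j); last first.
  (* No coordinate cuts out [Z j], so [Z j] misses [U] and only the conditions with right-hand side
     0 remain. *)
  exists (fun=> 0); split=> //; split; first exact: smooth_field0.
  move=> i x Ux Zx; have := dl i x (-1) 0 0; rewrite scaler0 addr0 mulN1r addNr => ->.
  case: eqP => // ij; case: nj; rewrite -ij.
  by have [l [il _]] := (HZ i x Ux).1 Zx; exists l.
have [q [sq qn Eq]] := adapted_dframe ad jl.
(* The field [q^-1 d/dx_l], because [df_j = q dx_l] on [Z j]. *)
exists (chart_field S c (fun x => (q x)^-1 *: delta_mx 0 l)); split=> //; split.
  apply: chart_field_smooth => //.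
  refine (@smooth_mxZ _ _ _ S 1 n U _ _ oU (smooth_funV oU qn sq) _).
  exact: (@smooth_mx_cst _ _ _ S 1 n _ (delta_mx 0 l)).
move=> i x Ux Zx; have [l' il' _] := (HZ i x Ux).1 Zx.
have [q' [_ _ Eq']] := adapted_dframe ad il'.
have [ij|ij] := eqVneq i j.
  subst i; rewrite Eq // chart_fieldK //; last exact: Uc.
  by rewrite !mxE !eqxx mulr1 mulfV // qn.
rewrite Eq' // chart_fieldK //; last exact: Uc.
rewrite !mxE eqxx /=; case: eqP => [ll|_]; last by rewrite !mulr0.
by move: ij; move: jl; rewrite -ll il' => -[->]; rewrite eqxx.
Qed.

Lemma ex_splitting_data : exists nu al, splitting_data S Z f nu al.
Proof.
have [nu H] := choice ex_normal_field.
(* The 1-forms only parametrise the splittings; 0 is the simplest choice. *)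
exists nu, (fun _ _ => 0); split.
- by move=> j; have [] := H j.
- by move=> i j x; have [_ D] := H j; apply: D.
- move=> i U X oU _; refine (smooth_fun_eq oU _ (@smooth_fun_cst _ _ _ S U 0)) => x _.
  by rewrite mulmx0 mxE.
Qed.

End Splitting.

(** * The stable almost complex structure *)

Definition std_acs (R : pzRingType) k n (A : 'M[R]_n) : 'M[R]_((k + k) + n) :=
  block_mx (block_mx 0 1%:M (- 1%:M) 0) 0 0 A.

Lemma std_acs_row (R : pzRingType) k n (A : 'M[R]_n) (a' a : 'rV[R]_k) c :
  row_mx (row_mx a' a) c *m std_acs k A = row_mx (row_mx (- a) a') (c *m A).
Proof.
rewrite /std_acs !mul_row_block !(mulmx0, mul0mx, addr0, add0r, mulmxN, mulmx1).
by [].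
Qed.

Lemma mx_ext (R : pzRingType) m p (A B : 'M[R]_(m, p)) : (forall u : 'rV_m, u *m A = u *m B) -> A = B.
Proof. by move=> H; apply/row_matrixP => i; rewrite !rowE. Qed.

Lemma row3_ext (R : pzRingType) k n p (A B : 'M[R]_((k + k) + n, p)) :
  (forall (a' a : 'rV_k) c, row_mx (row_mx a' a) c *m A = row_mx (row_mx a' a) c *m B) -> A = B.
Proof. by move=> H; apply: mx_ext => u; rewrite -[u]hsubmxK -[lsubmx u]hsubmxK H. Qed.

Lemma std_acs_sqr (R : pzRingType) k n (A : 'M[R]_n) : A *m A = - 1%:M ->
  std_acs k A *m std_acs k A = - 1%:M.
Proof.
move=> A2; apply: row3_ext => a' a c; rewrite mulmxA !std_acs_row -mulmxA A2 !mulmxN !mulmx1.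
by rewrite !opp_row_mx.
Qed.

Lemma addmx_entry (R : nmodType) p q (A B : 'M[R]_(p, q)) i j : (A + B) i j = A i j + B i j.
Proof. by rewrite mxE. Qed.

Lemma mulmx_entry (R : pzRingType) p q r (A : 'M[R]_(p, q)) (B : 'M[R]_(q, r)) i j :
  (A *m B) i j = (row i A *m B) 0 j.
Proof. by rewrite -row_mul [RHS]mxE. Qed.

Lemma surj_unitmx (R : fieldType) m (T : 'M[R]_m) : (forall u : 'rV_m, exists v, v *m T = u) -> T \in unitmx.
Proof.
move=> H; have [B HB] := choice (fun i => H (delta_mx 0 i)).
suff E : (\matrix_i B i) *m T = 1%:M by have [] := mulmx1_unit E.
by apply/row_matrixP => i; rewrite row_mul rowK row1.
Qed.

Section Quot.
Context {R : realType} {n : nat} {M : topologicalType}.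
Variable S : smooth_structure R n M.
Variables (D : set M) (f : M -> R).
Hypothesis F : ideal_frame S D [set: M] f.
Implicit Types (U V : set M) (g h : M -> R) (x : M).

(* The section [g / f] on the open sets where [g] is a section of the ideal. *)
Definition quot g x : R :=
  xget 0 [set r | exists V h, [/\ open V, V x, smooth_fun S V h, eqon V g (fun z => h z * f z) & h x = r]].

Lemma quot_unique V g h : open V -> smooth_fun S V h -> eqon V g (fun z => h z * f z) -> eqon V (quot g) h.
Proof.
move=> oV sh E x Vx; rewrite /quot; case: xgetP => [r _ [V' [h' [oV' Vx' sh' E' <-]]]|].
  have oW : open (V `&` V') by apply: openI.
  apply: (@ideal_frame_inj _ _ _ _ _ _ (V `&` V') _ _ _ F oW) => //.
  - by apply: smooth_fun_sub sh' => z [].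
  - by apply: smooth_fun_sub sh => z [].
  - by move=> z [Vz Vz']; rewrite -E' // E.
by move=> /(_ (h x)); case; exists V, h.
Qed.

Lemma quotP V g : open V -> vanishing S D V g ->
  smooth_fun S V (quot g) /\ eqon V g (fun z => quot g z * f z).
Proof.
move=> oV vg; have [_ fr] := F; have [h [sh E _]] := fr V g oV (@subsetT _ V) vg.
have Q := quot_unique oV sh E; split; last by move=> z Vz; rewrite Q // E.
by refine (smooth_fun_eq oV _ sh) => z Vz; rewrite Q.
Qed.

(** Every local section of the ideal is [h f], whose differential on [D] is [h df]. *)
Lemma frame_tangent x v : D x -> Defs.dfun S f x v = 0 -> tangent_to S D x v.
Proof.
move=> Dx dv U g oU Ux vg; have [_ fr] := F; have [h [sh E _]] := fr U g oU (@subsetT _ U) vg.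
have sf : smooth_fun S U f by have [[sf _] _] := F; apply: smooth_fun_sub sf.
rewrite (dfun_eq S oU Ux E) (dfunM _ oU Ux sh sf) dv mulr0 add0r.
by have [[_ ->]] := F; rewrite ?mul0r.
Qed.

End Quot.

Section Differential.
Context {R : realType} {n : nat} {M : topologicalType}.
Variable S : smooth_structure R n M.
Context {k : nat}.
Variable f : 'I_k -> M -> R.
Hypothesis sf : forall i, smooth_fun S [set: M] (f i).

Definition diff_mx x : 'M[R]_(n, k) := \matrix_(m, i) Defs.dfun S (f i) x (delta_mx 0 m).

Lemma diff_mxE x v i : Defs.dfun S (f i) x v = (v *m diff_mx x) 0 i.
Proof.
rewrite (dfun_grad _ openT Logic.I (sf i)) !mxE.
by apply: eq_bigr => m _; rewrite !mxE.
Qed.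

Lemma diff_mx_smooth U (X : @vfield R n M) : open U -> smooth_field S U X ->
  smooth_mx S U (fun x => X x *m diff_mx x).
Proof.
move=> oU HX i j; have sU := smooth_fun_sub (@subsetT _ U) (sf j).
by refine (smooth_fun_eq oU _ (dfun_smooth oU sU HX)) => x _; rewrite ord1 diff_mxE.
Qed.

End Differential.

Section Construction.
Context {R : realType} {n : nat} {M : topologicalType}.
Variable S : smooth_structure R n M.
Context {k : nat}.
Variable Z : 'I_k -> set M.
Variable f : 'I_k -> M -> R.
Hypothesis ff : forall i, ideal_frame S (Z i) [set: M] (f i).
Variables (nu : 'I_k -> @vfield R n M) (al : 'I_k -> M -> 'cV[R]_n).
Hypothesis sd : splitting_data S Z f nu al.
Implicit Types (c d : chart R n M) (U V : set M) (x : M) (X Y : @vfield R n M) (e : 'I_n -> @vfield R n M).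
Local Notation smx := (smooth_mx S).
Local Notation dfun := (dfun S).
Local Notation logf := (log_field S Z).
Local Notation logfr := (log_frame S Z).

Local Notation dmx := (diff_mx S f).
Definition covector_mx x : 'M[R]_(n, k) := \matrix_(m, i) al i x m 0.
Definition diag_fun x : 'M[R]_k := diag_mx (\row_i f i x).
Definition normal_mx x : 'M[R]_(k, n) := \matrix_j nu j x.

Let sff i : smooth_fun S [set: M] (f i) := frame_smooth ff i setT.
Let dmxE x v i : dfun (f i) x v = (v *m dmx x) 0 i := diff_mxE sff x v i.

Lemma covector_mxE x (v : 'rV[R]_n) i : (v *m al i x) 0 0 = (v *m covector_mx x) 0 i.
Proof. by rewrite !mxE; apply: eq_bigr => m _; rewrite !mxE. Qed.

Lemma mul_diag_fun p x (b : 'M[R]_(p, k)) j i : (b *m diag_fun x) j i = b j i * f i x.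
Proof. by rewrite mul_mx_diag !mxE. Qed.

Lemma splitting_isoE U X a v b : splitting_iso S f nu al U X a v b <->
  [/\ eqon U v (fun x => X x + a x *m normal_mx x), smooth_vec S U b &
      eqon U a (fun x => v x *m dmx x + (b x + v x *m covector_mx x) *m diag_fun x)].
Proof.
have E1 x : X x + \sum_j a x 0 j *: nu j x = X x + a x *m normal_mx x.
  by congr (_ + _); rewrite mulmx_sum_row; apply: eq_bigr => j _; rewrite rowK.
have E2 x i : dfun (f i) x (v x) + f i x * (b x 0 i + (v x *m al i x) 0 0)
    = (v x *m dmx x + (b x + v x *m covector_mx x) *m diag_fun x) 0 i.
  by rewrite !addmx_entry mul_diag_fun addmx_entry -dmxE -covector_mxE mulrC.
split=> -[H1 H2 H3]; split=> //.
- by move=> x Ux; rewrite H1.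
- by move=> x Ux; apply/rowP => i; rewrite -E2 H3.
- by move=> x Ux; rewrite H1.
- by move=> i x Ux; rewrite E2 -H3.
Qed.

(* The component [b] in [splitting_iso] for the fields of the frame [e] with [a = 0];
   [nu_quot] is that for [X = 0] and constant [a]. *)
Definition log_quot e x : 'M[R]_(n, k) :=
  \matrix_(l, i) quot S (f i) (fun z => - dfun (f i) z (e l z)) x - frame_mx e x *m covector_mx x.
Definition nu_quot x : 'M[R]_k :=
  \matrix_(j, i) quot S (f i) (fun z => (i == j)%:R - dfun (f i) z (nu j z)) x - normal_mx x *m covector_mx x.

(** [diag_fun x] is singular on the divisor, so nothing can be cancelled pointwise there. For smooth
    functions on an open set it can, because each [f i] is a frame. *)
Lemma diag_fun_inj p U (b b' : M -> 'M[R]_(p, k)) : open U -> smx U b -> smx U b' ->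
  eqon U (fun x => b x *m diag_fun x) (fun x => b' x *m diag_fun x) -> eqon U b b'.
Proof.
move=> oU sb sb' E x Ux; apply/matrixP => j i.
apply: (ideal_frame_inj (ff i) oU (@subsetT _ U) (sb j i) (sb' j i)) Ux => z Uz.
by rewrite -!mul_diag_fun E.
Qed.

Lemma covector_mx_smooth U X : open U -> smooth_field S U X -> smx U (fun x => X x *m covector_mx x).
Proof.
move=> oU HX i j; have [_ _ sal] := sd.
by refine (smooth_fun_eq oU _ (sal j U X oU HX)) => x _; rewrite ord1 covector_mxE.
Qed.

Lemma rows_smooth p q U (A : M -> 'M[R]_(p, q)) : open U ->
  (forall l, smx U (fun x => row l (A x))) -> smx U A.
Proof. by move=> oU H i j; refine (smooth_fun_eq oU _ (H i 0 j)) => x _; rewrite mxE. Qed.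

(** With [a = 0] the equation for [b] is [f_i b_i = - df_i(e_l) - f_i al_i(e_l)], and [df_i(e_l)] is
    divisible by [f_i] since [e_l] is tangent to [Z i]. *)
Lemma log_quotP U e : logfr U e ->
  smx U (log_quot e) /\
  eqon U (fun x => log_quot e x *m diag_fun x)
    (fun x => - (frame_mx e x *m dmx x) - frame_mx e x *m covector_mx x *m diag_fun x).
Proof.
move=> fr; have [oU le _ _] := fr.
have van l i : vanishing S (Z i) U (fun z => - dfun (f i) z (e l z)).
  have [sl tl] := le l; split; first exact: (smooth_funN oU (dfun_smooth oU (frame_smooth ff i U) sl)).
  by move=> x Ux Zx; rewrite (tl i x Ux Zx setT) ?oppr0 //; [exact: openT|case: (ff i)].
have Q l i := quotP (ff i) oU (van l i).
split.
  refine (smooth_mxD oU _ (smooth_mxN oU _)).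
    by move=> l i; refine (smooth_fun_eq oU _ (proj1 (Q l i))) => x _; rewrite mxE.
  apply: (rows_smooth oU) => l; have [sl _] := le l.
  by refine (smooth_mx_eq oU _ (covector_mx_smooth oU sl)) => x _; rewrite row_mul rowK.
move=> x Ux; rewrite /log_quot mulmxBl; congr (_ - _).
apply/matrixP => l i; rewrite mul_diag_fun mxE -(proj2 (Q l i) x Ux) [RHS]mxE; congr (- _).
by rewrite mulmx_entry rowK -dmxE.
Qed.

(** Here the function to divide by [f_i] is [delta_ij - df_i(nu_j)], which vanishes on [Z i] by the
    normalisation of [nu]. *)
Lemma nu_quotP : smx [set: M] nu_quot /\
  forall x, nu_quot x *m diag_fun x = 1%:M - normal_mx x *m dmx x - normal_mx x *m covector_mx x *m diag_fun x.
Proof.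
have [snu dnu _] := sd; have oU := @openT M.
have van j i : vanishing S (Z i) [set: M] (fun z => (i == j)%:R - dfun (f i) z (nu j z)).
  split; last by move=> x _ Zx; rewrite dnu // subrr.
  apply: (smooth_funD oU (@smooth_fun_cst _ _ _ S _ (i == j)%:R)).
  exact: (smooth_funN oU (dfun_smooth oU (frame_smooth ff i _) (snu j))).
have Q j i := quotP (ff i) oU (van j i).
split.
  refine (smooth_mxD oU _ (smooth_mxN oU _)).
    by move=> l i; refine (smooth_fun_eq oU _ (proj1 (Q l i))) => x _; rewrite mxE.
  apply: (rows_smooth oU) => l.
  by refine (smooth_mx_eq oU _ (covector_mx_smooth oU (snu l))) => x _; rewrite row_mul rowK.
move=> x; rewrite /nu_quot mulmxBl; congr (_ - _).
apply/matrixP => l i; rewrite mul_diag_fun mxE -(proj2 (Q l i) x Logic.I) addmx_entry !mxE eq_sym; congr (_ - _).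
by rewrite dmxE mxE; apply: eq_bigr => m _; rewrite [normal_mx x l m]mxE.
Qed.

(** [splitting_iso] determines [b] only implicitly, through [f b]. Here [(v, b)] becomes an explicit
    linear function of [a] and the coefficients of [X], with smooth matrices; both directions rest
    on [diag_fun_inj] or on the identity [key]. *)
Lemma splitting_coef U V e X a v b : logfr V e -> open U -> U `<=` V -> logf U X -> smooth_vec S U a ->
  (splitting_iso S f nu al U X a v b <->
   eqon U v (fun x => coef S e X x *m frame_mx e x + a x *m normal_mx x) /\
   eqon U b (fun x => coef S e X x *m log_quot e x + a x *m nu_quot x)).
Proof.
move=> fr oU UV HX sa; rewrite splitting_isoE.
have [sc cE] := coef_spec fr oU UV HX.
have [sQ QE] := log_quotP fr; have [sN NE] := nu_quotP.
pose b0 x := coef S e X x *m log_quot e x + a x *m nu_quot x.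
have sb0 : smx U b0.
  move/smooth_vec_mx: sc => sc; move/smooth_vec_mx: sa => sa.
  refine (smooth_mxD oU (smooth_mxM oU sc (smooth_mx_sub UV sQ)) _).
  exact: (smooth_mxM oU sa (smooth_mx_sub (@subsetT _ U) sN)).
have key x : U x -> b0 x *m diag_fun x = a x - (X x + a x *m normal_mx x) *m dmx x
     - (X x + a x *m normal_mx x) *m covector_mx x *m diag_fun x.
  move=> Ux; rewrite /b0 mulmxDl -!mulmxA NE QE //; last exact: UV.
  rewrite cE // lincombE !mulmxBr !mulmxDl mulmxN mulmx1 !mulmxA.
  move: (coef S e X x *m frame_mx e x) (a x *m normal_mx x) => C N.
  move: (C *m covector_mx x *m diag_fun x) (C *m dmx x) (N *m covector_mx x *m diag_fun x) (N *m dmx x) => p q r s.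
  by apply/rowP => i; rewrite !mxE; ring.
split=> [[vE sb aE]|[vE bE]].
- have vE' : eqon U v (fun x => coef S e X x *m frame_mx e x + a x *m normal_mx x).
    by move=> x Ux; rewrite vE // {1}cE // lincombE.
  split=> //; apply: (diag_fun_inj oU (proj1 (smooth_vec_mx _ _ _) sb) sb0) => x Ux.
  by rewrite key // -vE // {1}aE // mulmxDl; move: (v x *m dmx x) (b x *m diag_fun x) (v x *m covector_mx x *m diag_fun x) => p q r; apply/rowP => i; rewrite !mxE; ring.
- have vE' : eqon U v (fun x => X x + a x *m normal_mx x) by move=> x Ux; rewrite vE // -lincombE -cE.
  split=> //.
    by apply/smooth_vec_mx; refine (smooth_mx_eq oU _ sb0) => x Ux; rewrite bE.
  move=> x Ux; have K : b x *m diag_fun x = a x - v x *m dmx x - v x *m covector_mx x *m diag_fun x.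
    by rewrite bE // -/(b0 x) key // -vE'.
  by rewrite mulmxDl K subrK addrC subrK.
Qed.

(* In the frame [e], the map [(a', a, X) |-> (a', b, v)] given by [splitting_iso]. *)
Definition splitting_mx e x : 'M[R]_((k + k) + n) :=
  block_mx (block_mx 1%:M 0 0 (nu_quot x)) (col_mx 0 (normal_mx x)) (row_mx 0 (log_quot e x)) (frame_mx e x).

Lemma splitting_mx_row e x (a' a : 'rV[R]_k) (c : 'rV[R]_n) : row_mx (row_mx a' a) c *m splitting_mx e x =
  row_mx (row_mx a' (c *m log_quot e x + a *m nu_quot x)) (c *m frame_mx e x + a *m normal_mx x).
Proof.
rewrite /splitting_mx mul_row_block mul_row_block mul_row_col mul_mx_row !(mulmx0, mul0mx, addr0, add0r, mulmx1).
by rewrite add_row_mx addr0 addrC [X in row_mx _ X]addrC [X in row_mx (row_mx _ X) _]addrC.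
Qed.

Lemma diag_fun_smooth p U (b : M -> 'M[R]_(p, k)) : open U -> smx U b -> smx U (fun x => b x *m diag_fun x).
Proof.
move=> oU sb j i; refine (smooth_fun_eq oU _ (smooth_funM oU (sb j i) (frame_smooth ff i U))) => x _.
by rewrite mul_diag_fun.
Qed.

Lemma ex_log_section U v b : open U -> smooth_field S U v -> smooth_vec S U b ->
  exists X a, [/\ logf U X, smooth_vec S U a & splitting_iso S f nu al U X a v b].
Proof.
move=> oU sv sb; have [snu dnu _] := sd.
pose a x := v x *m dmx x + (b x + v x *m covector_mx x) *m diag_fun x.
have sa : smx U a.
  refine (smooth_mxD oU (diff_mx_smooth sff oU sv) (diag_fun_smooth oU _)).
  exact: (smooth_mxD oU (proj1 (smooth_vec_mx _ _ _) sb) (covector_mx_smooth oU sv)).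
pose X x := v x - a x *m normal_mx x.
have sX : smooth_field S U X.
  have sn : smooth_field S U (fun x => \sum_j a x 0 j *: nu j x).
    refine (@smooth_field_sum _ _ _ S U 'I_k _ predT (fun j x => a x 0 j) nu oU _) => j _; split; first exact: (sa 0 j).
    exact: smooth_field_sub (@subsetT _ U) (snu j).
  refine (smooth_field_eq oU _ (smooth_field_lin oU (@smooth_fun_cst _ _ _ S U (-1)) sn sv)) => x _.
  rewrite scaleN1r addrC /X; congr (_ - _); rewrite mulmx_sum_row; apply: eq_bigr => j _.
  by rewrite rowK.
exists X, a; split.
- split=> // i x Ux Zx; apply: (frame_tangent (ff i) Zx).
  rewrite dmxE /X mulmxBl addmx_entry.
  (* On [Z i], [df_i(nu_j)] is [delta_ij], so [df_i(X) = df_i(v) - a_i]; this is 0 because [f_i]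
     vanishes there. *)
  have E : (a x *m normal_mx x *m dmx x) 0 i = a x 0 i.
    rewrite -mulmxA mxE (bigD1 i) //= big1 => [|j ji].
      by rewrite mulmx_entry rowK -dmxE dnu // eqxx mulr1 addr0.
    by rewrite mulmx_entry rowK -dmxE dnu // eq_sym (negbTE ji) mulr0.
  have oppE (B : 'rV[R]_k) : (- B) 0 i = - B 0 i by rewrite mxE.
  rewrite oppE E /a addmx_entry mul_diag_fun.
  by have [[_ ->]] := ff i; rewrite ?mulr0 ?addr0 ?subrr.
- exact/smooth_vec_mx.
- by rewrite splitting_isoE; split=> // x _; rewrite subrK.
Qed.

(** Surjectivity at [x] suffices: a vector extends to a local section with constant coordinates in a
    chart, to which [ex_log_section] applies. *)
Lemma splitting_mx_unit V e x : logfr V e -> V x -> splitting_mx e x \in unitmx.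
Proof.
move=> fr Vx; have [oV _ _ _] := fr; apply: surj_unitmx => u.
rewrite -[u]hsubmxK -[lsubmx u]hsubmxK.
move: (lsubmx (lsubmx u)) (rsubmx (lsubmx u)) (rsubmx u) => a' b v.
pose c := chart_at S x; have Sc : smooth_chart S c := atlas_smooth (chart_at_atlas S x).
have Dx : dom c x := chart_at_dom S x.
have oU : open (V `&` dom c) by apply: openI => //; apply: dom_open.
pose v1 := chart_field S c (fun=> v *m jac S c x).
have sv : smooth_field S (V `&` dom c) v1.
  refine (chart_field_smooth oU Sc _ (@smooth_mx_cst _ _ _ S 1 n _ (v *m jac S c x))).
  by move=> z [].
have sb : smooth_vec S (V `&` dom c) (fun=> b) by move=> i; apply: smooth_fun_cst.
have [X [a [lX sa iso]]] := ex_log_section oU sv sb.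
have UV : V `&` dom c `<=` V by move=> z [].
have Ux : (V `&` dom c) x by [].
have [vE bE] := (splitting_coef v1 (fun=> b) fr oU UV lX sa).1 iso.
exists (row_mx (row_mx a' (a x)) (coef S e X x)); rewrite splitting_mx_row -bE // -vE //.
by rewrite /v1 /chart_field mulmxK // jac_unit.
Qed.

Definition ext1_mx (G : 'M[R]_n) : 'M[R]_((k + k) + n) := block_mx 1%:M 0 0 G.

Lemma ext1_row G (a' a : 'rV[R]_k) (c : 'rV[R]_n) : row_mx (row_mx a' a) c *m ext1_mx G = row_mx (row_mx a' a) (c *m G).
Proof. by rewrite /ext1_mx mul_row_block !(mulmx0, mulmx1, addr0, add0r). Qed.

(** The rows of [log_quot e] are the components [b] of the fields [e l] with [a = 0], a description
    that does not depend on the frame; [splitting_coef] evaluates it in [e']. *)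
Lemma splitting_mx_tr V V' e e' x : logfr V e -> logfr V' e' -> V x -> V' x ->
  splitting_mx e x = ext1_mx (frame_tr S e e' x) *m splitting_mx e' x.
Proof.
move=> fr fr' Vx Vx'; have [oV le _ _] := fr; have [oV' _ _ _] := fr'.
have oU : open (V `&` V') by apply: openI.
have UV : V `&` V' `<=` V by move=> z [].
have UV' : V `&` V' `<=` V' by move=> z [].
apply: row3_ext => a' a c; rewrite mulmxA ext1_row !splitting_mx_row (frame_tr_mxE fr fr') // mulmxA.
suff -> : log_quot e x = frame_tr S e e' x *m log_quot e' x by rewrite mulmxA.
apply/row_matrixP => l; rewrite row_mul rowK.
have lU : logf (V `&` V') (e l) by apply: log_field_sub (le l).
have sa : smooth_vec S (V `&` V') (fun=> 0 : 'rV[R]_k) by move=> i; apply: smooth_fun_cst.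
have iso : splitting_iso S f nu al (V `&` V') (e l) (fun=> 0) (e l) (fun z => row l (log_quot e z)).
  apply/(splitting_coef _ _ fr oU UV lU sa); split=> z [Vz Vz'].
    by rewrite (coef_frame fr) // -rowE rowK mul0mx addr0.
  by rewrite (coef_frame fr) // -rowE mul0mx addr0.
have [_ ->] := (splitting_coef _ _ fr' oU UV' lU sa).1 iso; last by [].
by rewrite mul0mx addr0.
Qed.

Section Twist.
Variables (I : @vfield R n M -> @vfield R n M).
Hypothesis cI : log_complex S Z I.

(** The pointwise matrix form of [transport]. *)
Definition intertwines e (J : M -> 'M[R]_((k + k) + n)) x :=
  splitting_mx e x *m J x = std_acs k (endo_mx S e I x) *m splitting_mx e x.

Lemma intertwines_change V V' e e' J x : logfr V e -> logfr V' e' -> V x -> V' x ->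
  intertwines e' J x -> intertwines e J x.
Proof.
move=> fr fr' Vx Vx' H; rewrite /intertwines (splitting_mx_tr fr fr') // -mulmxA H !mulmxA.
congr (_ *m _); apply: row3_ext => a' a c.
rewrite !mulmxA ext1_row !std_acs_row ext1_row -!mulmxA.
by rewrite (endo_mx_tr cI fr fr').
Qed.

(** The last clause of [constructed], for the given [f], [nu], [al] and [I]. *)
Definition transport (J : M -> 'M[R]_((k + k) + n)) :=
  forall U X (a a' : M -> 'rV[R]_k) v b v' b', open U -> logf U X -> smooth_vec S U a -> smooth_vec S U a' ->
    splitting_iso S f nu al U X a v b -> splitting_iso S f nu al U (I X) a' v' b' ->
    eqon U (fun x => row_mx (row_mx (a' x) (b x)) (v x) *m J x)
           (fun x => row_mx (row_mx (- a x) (b' x)) (v' x)).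

Lemma transport_intertwines J V e x : transport J -> logfr V e -> V x -> intertwines e J x.
Proof.
move=> H fr Vx; have [oV _ _ _] := fr; have VV := @subset_refl _ V.
apply: row3_ext => a' a c; rewrite !mulmxA.
have sc p (u : 'rV[R]_p) : smooth_vec S V (fun=> u) by move=> i; apply: smooth_fun_cst.
have lX := lincomb_log fr oV VV (sc _ c).
have [Il _ _ _] := cI oV; have lIX := Il _ lX.
have i1 := (splitting_coef _ _ fr oV VV lX (sc _ a)).2 (conj (fun _ _ => erefl) (fun _ _ => erefl)).
have i2 := (splitting_coef _ _ fr oV VV lIX (sc _ a')).2 (conj (fun _ _ => erefl) (fun _ _ => erefl)).
have := H V _ _ _ _ _ _ _ oV lX (sc _ a) (sc _ a') i1 i2 x Vx.
rewrite /= (endo_mxE cI fr oV VV lX) // (coef_lincomb fr oV VV (sc _ c)) //.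
by rewrite splitting_mx_row std_acs_row splitting_mx_row => ->.
Qed.

Lemma intertwines_transport J : (forall x, exists V e, [/\ logfr V e, V x & intertwines e J x]) -> transport J.
Proof.
move=> H U X a a' v b v' b' oU lX sa sa' i1 i2 x Ux.
have [V [e [fr Vx T]]] := H x; have [oV _ _ _] := fr.
have oW : open (U `&` V) by apply: openI.
have WU : U `&` V `<=` U by move=> z [].
have WV : U `&` V `<=` V by move=> z [].
have Wx : (U `&` V) x by [].
have lX' := log_field_sub WU lX; have [Il _ _ _] := cI oW; have lIX := Il _ lX'.
have res Y a1 v1 b1 : splitting_iso S f nu al U Y a1 v1 b1 -> splitting_iso S f nu al (U `&` V) Y a1 v1 b1.
  move=> [h1 h2 h3]; split; [by move=> z [/h1]|exact: smooth_vec_sub WU h2|by move=> i z [/h3]].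
have [vE bE] := (splitting_coef _ _ fr oW WV lX' (smooth_vec_sub WU sa)).1 (res _ _ _ _ i1).
have [vE' bE'] := (splitting_coef _ _ fr oW WV lIX (smooth_vec_sub WU sa')).1 (res _ _ _ _ i2).
rewrite vE // bE // vE' // bE' // -!splitting_mx_row -mulmxA T mulmxA std_acs_row.
by rewrite (endo_mxE cI fr oW WV lX').
Qed.

Lemma intertwines_sqr J V e x : logfr V e -> V x -> intertwines e J x -> J x *m J x = - 1%:M.
Proof.
move=> fr Vx H; have [oV le _ _] := fr; have uT := splitting_mx_unit fr Vx.
have sq : endo_mx S e I x *m endo_mx S e I x = - 1%:M.
  have VV := @subset_refl _ V; have [Il _ _ sI] := cI oV.
  apply/row_matrixP => l; rewrite row_mul rowK.
  rewrite -(endo_mxE cI fr oV VV (Il _ (le l))) //.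
  have HN : smooth_vec S V (fun=> - delta_mx 0 l : 'rV_n) by move=> i; apply: smooth_fun_cst.
  have -> : row l (- 1%:M) = - delta_mx 0 l :> 'rV[R]_n by rewrite -row1; apply/rowP => j; rewrite !mxE.
  apply: (coef_unique fr oV VV HN _ Vx).
  by move=> z Uz; rewrite (sI _ (le l)) // lincombE mulNmx -rowE rowK.
apply: (can_inj (mulKmx uT)).
by rewrite mulmxA H -mulmxA H mulmxA std_acs_sqr // mulNmx mul1mx mulmxN mulmx1.
Qed.

(** The entries of [J] refer to varying preferred charts, so [TM] is first read in the chart [c];
    there [J] is the conjugate of a smooth matrix by a smooth matrix. *)
Lemma intertwines_smooth J : (forall x, exists V e, logfr V e /\ V x) ->
  (forall x V e, logfr V e -> V x -> intertwines e J x) ->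
  forall c, smooth_chart S c -> smx (dom c) (end_in_chart S c J).
Proof.
move=> ex H c Sc; refine (smooth_mx_local _) => x Dx; have [V [e [fr Vx]]] := ex x.
have [oV le _ _] := fr; have oW : open (V `&` dom c) by apply: openI => //; apply: dom_open.
exists (V `&` dom c); split=> //.
(* The splitting isomorphism from the log frame [e] to the coordinates of [c]. *)
pose P z := splitting_mx e z *m ext1_mx (jac S c z).
have uP z : (V `&` dom c) z -> P z \in unitmx.
  move=> [Vz Dz]; rewrite unitmx_mul (splitting_mx_unit fr Vz) /ext1_mx unitmxE det_ublock det1 mul1r -unitmxE.
  exact: jac_unit.
have E : eqon (V `&` dom c) (fun z => invmx (P z) *m std_acs k (endo_mx S e I z) *m P z) (end_in_chart S c J).
  move=> z [Vz Dz]; have uT := splitting_mx_unit fr Vz; have uPz := uP z (conj Vz Dz).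
  apply: (can_inj (mulKmx uPz)).
  have uj : ext1_mx (jac S c z) \in unitmx.
    by move: uPz; rewrite unitmx_mul => /andP[].
  rewrite /end_in_chart -/(ext1_mx (jac S c z)) !mulmxA mulmxV // mul1mx /P mulmxK //.
  by congr (_ *m _); apply: esym; apply: (H z V e fr Vz).
refine (smooth_mx_eq oW E _).
have WV : V `&` dom c `<=` V by move=> z [].
have sP : smx (V `&` dom c) P.
  have PE : eqon (V `&` dom c) (fun z => block_mx (block_mx 1%:M 0 0 (nu_quot z)) (col_mx 0 (normal_mx z *m jac S c z))
     (row_mx 0 (log_quot e z)) (frame_mx e z *m jac S c z)) P.
    move=> z _; rewrite /P /splitting_mx /ext1_mx mulmx_block !(mulmx0, addr0, add0r, mulmx1).
    by rewrite mul_col_mx mul0mx.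
  refine (smooth_mx_eq oW PE _).
  have [sN _] := nu_quotP; have [sL _] := log_quotP fr; have [snu _ _] := sd.
  have s0 p q : smx (V `&` dom c) (fun=> 0 : 'M[R]_(p, q)) by exact: smooth_mx_cst.
  have s1 p : smx (V `&` dom c) (fun=> 1%:M : 'M[R]_p) by exact: smooth_mx_cst.
  refine (smooth_block_mx oW (smooth_block_mx oW (s1 _) (s0 _ _) (s0 _ _) (smooth_mx_sub (@subsetT _ _) sN)) _ _ _).
  - refine (smooth_col_mx oW (s0 _ _) (rows_smooth oW _)) => j.
    have := field_smooth_mx (@openT M) Sc (snu j); rewrite setTI => h.
    refine (smooth_mx_eq oW _ (smooth_mx_sub (@subIsetr _ _ _) h)) => z _.
    by rewrite row_mul rowK.
  - exact: (smooth_row_mx oW (s0 _ _) (smooth_mx_sub WV sL)).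
  - refine (rows_smooth oW _) => l; have [sl _] := le l.
    refine (smooth_mx_eq oW _ (field_smooth_mx oV Sc sl)) => z _.
    by rewrite row_mul rowK.
have sS : smx (V `&` dom c) (fun z => std_acs k (endo_mx S e I z)).
  have s0 p q : smx (V `&` dom c) (fun=> 0 : 'M[R]_(p, q)) by exact: smooth_mx_cst.
  refine (smooth_block_mx oW (@smooth_mx_cst _ _ _ S _ _ _ _) (s0 _ _) (s0 _ _) _).
  exact: smooth_mx_sub WV (endo_mx_smooth cI fr).
exact: (smooth_mxM oW (smooth_mxM oW (smooth_invmx oW uP sP) sS) sP).
Qed.

(** The intertwining equation at [x] in one frame determines [J x], and [intertwines_change] carries
    it to all the others. *)
Lemma ex_intertwining : (forall x, exists V e, logfr V e /\ V x) ->
  exists J, forall x V e, logfr V e -> V x -> intertwines e J x.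
Proof.
move=> ex.
have H x : exists Jx, forall V e, logfr V e -> V x -> intertwines e (fun=> Jx) x.
  have [V [e [fr Vx]]] := ex x.
  exists (invmx (splitting_mx e x) *m std_acs k (endo_mx S e I x) *m splitting_mx e x) => V' e' fr' Vx'.
  apply: (intertwines_change fr' fr Vx' Vx).
  by rewrite /intertwines !mulmxA mulmxV ?mul1mx // (splitting_mx_unit fr Vx).
have [J HJ] := choice H; exists J => x V e fr Vx.
exact: (HJ x V e fr Vx).
Qed.

End Twist.

End Construction.

Section StableAcs.
Context {R : realType} {n : nat} {M : topologicalType}.
Variable S : smooth_structure R n M.

Lemma stable_acs_smooth p (J : M -> 'M[R]_(p + n)) : (forall x, J x *m J x = - 1%:M) ->
  (forall c, atlas S c -> smooth_mx S (dom c) (end_in_chart S c J)) -> stable_acs S J.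
Proof.
move=> sq sm; split=> // c Ac i j.
have := smooth_fun_via (dom_open c) (atlas_smooth Ac) (sm c Ac i j).
by rewrite /smooth_via setIid.
Qed.

End StableAcs.

(** * Homotopies *)

Section ContinuousMatrix.
Context {R : realType} {T : topologicalType}.
Variable q : T.

Definition cont_mx p r (F : T -> 'M[R]_(p, r)) := forall i j, {for q, continuous (fun z => F z i j)}.

Lemma cont_big (I : Type) (op : R -> R -> R) (x0 : R) (s : seq I) (F : I -> T -> R) :
  (forall f g : T -> R, {for q, continuous f} -> {for q, continuous g} -> {for q, continuous (fun z => op (f z) (g z))}) ->
  (forall i, {for q, continuous (F i)}) -> {for q, continuous (fun z => \big[op/x0]_(i <- s) F i z)}.
Proof.
move=> cop cF; have cst : {for q, continuous (fun _ : T => x0)} by apply: cst_continuous.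
elim: s => [|i s IH].
  by rewrite (_ : (fun z => _) = fun=> x0) //; apply/funext => z; rewrite big_nil.
rewrite (_ : (fun z => _) = fun z => op (F i z) (\big[op/x0]_(i <- s) F i z)); first exact: cop.
by apply/funext => z; rewrite big_cons.
Qed.

Lemma cont_mxM p r s (F : T -> 'M[R]_(p, r)) (G : T -> 'M[R]_(r, s)) : cont_mx F -> cont_mx G ->
  cont_mx (fun z => F z *m G z).
Proof.
move=> cF cG i j; rewrite (_ : (fun z => _) = fun z => \sum_l F z i l * G z l j).
  apply: cont_big => [f g cf cg|l]; first exact: cvgD.
  by apply: cvgM; [exact: cF|exact: cG].
by apply/funext => z; rewrite mxE.
Qed.

Lemma cont_mxD p r (F G : T -> 'M[R]_(p, r)) : cont_mx F -> cont_mx G -> cont_mx (fun z => F z + G z).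
Proof.
move=> cF cG i j; rewrite (_ : (fun z => _) = fun z => F z i j + G z i j).
  by apply: cvgD; [exact: cF|exact: cG].
by apply/funext => z; rewrite mxE.
Qed.

Lemma cont_mxZ p r (f : T -> R) (F : T -> 'M[R]_(p, r)) : {for q, continuous f} -> cont_mx F ->
  cont_mx (fun z => f z *: F z).
Proof.
move=> cf cF i j; rewrite (_ : (fun z => _) = fun z => f z * F z i j).
  by apply: cvgM; [exact: cf|exact: cF].
by apply/funext => z; rewrite mxE.
Qed.

Lemma cont_mx_cst p r (B : 'M[R]_(p, r)) : cont_mx (fun=> B).
Proof. by move=> i j; apply: cst_continuous. Qed.

Lemma cont_det p (F : T -> 'M[R]_p) : cont_mx F -> {for q, continuous (fun z => \det (F z))}.
Proof.
move=> cF; apply: cont_big => [f g cf cg|s]; first exact: cvgD.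
apply: cvgM; first exact: cst_continuous.
by apply: cont_big => [f g cf cg|i]; [exact: cvgM|exact: cF].
Qed.

Lemma cont_invmx p (F : T -> 'M[R]_p) : F q \in unitmx -> cont_mx F -> cont_mx (fun z => invmx (F z)).
Proof.
move=> uF cF i j.
have d0 : \det (F q) != 0 by rewrite -unitfE -unitmxE.
have cd := cont_det cF.
pose f z := (\det (F z))^-1 * ((-1) ^+ (j + i) * \det (row' j (col' i (F z)))).
have nE : \forall z \near q, f z = invmx (F z) i j.
  have : \forall z \near q, \det (F z) != 0 by apply: (cd [set t | t != 0]); apply: open_nbhs_nbhs; split=> //; exact: open_neq.
  apply: filterS => z dz; rewrite /f /invmx ifT; first by rewrite !mxE.
  by rewrite unitmxE unitfE.
have cf : f z @[z --> q] --> invmx (F q) i j.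
  have -> : invmx (F q) i j = f q by rewrite (nbhs_singleton nE).
  apply: cvgM; first exact: cvgV.
  apply: cvgM; first exact: cst_continuous.
  apply: cont_det => a b.
  rewrite (_ : (fun z => _) = fun z => F z (lift j a) (lift i b)); first exact: cF.
  by apply/funext => z; rewrite !mxE.
apply: cvg_trans cf; exact: near_eq_cvg.
Qed.

Lemma cont_mx_continuous p r (F : T -> 'M[R]_(p, r)) : cont_mx F -> {for q, continuous F}.
Proof.
move=> cF; apply/cvg_ballP => e e0.
have : \forall z \near q, forall i, forall j, ball (F q i j) e (F z i j).
  apply: near_all => i; apply: near_all => j.
  by have /cvg_ballP := cF i j; apply.
by apply: filterS => z Hz; split=> // i j; apply: Hz.
Qed.

End ContinuousMatrix.

(* From [J] to [J'], by interpolating between [J] and [g^-1 J' g] while the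
   conjugation by [g] is undone along the segment from 1 to [g]. *)
Definition acs_path (R : realFieldType) N (t : R) (J J' g : 'M[R]_N) : 'M[R]_N :=
  let gt := (1 - t) *: 1%:M + t *: g in
  gt *m cs_interp t J (invmx g *m J' *m g) *m invmx gt.

Section AcsPath.
Context {R : realFieldType} {N : nat}.
Implicit Types (J g T : 'M[R]_N).

Lemma acs_path0 J J' g : J *m J = - 1%:M -> acs_path 0 J J' g = J.
Proof.
move=> J2; rewrite /acs_path subr0 scale1r scale0r addr0 cs_interp0 //.
by rewrite invmx1 mul1mx mulmx1.
Qed.

Lemma conj_sqr J g : g \in unitmx -> J *m J = - 1%:M ->
  (invmx g *m J *m g) *m (invmx g *m J *m g) = - 1%:M.
Proof.
move=> ug J2; rewrite !mulmxA mulmxK // -[invmx g *m J *m J]mulmxA J2.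
by rewrite mulmxN mulmx1 mulNmx mulVmx.
Qed.

Lemma acs_path1 J J' g : g \in unitmx -> cs_mid 1 J (invmx g *m J' *m g) \in unitmx ->
  J *m J = - 1%:M -> J' *m J' = - 1%:M -> acs_path 1 J J' g = J'.
Proof.
move=> ug uK J2 J2'; rewrite /acs_path subrr scale0r scale1r add0r cs_interp1 //; last exact: conj_sqr.
by rewrite !mulmxA mulmxV // mul1mx mulmxK.
Qed.

Lemma acs_path_sqr t J J' g : (1 - t) *: 1%:M + t *: g \in unitmx ->
  cs_mid t J (invmx g *m J' *m g) \in unitmx -> J *m J = - 1%:M ->
  acs_path t J J' g *m acs_path t J J' g = - 1%:M.
Proof.
have sq (G C : 'M[R]_N) : G \in unitmx -> C *m C = - 1%:M ->
    G *m C *m invmx G *m (G *m C *m invmx G) = - 1%:M.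
  move=> uG C2; rewrite !mulmxA mulmxKV // -(mulmxA G C C) C2 mulmxN mulmx1 mulNmx mulmxV //.
by move=> ug uK J2; apply: sq => //; apply: cs_interp_sqr.
Qed.

Definition mx_conj T A : 'M[R]_N := invmx T *m A *m T.

Lemma mx_conjM T A B : T \in unitmx -> mx_conj T (A *m B) = mx_conj T A *m mx_conj T B.
Proof. by move=> uT; rewrite /mx_conj !mulmxA mulmxK. Qed.

Lemma mx_conj1 T : T \in unitmx -> mx_conj T 1%:M = 1%:M.
Proof. by move=> uT; rewrite /mx_conj mulmx1 mulVmx. Qed.

Lemma mx_conj_unit T A : T \in unitmx -> (mx_conj T A \in unitmx) = (A \in unitmx).
Proof. by move=> uT; rewrite /mx_conj !unitmx_mul unitmx_inv uT andbT. Qed.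

(* No condition on [A], because [invmx] is the identity outside [unitmx]. *)
Lemma mx_conjV T A : T \in unitmx -> mx_conj T (invmx A) = invmx (mx_conj T A).
Proof.
move=> uT; have [uA|nA] := boolP (A \in unitmx); last first.
  by rewrite !invmx_out // ?inE ?mx_conj_unit.
have uC : mx_conj T A \in unitmx by rewrite mx_conj_unit.
by apply: (can_inj (mulKmx uC)); rewrite mulmxV // -mx_conjM // mulmxV // mx_conj1.
Qed.

Lemma mx_conj_lin T a b A B : mx_conj T (a *: A + b *: B) = a *: mx_conj T A + b *: mx_conj T B.
Proof. by rewrite /mx_conj mulmxDr mulmxDl -!(scalemxAl, scalemxAr). Qed.

(** The path is built from algebraic operations, so reading it in a chart gives the path between the
    chart expressions, where smoothness and continuity are tested. *)
Lemma acs_path_conj t J J' g T : T \in unitmx ->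
  mx_conj T (acs_path t J J' g) = acs_path t (mx_conj T J) (mx_conj T J') (mx_conj T g).
Proof.
move=> uT; rewrite /acs_path /cs_interp !mx_conjM // !mx_conjV // /cs_mid !mx_conj_lin mx_conj1 //.
by rewrite !mx_conjM // mx_conjV.
Qed.

End AcsPath.

Section Homotopy.
Context {R : realType} {n : nat} {M : topologicalType}.
Variable S : smooth_structure R n M.
Local Notation smx := (smooth_mx S).

Lemma acs_path_homotopic p (J J' g : M -> 'M[R]_(p + n)) :
  (forall x, J x *m J x = - 1%:M) -> (forall x, J' x *m J' x = - 1%:M) ->
  (forall c, atlas S c -> smx (dom c) (end_in_chart S c J)) ->
  (forall c, atlas S c -> smx (dom c) (end_in_chart S c J')) ->
  (forall c, atlas S c -> smx (dom c) (end_in_chart S c g)) ->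
  (forall t x, 0 <= t <= 1 -> (1 - t) *: 1%:M + t *: g x \in unitmx) ->
  (forall t x, 0 <= t <= 1 -> cs_mid t (J x) (invmx (g x) *m J' x *m g x) \in unitmx) ->
  homotopic_acs S J J'.
Proof.
move=> J2 J2' sJ sJ' sg ugt uK.
have ug x : g x \in unitmx.
  by have := ugt 1 x; rewrite ler01 lexx subrr scale0r scale1r add0r; apply.
pose T c x : 'M[R]_(p + n) := block_mx 1%:M 0 0 (jac S c x).
have uT c x : atlas S c -> dom c x -> T c x \in unitmx.
  move=> Ac Dx; rewrite /T unitmxE det_ublock det1 mul1r -unitmxE.
  by apply: jac_unit => //; apply: atlas_smooth.
pose cj c (A : M -> 'M[R]_(p + n)) x := end_in_chart S c A x.
have cE c t x : atlas S c -> dom c x ->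
    cj c (fun x => acs_path t (J x) (J' x) (g x)) x = acs_path t (cj c J x) (cj c J' x) (cj c g x).
  by move=> Ac Dx; exact: (acs_path_conj t _ _ _ (uT c x Ac Dx)).
have ugc c x : atlas S c -> dom c x -> cj c g x \in unitmx.
  move=> Ac Dx; have := mx_conj_unit (g x) (uT c x Ac Dx); rewrite ug; exact.
have ugtc c t x : atlas S c -> dom c x -> 0 <= t <= 1 -> (1 - t) *: 1%:M + t *: cj c g x \in unitmx.
  move=> Ac Dx t01; have := mx_conj_unit ((1 - t) *: 1%:M + t *: g x) (uT c x Ac Dx).
  rewrite ugt //.
  by rewrite mx_conj_lin mx_conj1 // uT.
have uKc c t x : atlas S c -> dom c x -> 0 <= t <= 1 ->
    cs_mid t (cj c J x) (invmx (cj c g x) *m cj c J' x *m cj c g x) \in unitmx.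
  move=> Ac Dx t01; have uTx := uT c x Ac Dx; have := mx_conj_unit (cs_mid t (J x) (invmx (g x) *m J' x *m g x)) uTx.
  rewrite uK //.
  by rewrite /cs_mid mx_conj_lin !mx_conjM // mx_conjV.
exists (fun t x => acs_path t (J x) (J' x) (g x)); split.
- by apply/funext => x; apply: acs_path0.
- apply/funext => x; apply: acs_path1 => //; apply: uK; by rewrite ler01 lexx.
- move=> t t01; apply: stable_acs_smooth.
    by move=> x; apply: acs_path_sqr; [exact: ugt|exact: uK|exact: J2].
  move=> c Ac; have oD := dom_open c.
  refine (smooth_mx_eq oD (fun x Dx => esym (cE c t x Ac Dx)) _).
  have sZ (a : R) q (A : M -> 'M[R]_q) : smx (dom c) A -> smx (dom c) (fun x => a *: A x).
    by move=> sA; exact: (smooth_mxZ oD (@smooth_fun_cst _ _ _ S _ a) sA).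
  have sgt : smx (dom c) (fun x => (1 - t) *: 1%:M + t *: cj c g x).
    by refine (smooth_mxD oD (sZ _ _ _ (@smooth_mx_cst _ _ _ S _ _ _ _)) (sZ _ _ _ (sg c Ac))).
  have sC : smx (dom c) (fun x => invmx (cj c g x) *m cj c J' x *m cj c g x).
    refine (smooth_mxM oD (smooth_mxM oD _ (sJ' c Ac)) (sg c Ac)).
    by refine (smooth_invmx oD _ (sg c Ac)) => x; apply: ugc.
  have sK : smx (dom c) (fun x => cs_mid t (cj c J x) (invmx (cj c g x) *m cj c J' x *m cj c g x)).
    by refine (smooth_mxD oD (sZ _ _ _ (sJ c Ac)) (sZ _ _ _ sC)).
  refine (smooth_mxM oD (smooth_mxM oD sgt (smooth_mxM oD (smooth_mxM oD _ (sJ c Ac)) sK)) _).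
    by refine (smooth_invmx oD _ sK) => x Dx; apply: uKc.
  by refine (smooth_invmx oD _ sgt) => x Dx; apply: ugtc.
- move=> c Ac; apply: continuous_in_subspaceT => q; rewrite inE => -[/= t01 Dq].
  have cs p1 r1 (A : M -> 'M[R]_(p1, r1)) : smx (dom c) A -> cont_mx q (fun z : R * M => A z.2).
    move=> sA i j.
    apply: (@continuous_comp _ _ _ (snd : R * M -> M) (fun x => A x i j)); first exact: cvg_snd.
    exact: (smooth_fun_continuous (dom_open c) Dq (sA i j)).
  have ct : {for q, continuous (fun z : R * M => z.1)} by exact: cvg_fst.
  have cJ := cs _ _ _ (sJ c Ac); have cJ' := cs _ _ _ (sJ' c Ac); have cg := cs _ _ _ (sg c Ac).
  pose F z := acs_path z.1 (cj c J z.2) (cj c J' z.2) (cj c g z.2).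
  have cgt : cont_mx q (fun z : R * M => (1 - z.1) *: 1%:M + z.1 *: cj c g z.2).
    apply: cont_mxD; apply: cont_mxZ => //; last exact: cont_mx_cst.
    by apply: cvgB => //; exact: cst_continuous.
  have cC : cont_mx q (fun z : R * M => invmx (cj c g z.2) *m cj c J' z.2 *m cj c g z.2).
    by apply: cont_mxM => //; apply: cont_mxM => //; apply: cont_invmx => //; apply: ugc.
  have cK : cont_mx q (fun z : R * M => cs_mid z.1 (cj c J z.2) (invmx (cj c g z.2) *m cj c J' z.2 *m cj c g z.2)).
    apply: cont_mxD; apply: cont_mxZ => //.
    by apply: cvgB => //; exact: cst_continuous.
  have cF : cont_mx q F.
    apply: cont_mxM; last by apply: cont_invmx => //; apply: ugtc.
    apply: cont_mxM => //; apply: cont_mxM => //; apply: cont_mxM => //.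
    by apply: cont_invmx => //; apply: uKc.
  have nE : \forall z \near q, F z = cj c (fun x => acs_path z.1 (J x) (J' x) (g x)) z.2.
    have : \forall z \near q, dom c z.2.
      have : (z.2 : M) @[z --> q] --> q.2 by exact: cvg_snd.
      by apply; apply: open_nbhs_nbhs; split=> //; apply: dom_open.
    by apply: filterS => z Dz; rewrite cE.
  have := cont_mx_continuous cF.
  rewrite /prop_for /continuous_at (nbhs_singleton nE) => H.
  by apply: cvg_trans H; apply: near_eq_cvg.
Qed.

End Homotopy.

(** * Comparison of two constructions of [J] *)

Section Periods.
Context {R : realType} {n : nat} {M : topologicalType}.
Variable S : smooth_structure R n M.
Context {k : nat}.
Variable Z : 'I_k -> set M.
Variable f : 'I_k -> M -> R.
Hypothesis ff : forall i, ideal_frame S (Z i) [set: M] (f i).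
Variables (nu : 'I_k -> @vfield R n M) (al : 'I_k -> M -> 'cV[R]_n).
Hypothesis sd : splitting_data S Z f nu al.
Implicit Types (U V : set M) (x : M) (e : 'I_n -> @vfield R n M).
Local Notation logfr := (log_frame S Z).

Definition fst_mx : 'M[R]_((k + k) + n, k) := col_mx (col_mx 1%:M 0) 0.
(* [(a', b, v) |-> a], for the [a] that [splitting_iso] relates to [(v, b)]. *)
Definition snd_mx x : 'M[R]_((k + k) + n, k) :=
  col_mx (col_mx 0 (diag_fun f x)) (diff_mx S f x + covector_mx al x *m diag_fun f x).

Lemma fst_mx_row (a' b : 'rV[R]_k) v : row_mx (row_mx a' b) v *m fst_mx = a'.
Proof. by rewrite /fst_mx !mul_row_col !mulmx0 mulmx1 !addr0. Qed.

Lemma snd_mx_row x (a' b : 'rV[R]_k) v : row_mx (row_mx a' b) v *m snd_mx x =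
  v *m diff_mx S f x + (b + v *m covector_mx al x) *m diag_fun f x.
Proof.
rewrite /snd_mx !mul_row_col mulmx0 add0r mulmxDr mulmxDl !mulmxA.
by rewrite addrCA.
Qed.

Lemma splitting_mx_fst e x (a' a : 'rV[R]_k) c : row_mx (row_mx a' a) c *m splitting_mx S f nu al e x *m fst_mx = a'.
Proof. by rewrite splitting_mx_row fst_mx_row. Qed.

Lemma splitting_mx_snd V e x (a' a : 'rV[R]_k) c : logfr V e -> V x ->
  row_mx (row_mx a' a) c *m splitting_mx S f nu al e x *m snd_mx x = a.
Proof.
move=> fr Vx; rewrite splitting_mx_row snd_mx_row.
have [_ QE] := log_quotP ff sd fr; have [_ NE] := nu_quotP ff sd.
rewrite !mulmxDl -(mulmxA c (log_quot _ _ _ _ _)) QE // -(mulmxA a (nu_quot _ _ _ _ _)) NE.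
rewrite !mulmxBr mulmxN mulmx1 !mulmxA.
move: (c *m frame_mx e x) (a *m normal_mx nu x) => C N.
move: (C *m covector_mx al x *m diag_fun f x) (C *m diff_mx S f x) (N *m covector_mx al x *m diag_fun f x) (N *m diff_mx S f x) => p q r s.
by apply/rowP => i; rewrite !mxE; ring.
Qed.

(** With [intertwines_snd]: [J] exchanges the functionals [a'] and [a] up to sign, whatever [I] is.
    In [mid_unit] this is what the two structures have in common. *)
Lemma intertwines_fst I J V e x : logfr V e -> V x -> intertwines S f nu al I e J x ->
  J x *m fst_mx = - snd_mx x.
Proof.
move=> fr Vx H; apply: (can_inj (mulKmx (splitting_mx_unit ff sd fr Vx))).
apply: row3_ext => a' a c; rewrite mulmxN mulmxN.
rewrite [X in _ = - X]mulmxA (splitting_mx_snd _ _ _ fr Vx).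
by rewrite [splitting_mx _ _ _ _ _ _ *m _]mulmxA H !mulmxA std_acs_row splitting_mx_fst.
Qed.

Lemma intertwines_snd I J V e x : logfr V e -> V x -> intertwines S f nu al I e J x ->
  J x *m snd_mx x = fst_mx.
Proof.
move=> fr Vx H; apply: (can_inj (mulKmx (splitting_mx_unit ff sd fr Vx))).
apply: row3_ext => a' a c.
rewrite [RHS]mulmxA splitting_mx_fst [splitting_mx _ _ _ _ _ _ *m _]mulmxA H !mulmxA std_acs_row.
by rewrite (splitting_mx_snd _ _ _ fr Vx).
Qed.

End Periods.

Section Compare.
Context {R : realType} {n : nat} {M : topologicalType}.
Variable S : smooth_structure R n M.
Context {k : nat}.
Variable Z : 'I_k -> set M.
Variable w : @vfield R n M -> @vfield R n M -> M -> R.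
Hypothesis w2 : log_form2 S Z w.
Hypothesis ex_fr : forall x, exists V e, log_frame S Z V e /\ V x.
Variables f f' : 'I_k -> M -> R.
Hypothesis ff : forall i, ideal_frame S (Z i) [set: M] (f i).
Hypothesis ff' : forall i, ideal_frame S (Z i) [set: M] (f' i).
Variables (nu nu' : 'I_k -> @vfield R n M) (al al' : 'I_k -> M -> 'cV[R]_n).
Hypothesis sd : splitting_data S Z f nu al.
Hypothesis sd' : splitting_data S Z f' nu' al'.
Variable h : 'I_k -> M -> R.
Hypothesis sh : forall i, smooth_fun S [set: M] (h i).
Hypothesis hf : forall i x, f' i x = h i x * f i x.
Hypothesis h0 : forall i x, 0 < h i x.
Variables (I I' : @vfield R n M -> @vfield R n M).
Hypotheses (cI : log_compatible S Z w I) (cI' : log_compatible S Z w I').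
Variables J J' : M -> 'M[R]_((k + k) + n).
Hypothesis tJ : forall x V e, log_frame S Z V e -> V x -> intertwines S f nu al I e J x.
Hypothesis tJ' : forall x V e, log_frame S Z V e -> V x -> intertwines S f' nu' al' I' e J' x.
Implicit Types (U V : set M) (x : M) (e : 'I_n -> @vfield R n M).
Local Notation logfr := (log_frame S Z).
Local Notation smx := (smooth_mx S).

Lemma diag_funM (u v : 'I_k -> M -> R) x : diag_fun u x *m diag_fun v x = diag_fun (fun i z => u i z * v i z) x.
Proof. by rewrite /diag_fun mulmx_diag; congr diag_mx; apply/rowP => i; rewrite !mxE. Qed.

Definition hinv x := diag_fun (fun i z => (h i z)^-1) x.

Lemma diag_fun'_hinv x : diag_fun f' x *m hinv x = diag_fun f x.
Proof.
rewrite /hinv diag_funM /diag_fun; congr diag_mx; apply/rowP => i; rewrite !mxE hf mulrAC mulfV ?mul1r //.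
by rewrite gt_eqF.
Qed.

Lemma hinvK x : diag_fun h x *m hinv x = 1%:M.
Proof.
rewrite /hinv diag_funM /diag_fun -[RHS]/(1%:M) -diag_const_mx; congr diag_mx; apply/rowP => i; rewrite !mxE mulfV //.
by rewrite gt_eqF.
Qed.

Lemma diff_mx' x : diff_mx S f' x = diff_mx S f x *m diag_fun h x + diff_mx S h x *m diag_fun f x.
Proof.
apply/matrixP => m i; rewrite addmx_entry !mul_diag_fun !mxE.
have -> : f' i = fun z => h i z * f i z by apply/funext => z; rewrite hf.
rewrite (dfunM _ openT Logic.I (sh i) (frame_smooth ff i setT)).
by rewrite mulrC [X in _ + X]mulrC.
Qed.

Lemma hinv_comm x : diag_fun f x *m hinv x = hinv x *m diag_fun f x.
Proof. by rewrite /hinv !diag_funM; congr (diag_fun _ _); apply/funext => i; apply/funext => z; rewrite mulrC. Qed.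

(** For a log field the component [b_i] is [- df_i / f_i - al_i]. Since
    [df'_i / f'_i = df_i / f_i + dh_i / h_i], this matrix is the difference between the components
    for the two data. *)
Definition shear x : 'M[R]_(n, k) := covector_mx al' x - covector_mx al x + diff_mx S h x *m hinv x.

(* It sends a vector with component [a] for the second data to one with component
   [a / h] for the first data, and is the identity on log fields. *)
Definition comparison x : 'M[R]_((k + k) + n) :=
  block_mx (block_mx (hinv x) 0 0 1%:M) 0 (row_mx 0 (shear x)) 1%:M.

Lemma comparison_row x (a' b : 'rV[R]_k) v : row_mx (row_mx a' b) v *m comparison x =
  row_mx (row_mx (a' *m hinv x) (b + v *m shear x)) v.
Proof.
rewrite /comparison !mul_row_block mul_mx_row !(mulmx0, mulmx1, addr0, add0r).
by rewrite add_row_mx addr0.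
Qed.

Lemma comparison_snd x : comparison x *m snd_mx S f al x = snd_mx S f' al' x *m hinv x.
Proof.
apply: row3_ext => a' b v; rewrite !mulmxA comparison_row !snd_mx_row diff_mx' /shear.
rewrite !(mulmxDr, mulmxDl, mulmxN, mulNmx) !mulmxA.
rewrite -!(mulmxA _ (diag_fun h x) (hinv x)) hinvK mulmx1.
rewrite -!(mulmxA _ (diag_fun f' x) (hinv x)) diag_fun'_hinv.
rewrite -!(mulmxA _ (diag_fun f x) (hinv x)) hinv_comm !mulmxA.
move: (v *m diff_mx S f x) (b *m diag_fun f x) (v *m covector_mx al x *m diag_fun f x) (v *m covector_mx al' x *m diag_fun f x).
move: (v *m diff_mx S h x *m hinv x *m diag_fun f x) => p q r s t.
by apply/rowP => i; rewrite !mxE; ring.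
Qed.

Lemma comparison_fst x : comparison x *m fst_mx = fst_mx *m hinv x.
Proof. by apply: row3_ext => a' b v; rewrite !mulmxA comparison_row !fst_mx_row. Qed.

Lemma shear_smooth U X : open U -> smooth_field S U X -> smx U (fun x => X x *m shear x).
Proof.
move=> oU HX.
have E : eqon U (fun x => X x *m covector_mx al' x - X x *m covector_mx al x + X x *m diff_mx S h x *m hinv x)
    (fun x => X x *m shear x).
  by move=> x _; rewrite /shear mulmxDr mulmxBr mulmxA.
have sb := covector_mx_smooth sd oU HX; have sb' := covector_mx_smooth sd' oU HX.
have sd1 := diff_mx_smooth sh oU HX.
have s3 : smx U (fun x => X x *m diff_mx S h x *m hinv x).
  move=> i j; have sj : smooth_fun S U (fun x => (h j x)^-1).
    apply: (smooth_funV oU _ (smooth_fun_sub (@subsetT _ U) (sh j))) => x _.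
    by rewrite gt_eqF.
  refine (smooth_fun_eq oU _ (smooth_funM oU (sd1 i j) sj)) => x _.
  by rewrite mul_diag_fun.
exact: (smooth_mx_eq oU E (smooth_mxD oU (smooth_mxD oU sb' (smooth_mxN oU sb)) s3)).
Qed.

(** An identity between quotients: it is verified after multiplication by [f] and [h], and
    [diag_fun_inj] removes [f], also on the divisor. *)
Lemma log_quot_shear V e x : logfr V e -> V x ->
  log_quot S f' al' e x + frame_mx e x *m shear x = log_quot S f al e x.
Proof.
move=> fr; have [oV le _ _] := fr.
have [sQ QE] := log_quotP ff sd fr; have [sQ' QE'] := log_quotP ff' sd' fr.
have s2 : smx V (fun x => log_quot S f' al' e x + frame_mx e x *m shear x).
  refine (smooth_mxD oV sQ' (rows_smooth oV _)) => l; have [sl _] := le l.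
  refine (smooth_mx_eq oV _ (shear_smooth oV sl)) => z _.
  by rewrite row_mul rowK.
have fE x' : diag_fun f' x' = diag_fun f x' *m diag_fun h x'.
  by rewrite diag_funM; congr (diag_fun _ _); apply/funext => i; apply/funext => z; rewrite hf mulrC.
have uH x' : diag_fun h x' \in unitmx by have [] := mulmx1_unit (hinvK x').
suff E : eqon V (fun x => (log_quot S f' al' e x + frame_mx e x *m shear x) *m diag_fun f x)
    (fun x => log_quot S f al e x *m diag_fun f x) by move/(diag_fun_inj ff oV s2 sQ E).
move=> x' Vx'; apply: (can_inj (mulmxK (uH x'))).
have c1 p (X : 'M[R]_(p, k)) : X *m hinv x' *m diag_fun f x' *m diag_fun h x' = X *m diag_fun f x'.
  by rewrite -(mulmxA X) -hinv_comm mulmxA -(mulmxA _ (hinv x')) (mulmx1C (hinvK x')) mulmx1.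
rewrite -[LHS]mulmxA -fE mulmxDl QE' // QE // diff_mx' fE /shear.
move: (frame_mx e x') => E; rewrite !(mulmxDr E, mulmxBr E) !mulmxA.
rewrite !(mulmxBl, mulmxDl, mulmxN, mulNmx) c1.
move: (E *m diff_mx S f x' *m diag_fun h x') (E *m diff_mx S h x' *m diag_fun f x')
  (E *m covector_mx al' x' *m diag_fun f x' *m diag_fun h x') (E *m covector_mx al x' *m diag_fun f x' *m diag_fun h x') => p q r s.
by apply/matrixP => l i; rewrite !mxE; ring.
Qed.

(** The endomorphism is triangular with diagonal entries 1 and [(1 - t) + t / h_i]. Positivity of
    [h_i], that is agreement of the orientations, keeps the latter away from 0. *)
Lemma segment_unit t x : 0 <= t <= 1 -> (1 - t) *: 1%:M + t *: comparison x \in unitmx.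
Proof.
move=> /andP[t0 t1]; apply: ker0_unitmx => u.
rewrite -[u]hsubmxK -[lsubmx u]hsubmxK.
move: (lsubmx (lsubmx u)) (rsubmx (lsubmx u)) (rsubmx u) => a' b v.
rewrite mulmxDr -!scalemxAr mulmx1 comparison_row !scale_row_mx !add_row_mx.
rewrite -!row_mx0 => /eq_row_mx [/eq_row_mx [Ea Eb] Ev].
have v0 : v = 0 by move: Ev; rewrite -scalerDl subrK scale1r.
have b0 : b = 0 by move: Eb; rewrite v0 mul0mx addr0 -scalerDl subrK scale1r.
have a0 : a' = 0.
  apply/rowP => i; move/rowP: Ea => /(_ i); rewrite addmx_entry.
  have sE (s : R) (B : 'rV[R]_k) : (s *: B) 0 i = s * B 0 i by rewrite mxE.
  rewrite !sE mul_diag_fun [RHS]mxE [in X in _ -> X]mxE => /eqP.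
  rewrite mulrCA mulrC -mulrDr mulf_eq0 => /orP[/eqP //|/eqP E]; exfalso.
  have hp : 0 < (h i x)^-1 by rewrite invr_gt0.
  have : 0 < (1 - t) + t * (h i x)^-1.
    have [->|tn] := eqVneq t 0; first by rewrite mul0r subr0 addr0.
    by rewrite ltr_wpDl ?subr_ge0 // mulr_gt0 // lt_neqAle eq_sym tn.
  by rewrite E ltxx.
by rewrite a0 b0 v0.
Qed.

Lemma comparison_unit x : comparison x \in unitmx.
Proof. by have := @segment_unit 1 x; rewrite ler01 lexx subrr scale0r scale1r add0r; apply. Qed.

(** The comparison respects the two embeddings of [T_Z M] given by [a' = a = 0]; in [mid_unit] this
    lets [I'] be read through the first data. *)
Lemma log_row V e x (c : 'rV[R]_n) : logfr V e -> V x ->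
  row_mx (row_mx 0 0) c *m splitting_mx S f' nu' al' e x *m comparison x = row_mx (row_mx 0 0) c *m splitting_mx S f nu al e x.
Proof.
move=> fr Vx; rewrite !splitting_mx_row comparison_row !mul0mx !addr0.
by rewrite -(log_quot_shear fr Vx) (mulmxDr c (log_quot S f' al' e x)) (mulmxA c (frame_mx e x)).
Qed.

Lemma mid_unit t x : 0 <= t <= 1 ->
  cs_mid t (J x) (invmx (comparison x) *m J' x *m comparison x) \in unitmx.
Proof.
move=> t01; have [V [e [fr Vx]]] := ex_fr x.
set g := comparison x; have ug : g \in unitmx := comparison_unit x.
set J2 := invmx g *m J' x *m g.
have gJ : g *m J2 = J' x *m g by rewrite /J2 !mulmxA mulmxV // mul1mx.
have tx := tJ fr Vx; have tx' := tJ' fr Vx.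
have J2fst : J2 *m fst_mx = - snd_mx S f al x.
  apply: (can_inj (mulKmx ug)); rewrite mulmxA gJ -mulmxA comparison_fst mulmxA.
  by rewrite (intertwines_fst ff' sd' fr Vx tx') mulmxN comparison_snd mulNmx.
have J2snd : J2 *m snd_mx S f al x = fst_mx.
  apply: (can_inj (mulKmx ug)); rewrite mulmxA gJ -mulmxA comparison_snd mulmxA.
  by rewrite (intertwines_snd ff' sd' fr Vx tx') comparison_fst.
apply: ker0_unitmx => u H.
have uT := splitting_mx_unit ff sd fr Vx.
have uE : u = u *m invmx (splitting_mx S f nu al e x) *m splitting_mx S f nu al e x by rewrite mulmxKV.
move: (u *m invmx _) uE => y uE.
(* Both structures act in the same way on these functionals, so the weights [2 - t] and [t] add up
   to 2 and each functional vanishes on [u]. *)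
have H1 : u *m snd_mx S f al x = 0.
  have : u *m cs_mid t (J x) J2 *m fst_mx = 0 by rewrite H mul0mx.
  rewrite -mulmxA /cs_mid mulmxDl -!scalemxAl (intertwines_fst ff sd fr Vx tx) J2fst.
  rewrite -scalerDl subrK -scalemxAr mulmxN => /eqP.
  by rewrite scaler_eq0 pnatr_eq0 oppr_eq0 /= => /eqP.
have H2 : u *m fst_mx = 0.
  have : u *m cs_mid t (J x) J2 *m snd_mx S f al x = 0 by rewrite H mul0mx.
  rewrite -mulmxA /cs_mid mulmxDl -!scalemxAl (intertwines_snd ff sd fr Vx tx) J2snd.
  rewrite -scalerDl subrK -scalemxAr => /eqP.
  by rewrite scaler_eq0 pnatr_eq0 /= => /eqP.
move: uE; rewrite -[y]hsubmxK -[lsubmx y]hsubmxK.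
move: (lsubmx (lsubmx y)) (rsubmx (lsubmx y)) (rsubmx y) => a' a c uE.
have a'0 : a' = 0 by rewrite -H2 uE splitting_mx_fst.
have a0 : a = 0 by rewrite -H1 uE (splitting_mx_snd ff sd _ _ _ fr Vx).
move: uE; rewrite a'0 a0 => uE.
have uJ : u *m J x = row_mx (row_mx 0 0) (c *m endo_mx S e I x) *m splitting_mx S f nu al e x.
  by rewrite uE -mulmxA tx mulmxA std_acs_row oppr0.
(* [u] now lies in the image of [T_Z M], where by [log_row] the conjugate of [J'] acts as [I']. *)
have uJ2 : u *m J2 = row_mx (row_mx 0 0) (c *m endo_mx S e I' x) *m splitting_mx S f nu al e x.
  have R1 (d : 'rV[R]_n) : row_mx (row_mx 0 0) d *m splitting_mx S f nu al e x = row_mx (row_mx 0 0) d *m splitting_mx S f' nu' al' e x *m g.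
    by rewrite (log_row d fr Vx).
  rewrite uE !R1 -(mulmxA _ g J2) gJ (mulmxA _ (J' x) g) -(mulmxA _ _ (J' x)) tx'.
  by rewrite mulmxA std_acs_row oppr0.
have c0 : c *m cs_mid t (endo_mx S e I x) (endo_mx S e I' x) = 0.
  have : row_mx (row_mx 0 0) (c *m cs_mid t (endo_mx S e I x) (endo_mx S e I' x)) *m splitting_mx S f nu al e x = 0.
    rewrite -{1}H /cs_mid !mulmxDr -!scalemxAr uJ uJ2 !scalemxAl -mulmxDl.
    by rewrite !scale_row_mx !add_row_mx !scaler0 !addr0 -!scalemxAl.
  rewrite -{1}(mul0mx _ (splitting_mx S f nu al e x)) => /(can_inj (mulmxK uT)).
  by rewrite -row_mx0 => /eq_row_mx [].
have [_ _ p1] := endo_mx_compat w2 cI fr Vx; have [_ _ p2] := endo_mx_compat w2 cI' fr Vx.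
have cc : c = 0.
  by rewrite -[c](mulmxK (cs_mid_unit t01 p1 p2)) c0 mul0mx.
by rewrite uE cc !row_mx0 mul0mx.
Qed.

(** Only [shear] takes a tangent vector as argument, so it is the only block that changes when [TM]
    is read in the chart. *)
Lemma comparison_smooth c : smooth_chart S c -> smx (dom c) (end_in_chart S c comparison).
Proof.
move=> Sc; have oD := dom_open c.
pose P x : 'M[R]_(n, k) := invmx (jac S c x) *m shear x.
have E : eqon (dom c) (fun x => block_mx (block_mx (hinv x) 0 0 1%:M) 0 (row_mx 0 (P x)) 1%:M)
    (end_in_chart S c comparison).
  move=> x Dx; have uj := jac_unit Sc Dx.
  have uE : ext1_mx (k := k) (jac S c x) \in unitmx.
    by rewrite /ext1_mx unitmxE det_ublock det1 mul1r -unitmxE.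
  rewrite /end_in_chart -/(ext1_mx (k := k) (jac S c x)).
  apply: (can_inj (mulKmx uE)); rewrite !mulmxA mulmxV // mul1mx.
  apply: row3_ext => a' b v; rewrite !mulmxA ext1_row -/(comparison x) comparison_row ext1_row.
  rewrite !mul_row_block mul_mx_row !(mulmx0, mulmx1, addr0, add0r) add_row_mx addr0.
  by rewrite /P mulmxA mulmxK.
refine (smooth_mx_eq oD E _).
have s0 p q : smx (dom c) (fun=> 0 : 'M[R]_(p, q)) by exact: smooth_mx_cst.
have s1 p : smx (dom c) (fun=> 1%:M : 'M[R]_p) by exact: smooth_mx_cst.
have sH : smx (dom c) hinv.
  move=> i j.
  have sj : smooth_fun S (dom c) (fun x => (h j x)^-1).
    apply: (smooth_funV oD _ (smooth_fun_sub (@subsetT _ _) (sh j))) => x _.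
    by rewrite gt_eqF.
  have sc := @smooth_fun_cst _ _ _ S (dom c) ((i == j)%:R).
  refine (smooth_fun_eq oD _ (smooth_funM oD sc sj)) => x _.
  rewrite /hinv /diag_fun !mxE; case: eqP => [->|_]; first by rewrite mul1r.
  by rewrite mul0r.
have sP : smx (dom c) P.
  refine (rows_smooth oD _) => m.
  have sX := chart_field_smooth oD Sc (@subset_refl _ _) (@smooth_mx_cst _ _ _ S 1 n _ (delta_mx 0 m)).
  refine (smooth_mx_eq oD _ (shear_smooth oD sX)) => x _.
  by rewrite /P row_mul rowE.
exact: (smooth_block_mx oD (smooth_block_mx oD sH (s0 _ _) (s0 _ _) (s1 _)) (s0 _ _) (smooth_row_mx oD (s0 _ _) sP) (s1 _)).
Qed.

Lemma compared_homotopic : homotopic_acs S J J'.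
Proof.
have sqJ x : J x *m J x = - 1%:M.
  have [V [e [fr Vx]]] := ex_fr x; have [c _ _] := cI.
  exact: (intertwines_sqr ff sd c fr Vx (tJ fr Vx)).
have sqJ' x : J' x *m J' x = - 1%:M.
  have [V [e [fr Vx]]] := ex_fr x; have [c _ _] := cI'.
  exact: (intertwines_sqr ff' sd' c fr Vx (tJ' fr Vx)).
have [c1 _ _] := cI; have [c2 _ _] := cI'.
apply: (acs_path_homotopic sqJ sqJ' _ _ _ segment_unit mid_unit).
- by move=> c /atlas_smooth Sc; exact: (intertwines_smooth ff sd c1 ex_fr tJ Sc).
- by move=> c /atlas_smooth Sc; exact: (intertwines_smooth ff' sd' c2 ex_fr tJ' Sc).
- by move=> c /atlas_smooth Sc; exact: comparison_smooth.
Qed.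

End Compare.

Theorem corollary3p15 (R : realType) (n : nat) (M : topologicalType)
    (S : smooth_structure R n M)
    (hM : hausdorff_space M) (cM : @second_countable M)
    (connM : connected [set: M])
    (k : nat) (Z : 'I_k -> set M)
    (w : @vfield R n M -> @vfield R n M -> M -> R)
    (hw : log_symplectic S Z w)
    (hZ : forall i, exists f, global_defining S (Z i) f) :
  (exists (p : nat) (J : M -> 'M[R]_(p + n)), stable_acs S J) /\
  (forall O : 'I_k -> M -> (M -> R) -> Prop,
    (forall i, orientation S (Z i) (O i)) ->
    (exists J : M -> 'M[R]_((k + k) + n),
       stable_acs S J /\ constructed S Z w O J) /\
    (forall J J' : M -> 'M[R]_((k + k) + n),
       constructed S Z w O J -> constructed S Z w O J' ->
       homotopic_acs S J J')).
Proof.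
have [ncZ w2 _ nd] := hw; have [gf gfP] := choice hZ.
have ex_fr := ex_log_frame ncZ gfP.
have [I cI] : exists I, log_compatible S Z w I.
  have [pU H] := choice ex_fr; have [pe pfr] := choice H.
  have [A Aok] := ex_endo hM cM w2 nd pfr.
  by exists (endo_of S pe A); apply: (endo_of_compatible w2 pfr Aok).
have gfF i := global_defining_frame (gf := gf) ncZ gfP (gfP i).
have ex O : (forall i, orientation S (Z i) (O i)) ->
    exists J : M -> 'M[R]_((k + k) + n), stable_acs S J /\ constructed S Z w O J.
  move=> HO.
  have [f fP] := choice (fun i => ex_positive_frame connM (gfF i) (HO i)).
  have ff i : ideal_frame S (Z i) [set: M] (f i) by have [] := fP i.
  have [nu [al sd]] := ex_splitting_data hM cM ncZ gfP ff.
  have [lI _ _] := cI.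
  have [J tJ] := ex_intertwining ff sd lI ex_fr.
  exists J; split.
    apply: stable_acs_smooth => [x|c Ac].
      have [V [e [fr Vx]]] := ex_fr x.
      exact: (intertwines_sqr ff sd lI fr Vx (tJ x V e fr Vx)).
    exact: (intertwines_smooth ff sd lI ex_fr tJ (atlas_smooth Ac)).
  exists f, nu, al, I; split=> //.
  apply: (intertwines_transport ff sd lI) => x; have [V [e [fr Vx]]] := ex_fr x.
  by exists V, e; split=> //; apply: tJ fr Vx.
split.
  (* The bundles are oriented by the given defining functions. *)
  have [J [sJ _]] := ex _ (fun i => frame_orientation (gfF i)).
  by exists (k + k)%N, J.
move=> O HO; split; first exact: ex HO.
move=> J J' [f [nu [al [I1 [fP sd cI1 tJ]]]]] [f' [nu' [al' [I2 [fP' sd' cI2 tJ']]]]].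
have ff i : ideal_frame S (Z i) [set: M] (f i) by have [] := fP i.
have ff' i : ideal_frame S (Z i) [set: M] (f' i) by have [] := fP' i.
have [h hP] := choice (fun i => positive_frame_ratio (HO i) (fP i) (fP' i)).
have sh i : smooth_fun S [set: M] (h i) by have [] := hP i.
have hf i x : f' i x = h i x * f i x by have [_ H _] := hP i.
have h0 i x : 0 < h i x by have [_ _ H] := hP i.
have [l1 _ _] := cI1; have [l2 _ _] := cI2.
apply: (compared_homotopic w2 ex_fr ff ff' sd sd' sh hf h0 cI1 cI2).
- by move=> x V e fr Vx; exact: (transport_intertwines ff sd l1 tJ fr Vx).
- by move=> x V e fr Vx; exact: (transport_intertwines ff' sd' l2 tJ' fr Vx).
Qed.
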